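(* Let $g\in\mathcal G$ be conjugate to a reduced word of the form $f_1^{-1}\cdots f_m^{-1}\,\tilde r_1\,f_m\cdots f_1\,\tilde r_0$, where $\tilde r_0,\tilde r_1$ are involutions, each affine or elementary. Then $g$ is conjugate in $\mathcal G$ to a cyclically-reduced map of one of the following forms (for some $m'\ge 0$): (N_aa) $(h_1^{-1}\cdots h_{m'}^{-1})\,t\,(h_{m'}\cdots h_1)\,t$, if $\tilde r_0$ and $\tilde r_1$ are both affine; (N_ea) $(h_1^{-1}\cdots h_{m'}^{-1})\,e_{m'+1}\,(h_{m'}\cdots h_1)\,t$, if one of $\tilde r_0,\tilde r_1$ is affine and the other elementary; (N_ee) $(t\,h_1^{-1}\cdots h_{m'}^{-1})\,e_{m'+1}\,(h_{m'}\cdots h_1\,t)\,e_0$, if $\tilde r_0$ and $\tilde r_1$ are both elementary; where each $h_i$ is a generalized H\'enon transformation and $e_0,e_{m'+1}$ are elementary involutions. Furthermore one may require that the H\'enon transformations $h_i=t\,e_i$ ($i=1,\dots,m'$) be normal and that the involutions $e_0,e_{m'+1}$ be in the normal forms for elementary involutions; with these requirements the resulting composition is unique up to a finite number of choices.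
   Context: $\mathcal G$ is the group of polynomial automorphisms of $\mathbb C^2$; $\mathcal E$ the elementary maps $(x,y)\mapsto(\alpha x+p(y),\beta y+\eta)$, $\alpha\beta\ne0$; $\mathcal A$ the affine automorphisms; $\mathcal S=\mathcal A\cap\mathcal E$; $t(x,y)=(y,x)$. A reduced word is $g_k\cdots g_1$ with $g_i\in(\mathcal E\cup\mathcal A)\setminus\mathcal S$ and consecutive factors in different subgroups $\mathcal A$, $\mathcal E$; it is cyclically reduced if moreover $k\ge2$ and $g_k,g_1$ are not in the same subgroup (or trivially if the map is in $\mathcal A\cup\mathcal E$). A generalized H\'enon transformation is $h(x,y)=(y,p(y)-\delta x)$, $\delta\ne0$, $\deg p\ge2$, so $h=t\,e$ with $e$ elementary; it is normal if $p(y)=y^l+O(y^{l-2})$. Normal forms of elementary involutions (of degree $l\ge2$): $(x,y)\mapsto(-x+p(y),y)$ with $p(y)=y^l+O(y^{l-2})$; $(x,y)\mapsto(x+p(y),-y)$ with $p$ odd with leading coefficient $1$; $(x,y)\mapsto(-x+p(y),-y)$ with $p$ even with leading coefficient $1$. *)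

(* Defs.v *)
From mathcomp Require Import all_boot all_algebra.
From mathcomp Require Import Rstruct complex.
From mathcomp Require Import ring.

Set Implicit Arguments.
Unset Strict Implicit.
Unset Printing Implicit Defensive.

Import GRing.Theory.
Local Open Scope ring_scope.

Definition C : Type := complex Rdefinitions.R.

Definition map2 := (C * C -> C * C)%type.

(* evaluation of a bivariate polynomial P(x,y) : {poly {poly C}}
   (outer variable y, coefficients polynomials in x) at (x,y) *)
Definition ev2 (P : {poly {poly C}}) (z : C * C) : C := (P.[z.2%:P]).[z.1].

Definition polymap (f : map2) : Prop :=
  exists P Q : {poly {poly C}}, forall z, f z = (ev2 P z, ev2 Q z).

Definition isG (f : map2) : Prop :=
  polymap f /\ exists g : map2, polymap g /\ g \o f =1 id /\ f \o g =1 id.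

Definition isElem (f : map2) : Prop :=
  exists (al be eta : C) (p : {poly C}), al != 0 /\ be != 0 /\
    forall x y, f (x, y) = (al * x + p.[y], be * y + eta).

Definition isAff (f : map2) : Prop :=
  exists a b c d u v : C, a * d - b * c != 0 /\
    forall x y, f (x, y) = (a * x + b * y + u, c * x + d * y + v).

Definition isS (f : map2) : Prop := isAff f /\ isElem f.

Definition tsw : map2 := fun z => (z.2, z.1).

Definition involution (f : map2) : Prop := f \o f =1 id.

(* a word g_k ... g_1 is the list [:: g_k; ...; g_1]; its value is the
   composition g_k \o ... \o g_1 *)
Definition compw (w : seq map2) : map2 := foldr (fun f acc => f \o acc) id w.

Definition letter (f : map2) : Prop := (isAff f \/ isElem f) /\ ~ isS f.

Definition same_subgroup (f g : map2) : Prop :=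
  (isAff f /\ isAff g) \/ (isElem f /\ isElem g).

Definition reduced (w : seq map2) : Prop :=
  (0 < size w)%N /\
  (forall i, (i < size w)%N -> letter (nth id w i)) /\
  (forall i, (i.+1 < size w)%N -> ~ same_subgroup (nth id w i) (nth id w i.+1)).

Definition cyc_reduced (w : seq map2) : Prop :=
  reduced w /\ (2 <= size w)%N /\ ~ same_subgroup (head id w) (last id w).

Definition cred_map (f : map2) : Prop :=
  isAff f \/ isElem f \/ exists w, cyc_reduced w /\ f =1 compw w.

Definition conjG (g f : map2) : Prop :=
  exists phi psi : map2, isG phi /\ psi \o phi =1 id /\ phi \o psi =1 id /\
    g =1 phi \o f \o psi.

Definition henon (d : C * {poly C}) : map2 :=
  fun z => (z.2, d.2.[z.2] - d.1 * z.1).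

Definition henon_inv (d : C * {poly C}) : map2 :=
  fun z => ((d.2.[z.1] - z.2) / d.1, z.1).

Definition henon_data (d : C * {poly C}) : Prop :=
  d.1 != 0 /\ (2 < size d.2)%N.

Definition henon_normal (d : C * {poly C}) : Prop :=
  henon_data d /\ d.2 \is monic /\ d.2`_(size d.2 - 2) = 0.

Definition einv (d : nat * {poly C}) : map2 :=
  fun z => match d.1 with
           | 0 => (- z.1 + d.2.[z.2], z.2)
           | 1 => (z.1 + d.2.[z.2], - z.2)
           | _ => (- z.1 + d.2.[z.2], - z.2)
           end.

Definition einv_normal (d : nat * {poly C}) : Prop :=
  (d.1 < 3)%N /\ (2 < size d.2)%N /\ d.2 \is monic /\
  match d.1 with
  | 0 => d.2`_(size d.2 - 2) = 0
  | 1 => forall i, ~~ odd i -> d.2`_i = 0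
  | _ => forall i, odd i -> d.2`_i = 0
  end.

(* hs = [:: h_1; ...; h_m'] (as Henon data) *)
Definition hinvs (hs : seq (C * {poly C})) : seq map2 := map henon_inv hs.
Definition hrevs (hs : seq (C * {poly C})) : seq map2 := map henon (rev hs).

Definition N_aa (hs : seq (C * {poly C})) : map2 :=
  compw (hinvs hs ++ [:: tsw] ++ hrevs hs ++ [:: tsw]).

Definition N_ea (hs : seq (C * {poly C})) (e1 : nat * {poly C}) : map2 :=
  compw (hinvs hs ++ [:: einv e1] ++ hrevs hs ++ [:: tsw]).

Definition N_ee (hs : seq (C * {poly C})) (e0 e1 : nat * {poly C}) : map2 :=
  compw ([:: tsw] ++ hinvs hs ++ [:: einv e1] ++ hrevs hs ++ [:: tsw; einv e0]).

Definition all_normal (hs : seq (C * {poly C})) : Prop :=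
  forall h, h \in hs -> henon_normal h.

Lemma henon_invK d : d.1 != 0 -> henon_inv d \o henon d =1 id /\ henon d \o henon_inv d =1 id.
Proof.
case: d => de p /= Hd; split => -[x y] /=; rewrite /henon /henon_inv /=.
- by congr pair; field.
- by congr pair; field.
Qed.

(* Main.v *)
(* Writing affine maps as s t s' with s, s' triangular turns every tame automorphism into a
   word c t x1 t x2 ... t xn in elementary letters, and a word whose inner letters are not
   affine is nontrivial by a degree count. By Jung's theorem every polynomial automorphism is
   tame. Its proof degenerates the G_a-action s |-> psi(P, Q + s) preserving the coordinate P:
   for each system of weights one gets nonconstant polynomial curves on which the leading form
   of P is constant. Hence this form is c (y^a - l x^b)^g with a = 1 or b = 1, and a shear
   lowers the degree of P.

   If two cyclic words are conjugate by phi, cancelling letters of phi against the words makes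
   phi a diagonal affine map, after rotating the words. Normal letters leave only finitely many
   such diagonal maps: the scalings satisfy c_(nu j) = K_j c_j^(l_j) with l_j >= 2. Conversely,
   letters are normalized by inserting diagonal maps between them, from right to left; the
   remaining condition at the ends is one monomial equation, solvable over C. *)
Require Import Defs.
From mathcomp Require Import all_boot all_order all_algebra.
From mathcomp Require Import Rstruct complex polyXY.
From mathcomp Require Import ring zify boolp.
Set Implicit Arguments.
Unset Strict Implicit.
Unset Printing Implicit Defensive.
Import Order.TTheory GRing.Theory Num.Theory.
Local Open Scope ring_scope.

(** * Degeneration of coordinates *)

(** Degrees at least 2 carry both halves of the result. The scales of the inserted diagonal maps are
    linked by power relations whose exponents are the degrees of the nonaffine letters. Since these
    exceed 1, iteration around a cyclic word yields equations between two different powers of one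
    scale, with finitely many nonzero solutions; for the same reason the two sides of the end
    equation a z^m = b z^n have m < n, so a nonzero z exists. The G_a-action is useful because it
    moves every point: along an orbit P is fixed while Q grows by s. The rate at which s is rescaled
    must be the smallest slope of the Newton polygon of the orbit; any other rate makes the limit
    curve collapse to a point or blow up. The obstacle in comparing cyclic words is that phi may
    begin and end with affine letters, so the word of W'^-1 phi W phi^-1 can fail to be reduced at
    both ends of phi. Rotating W or W' moves such a letter to a place where it is absorbed. *)

Definition polyfun (f : C -> C) := exists p : {poly C}, forall v, f v = p.[v].

Lemma polyfun_cst (c : C) : polyfun (fun=> c).
Proof. by exists c%:P => v; rewrite hornerC. Qed.

Lemma polyfun_id : polyfun id.
Proof. by exists 'X => v; rewrite hornerX. Qed.

Lemma polyfunD f g : polyfun f -> polyfun g -> polyfun (fun v => f v + g v).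
Proof. by move=> [p hp] [q hq]; exists (p + q) => v; rewrite hornerD hp hq. Qed.

Lemma polyfunN f : polyfun f -> polyfun (fun v => - f v).
Proof. by move=> [p hp]; exists (- p) => v; rewrite hornerN hp. Qed.

Lemma polyfunM f g : polyfun f -> polyfun g -> polyfun (fun v => f v * g v).
Proof. by move=> [p hp] [q hq]; exists (p * q) => v; rewrite hornerM hp hq. Qed.

Lemma polyfunX f n : polyfun f -> polyfun (fun v => f v ^+ n).
Proof. by move=> [p hp]; exists (p ^+ n) => v; rewrite horner_exp hp. Qed.

Lemma polyfun_comp f (p : {poly C}) : polyfun f -> polyfun (fun v => p.[f v]).
Proof. by move=> [q hq]; exists (p \Po q) => v; rewrite horner_comp hq. Qed.

Lemma polyfun_sum (I : Type) (r : seq I) (F : I -> C -> C) :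
  (forall i, polyfun (F i)) -> polyfun (fun v => \sum_(i <- r) F i v).
Proof.
move=> h; elim: r => [|i r [p hp]].
  by exists 0 => v; rewrite big_nil horner0.
have [q hq] := h i.
by exists (q + p) => v; rewrite big_cons hornerD hp hq.
Qed.

Lemma polyfun_prod (I : Type) (r : seq I) (F : I -> C -> C) :
  (forall i, polyfun (F i)) -> polyfun (fun v => \prod_(i <- r) F i v).
Proof.
move=> h; elim: r => [|i r [p hp]].
  by exists 1 => v; rewrite big_nil hornerC.
have [q hq] := h i.
by exists (q * p) => v; rewrite big_cons hornerM hp hq.
Qed.

Lemma polyC_inj_fun (p q : {poly C}) : (forall v, p.[v] = q.[v]) -> p = q.
Proof.
move=> h; apply/eqP; rewrite -subr_eq0; apply/eqP.
apply: (@roots_geq_poly_eq0 _ _ [seq (i%:R : C) | i <- iota 0 (size (p - q))]).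
- by apply/allP => z _; rewrite rootE hornerD hornerN h subrr.
- rewrite map_inj_uniq ?iota_uniq // => i j /eqP.
  by rewrite eqr_nat => /eqP.
- by rewrite size_map size_iota.
Qed.

Lemma poly_eq0_punctured (p : {poly C}) : (forall v, v != 0 -> p.[v] = 0) -> p = 0.
Proof.
move=> h; have : p * 'X = 0.
  apply: polyC_inj_fun => v; rewrite hornerM hornerX horner0.
  by have [->|/h ->] := eqVneq v 0; rewrite ?mulr0 ?mul0r.
by move/eqP; rewrite mulf_eq0 polyX_eq0 orbF => /eqP.
Qed.

Lemma polyfun_eq_punctured f g : polyfun f -> polyfun g ->
  (forall v, v != 0 -> f v = g v) -> forall v, f v = g v.
Proof.
move=> [p hp] [q hq] h v; rewrite hp hq.
suff /eqP : p - q = 0 by rewrite subr_eq0 => /eqP ->.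
apply: poly_eq0_punctured => u /h.
by rewrite hp hq hornerD hornerN => ->; rewrite subrr.
Qed.

Lemma ev2E (P : {poly {poly C}}) x y :
  ev2 P (x, y) = \sum_(j < size P) \sum_(i < sizeY P) P`_j`_i * x ^+ i * y ^+ j.
Proof.
rewrite /ev2 /= (horner_coef P) horner_sum; apply: eq_bigr => j _.
rewrite hornerM -polyC_exp hornerC (horner_coef_wide _ (n := sizeY P)) ?mulr_suml //.
exact: max_size_coefXY.
Qed.

(* Laurent polynomials in u, polynomials in s; only u != 0 matters *)
Definition laur (f : C -> C -> C) := exists M (A : {poly {poly C}}),
  forall u s, u != 0 -> f u s * u ^+ M = ev2 A (u, s).

Lemma laur_cst c : laur (fun _ _ => c).
Proof. by exists 0%N, c%:P%:P => u s _; rewrite /ev2 /= !hornerC mulr1. Qed.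

Lemma laur_snd : laur (fun _ s => s).
Proof. by exists 0%N, 'X => u s _; rewrite /ev2 /= hornerX hornerC mulr1. Qed.

Lemma laur_fstVX k : laur (fun u _ => u ^- k).
Proof.
by exists k, 1 => u s u0; rewrite /ev2 /= !hornerC mulVf // expf_neq0.
Qed.

Lemma laur_fstX k : laur (fun u _ => u ^+ k).
Proof. by exists 0%N, ('X^k)%:P => u s u0; rewrite /ev2 /= hornerC hornerXn mulr1. Qed.

Lemma laurD f g : laur f -> laur g -> laur (fun u s => f u s + g u s).
Proof.
move=> [M [A hA]] [N [B hB]]; exists (M + N)%N, (A * ('X^N)%:P + B * ('X^M)%:P) => u s u0.
rewrite /ev2 /= hornerD !hornerM hornerD !hornerM !hornerC !hornerXn.
by have := hA u s u0; have := hB u s u0; rewrite /ev2 /= => <- <-; rewrite exprD; ring.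
Qed.

Lemma laurM f g : laur f -> laur g -> laur (fun u s => f u s * g u s).
Proof.
move=> [M [A hA]] [N [B hB]]; exists (M + N)%N, (A * B) => u s u0.
rewrite /ev2 /= !hornerM.
by have := hA u s u0; have := hB u s u0; rewrite /ev2 /= => <- <-; rewrite exprD; ring.
Qed.

Lemma laurX f n : laur f -> laur (fun u s => f u s ^+ n).
Proof.
move=> hf; elim: n => [|n IH]; first exact: laur_cst.
have [M [A hA]] := laurM hf IH; exists M, A => u s u0; rewrite -hA //.
by rewrite exprS.
Qed.

Lemma laur_sum (I : Type) (r : seq I) (F : I -> C -> C -> C) :
  (forall i, laur (F i)) -> laur (fun u s => \sum_(i <- r) F i u s).
Proof.
move=> h; elim: r => [|i r IH].
  by exists 0%N, 0 => u s _; rewrite big_nil /ev2 !horner0 mul0r.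
have [M [A hA]] := laurD (h i) IH; exists M, A => u s u0; rewrite -hA //.
by rewrite big_cons.
Qed.

Lemma laur_ev2 P f g : laur f -> laur g -> laur (fun u s => ev2 P (f u s, g u s)).
Proof.
move=> hf hg.
suff [M [A hA]] : laur (fun u s => \sum_(j < size P) \sum_(i < sizeY P)
   P`_j`_i * f u s ^+ i * g u s ^+ j).
  by exists M, A => u s u0; rewrite -hA // ev2E.
apply: laur_sum => j; apply: laur_sum => i.
by apply: laurM; [apply: laurM; [exact: laur_cst|exact: laurX]|exact: laurX].
Qed.

Definition top_form (w1 w2 D : nat) (P : {poly {poly C}}) : {poly {poly C}} :=
  \poly_(j < size P) \poly_(i < sizeY P)
    (if (i * w1 + j * w2 == D)%N then P`_j`_i else 0).

Lemma coef_top_form w1 w2 D P i j :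
  (top_form w1 w2 D P)`_j`_i = if (i * w1 + j * w2 == D)%N then P`_j`_i else 0.
Proof.
rewrite coef_poly; case: (ltnP j (size P)) => hj; last first.
  by rewrite (nth_default _ hj) !coef0 if_same.
rewrite coef_poly; case: (ltnP i (sizeY P)) => hi //.
by rewrite (nth_default _ (leq_trans (max_size_coefXY _ _) hi)) if_same.
Qed.

Lemma ev2_wide (P : {poly {poly C}}) m n x y :
  (size P <= m)%N -> (sizeY P <= n)%N ->
  ev2 P (x, y) = \sum_(j < m) \sum_(i < n) P`_j`_i * x ^+ i * y ^+ j.
Proof.
move=> hm hn; rewrite /ev2 /= (horner_coef_wide _ hm) horner_sum; apply: eq_bigr => j _.
rewrite hornerM -polyC_exp hornerC (horner_coef_wide _ (n := n)) ?mulr_suml //.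
exact: leq_trans (max_size_coefXY _ _) hn.
Qed.

Lemma size_top_form w1 w2 D P : (size (top_form w1 w2 D P) <= size P)%N.
Proof. exact: size_poly. Qed.

Lemma sizeY_top_form w1 w2 D P : (sizeY (top_form w1 w2 D P) <= sizeY P)%N.
Proof.
apply/bigmax_leqP => j _; apply/leq_sizeP => i hi; rewrite coef_top_form.
by rewrite (nth_default _ (leq_trans (max_size_coefXY _ _) hi)) if_same.
Qed.

Definition comp2 (T : {poly {poly C}}) (a b : {poly C}) : {poly C} :=
  \sum_(j < size T) \sum_(i < sizeY T) (T`_j`_i)%:P * a ^+ i * b ^+ j.

Lemma horner_comp2 T a b s : (comp2 T a b).[s] = ev2 T (a.[s], b.[s]).
Proof.
rewrite ev2E horner_sum; apply: eq_bigr => j _; rewrite horner_sum.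
by apply: eq_bigr => i _; rewrite !hornerM hornerC !horner_exp.
Qed.

(** The extension of u^D P(u^-w1 x, u^-w2 y) across u = 0; the truncated subtraction is exact once
    [D] bounds the weights occurring in [P]. *)
Definition scaled_ev (w1 w2 D : nat) (P : {poly {poly C}}) (u x y : C) : C :=
  \sum_(j < size P) \sum_(i < sizeY P)
    P`_j`_i * u ^+ (D - (i * w1 + j * w2)) * x ^+ i * y ^+ j.

Lemma scaled_evE w1 w2 D (P : {poly {poly C}}) u x y :
  (forall i j, P`_j`_i != 0 -> (i * w1 + j * w2 <= D)%N) -> u != 0 ->
  scaled_ev w1 w2 D P u x y = u ^+ D * ev2 P (u ^- w1 * x, u ^- w2 * y).
Proof.
move=> hD u0; rewrite ev2E mulr_sumr; apply: eq_bigr => j _.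
rewrite mulr_sumr; apply: eq_bigr => i _.
have [->|/hD h] := eqVneq (P`_j`_i) 0; first by rewrite !mul0r mulr0.
rewrite !exprMn !exprVn -!exprM -{2}(subnK h) !exprD (mulnC w1) (mulnC w2).
have := expf_neq0 (i * w1) u0; have := expf_neq0 (j * w2) u0 => h1 h2.
by field; rewrite h1 h2.
Qed.

Lemma scaled_ev0 w1 w2 D (P : {poly {poly C}}) x y :
  (forall i j, P`_j`_i != 0 -> (i * w1 + j * w2 <= D)%N) ->
  scaled_ev w1 w2 D P 0 x y = ev2 (top_form w1 w2 D P) (x, y).
Proof.
move=> hD; rewrite (ev2_wide _ _ (size_top_form _ _ _ _) (sizeY_top_form _ _ _ _)).
apply: eq_bigr => j _; apply: eq_bigr => i _; rewrite coef_top_form.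
have [->|/hD h] := eqVneq (P`_j`_i) 0; first by rewrite if_same !mul0r.
rewrite expr0n subn_eq0 eqn_leq h /=.
by case: leqP; rewrite ?mulr1 ?mulr0 ?mul0r.
Qed.

Lemma poly_valuation (p : {poly C}) : exists o (q : {poly C}),
  p = 'X^o * q /\ (p != 0 -> q.[0] != 0).
Proof.
case: (multiplicity_XsubC p 0) => o [q hq hp]; exists o, q; split.
  by rewrite [LHS]hp polyC0 subr0 mulrC.
by move=> p0; move: hq; rewrite p0 /= rootE.
Qed.

Lemma laur2_common f g : laur f -> laur g -> exists M (A B : {poly {poly C}}),
  forall u s, u != 0 -> f u s * u ^+ M = ev2 A (u, s) /\ g u s * u ^+ M = ev2 B (u, s).
Proof.
move=> [M [A hA]] [N [B hB]]; exists (M + N)%N, (A * ('X^N)%:P), (B * ('X^M)%:P) => u s u0.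
rewrite /ev2 /= !hornerM !hornerC !hornerXn exprD.
by have := hA u s u0; have := hB u s u0; rewrite /ev2 /= => <- <-; split; ring.
Qed.

(** A Newton polygon argument: the coefficient of s^k with index i has order [o i - M] in u, and the
    minimised quantity is the slope (o i - M) / k. The conclusion compares slopes after clearing
    denominators and signs, so that it lives in nat. *)
Lemma slope_min (K : nat) (P : pred (bool * 'I_K)) (o : bool * 'I_K -> nat) (M : nat) i0 :
  P i0 -> (forall i, P i -> (0 < i.2)%N) ->
  exists2 i, P i & forall j, P j -> (j.2 * o i + i.2 * M <= i.2 * o j + j.2 * M)%N.
Proof.
move=> P0 Ppos.
pose F (i : bool * 'I_K) : rat := ((o i)%:R - M%:R) / i.2%:R.
case: (@arg_minP _ rat _ i0 P F P0) => i Pi hi; exists i => // j Pj.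
have := hi j Pj; rewrite /F ler_pdivrMr ?ltr0n ?Ppos // mulrAC ler_pdivlMr ?ltr0n ?Ppos //.
rewrite !mulrBl lerBlDr addrAC lerBrDr -!natrM -!natrD ler_nat.
by rewrite (mulnC j.2) (mulnC i.2) (mulnC i.2) (mulnC j.2).
Qed.

(* Degeneration of the G_a-action s |-> psi(P, Q + s) along the weights: after the
   substitution u = v^N, s |-> s v^w its value at v = 0 is a curve on which the
   leading form of P is constant. *)
Lemma degenerate (P Q A B : {poly {poly C}}) w1 w2 D x y :
  (forall z, ev2 A (ev2 P z, ev2 Q z) = z.1) ->
  (forall z, ev2 B (ev2 P z, ev2 Q z) = z.2) ->
  (forall z, ev2 P (ev2 A z, ev2 B z) = z.1) ->
  (forall z, ev2 Q (ev2 A z, ev2 B z) = z.2) ->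
  (forall i j, P`_j`_i != 0 -> (i * w1 + j * w2 <= D)%N) ->
  exists a b : {poly C}, [/\ a.[0] = x, b.[0] = y, (1 < size a)%N || (1 < size b)%N
    & comp2 (top_form w1 w2 D P) a b = (ev2 (top_form w1 w2 D P) (x, y))%:P].
Proof.
move=> hA hB hP hQ hD.
pose px (u : C) := ev2 P (u ^- w1 * x, u ^- w2 * y).
pose qx (u : C) := ev2 Q (u ^- w1 * x, u ^- w2 * y).
(* [f] and [g] are the coordinates of the orbit through the point (x / u^w1, y / u^w2), scaled back
   by the weights; at s = 0 they return x and y. *)
pose f (u s : C) := u ^+ w1 * ev2 A (px u, qx u + s).
pose g (u s : C) := u ^+ w2 * ev2 B (px u, qx u + s).
have lp R : laur (fun u _ => ev2 R (u ^- w1 * x, u ^- w2 * y)).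
  by apply: laur_ev2; apply: laurM; try exact: laur_fstVX; exact: laur_cst.
have lf : laur f.
  apply: laurM; first exact: laur_fstX.
  by apply: laur_ev2; [exact: lp|apply: laurD; [exact: lp|exact: laur_snd]].
have lg : laur g.
  apply: laurM; first exact: laur_fstX.
  by apply: laur_ev2; [exact: lp|apply: laurD; [exact: lp|exact: laur_snd]].
have [M [A' [B' hAB]]] := laur2_common lf lg.
pose K := (maxn (size A') (size B')).+1.
pose cf (i : bool * 'I_K) := if i.1 then A'`_i.2 else B'`_i.2.
have f0 (u : C) : u != 0 -> f u 0 = x.
  by move=> u0; rewrite /f addr0 hA /= mulrA divff ?mul1r // expf_neq0.
have g0 (u : C) : u != 0 -> g u 0 = y.
  by move=> u0; rewrite /g addr0 hB /= mulrA divff ?mul1r // expf_neq0.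
have PQu (u s : C) : u != 0 -> scaled_ev w1 w2 D P u (f u s) (g u s) = scaled_ev w1 w2 D P u x y.
  move=> u0; rewrite !scaled_evE // /f /g !mulrA !mulVf ?expf_neq0 // !mul1r.
  by rewrite hP.
have Qu s : ev2 Q (f 1 s, g 1 s) = qx 1 + s.
  by rewrite /f /g !expr1n !mul1r hQ.
have fE (u s : C) : u != 0 -> f u s = x + \sum_(k < K | (0 < k)%N) u ^- M * (A'`_k).[u] * s ^+ k
           /\ g u s = y + \sum_(k < K | (0 < k)%N) u ^- M * (B'`_k).[u] * s ^+ k.
  move=> u0; have uM : u ^+ M != 0 by rewrite expf_neq0.
  suff E (h : C -> C -> C) c (E : {poly {poly C}}) : (size E <= K)%N -> h u 0 = c ->
     (forall s, h u s * u ^+ M = ev2 E (u, s)) ->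
     h u s = c + \sum_(k < K | (0 < k)%N) u ^- M * (E`_k).[u] * s ^+ k.
    split; apply: E => //; try by [exact: f0|exact: g0|move=> r; case: (hAB u r u0)].
      by rewrite /K leqW // leq_maxl.
    by rewrite /K leqW // leq_maxr.
  move=> sE h0 hE.
  have E1 r : h u r = u ^- M * (E`_0).[u] + \sum_(k < K | (0 < k)%N) u ^- M * (E`_k).[u] * r ^+ k.
    apply: (mulIf uM); rewrite hE /ev2 /= (horner_coef_wide _ sE) horner_sum.
    have -> (G : 'I_K -> C) : \sum_(k < K | (0 < k)%N) G k =
        \sum_(k < (maxn (size A') (size B'))) G (lift ord0 k).
      by rewrite big_mkcond big_ord_recl /= add0r.
    rewrite big_ord_recl /= mulrDl.
    congr (_ + _).
      by rewrite expr0 mulr1 mulrAC mulVf ?mul1r.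
    rewrite mulr_suml; apply: eq_bigr => k _ /=.
    rewrite hornerM -polyC_exp hornerC; set a := _.[u]; set b := r ^+ _.
    by field.
  rewrite E1; congr (_ + _); rewrite -h0 E1 big1 ?addr0 // => k /prednK <-.
  by rewrite exprS mul0r mulr0.
pose S (i : bool * 'I_K) := (0 < i.2)%N && (cf i != 0).
(* If no positive power of s occurred in [f] and [g], then Q would be constant along the orbit at u
   = 1, against [Qu]. *)
have [i0 Si0] : exists i, S i.
  have [/existsP[i Si]|] := boolP [exists i, S i]; first by exists i.
  rewrite negb_exists => /forallP h; exfalso.
  have z (i : bool * 'I_K) : (0 < i.2)%N -> cf i = 0.
    by move=> hi; apply/eqP; have := h i; rewrite /S hi /= negbK.
  have := Qu 1; have := Qu 0.
  have [-> ->] := fE 1 0 (oner_neq0 _); have [-> ->] := fE 1 1 (oner_neq0 _).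
  rewrite !big1; last 4 first.
  - by move=> k hk; have := z (false, k) hk; rewrite /cf /= => ->; rewrite horner0 mulr0 mul0r.
  - by move=> k hk; have := z (true, k) hk; rewrite /cf /= => ->; rewrite horner0 mulr0 mul0r.
  - by move=> k hk; have := z (false, k) hk; rewrite /cf /= => ->; rewrite horner0 mulr0 mul0r.
  - by move=> k hk; have := z (true, k) hk; rewrite /cf /= => ->; rewrite horner0 mulr0 mul0r.
  by move=> -> /eqP; rewrite addr0 -subr_eq0 opprD addNKr oppr_eq0 oner_eq0.
have [oq hoq] : exists oq : bool * 'I_K -> nat * {poly C},
    forall i, cf i = 'X^((oq i).1) * (oq i).2 /\ (cf i != 0 -> (oq i).2.[0] != 0).
  have h i : exists t : nat * {poly C}, cf i = 'X^(t.1) * t.2 /\ (cf i != 0 -> t.2.[0] != 0).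
    by have [o [q h]] := poly_valuation (cf i); exists (o, q).
  apply: (@fin_all_exists _ (fun=> (nat * {poly C})%type)
    (fun i t => cf i = 'X^(t.1) * t.2 /\ (cf i != 0 -> t.2.[0] != 0))) => i.
  exact: h.
pose o i := (oq i).1; pose q i := (oq i).2.
have [i1 Sis hmin] := @slope_min K S o M i0 Si0 (fun i hi => proj1 (andP hi)).
pose N := nat_of_ord i1.2.
(* After u := v^N and s := s v^(M - o i1) the coefficient i of s^k has order N (o i - M) + k (M - o
   i1) in v. Minimality of the slope makes this nonnegative, with value 0 at [i1]. *)
pose e (i : bool * 'I_K) := ((N * o i + i.2 * M) - (i.2 * o i1 + N * M))%N.
pose cc (b : bool) (c : C) (v : C) (k : 'I_K) : C :=
  if k == 0%N :> nat then c else
  if cf (b, k) == 0 then 0 else v ^+ (e (b, k)) * (q (b, k)).[v ^+ N].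
pose F b c (v s : C) : C := \sum_(k < K) cc b c v k * s ^+ k.
have pF b c s : polyfun (fun v => F b c v s).
  apply: polyfun_sum => k; apply: polyfunM; last exact: polyfun_cst.
  rewrite /cc; case: (k == 0%N :> nat) => /=; first exact: polyfun_cst.
  case: (cf (b, k) == 0); first exact: polyfun_cst.
  apply: (@polyfunM (fun v => v ^+ e (b, k)) (fun v => (q (b, k)).[v ^+ N])).
    by apply: (@polyfunX id); exact: polyfun_id.
  by apply: polyfun_comp; apply: (@polyfunX id); exact: polyfun_id.
have FE (v s : C) : v != 0 -> F true x v s = f (v ^+ N) (s * (v ^+ M / v ^+ o i1)) /\
                      F false y v s = g (v ^+ N) (s * (v ^+ M / v ^+ o i1)).
  move=> v0; have vN := expf_neq0 N v0.
  have [-> ->] := fE (v ^+ N) (s * (v ^+ M / v ^+ o i1)) vN.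
  suff E b c : F b c v s = c + \sum_(k < K | (0 < k)%N)
     (v ^+ N) ^- M * (cf (b, k)).[v ^+ N] * (s * (v ^+ M / v ^+ o i1)) ^+ k.
    by rewrite !E.
  rewrite /F big_ord_recl /cc /= expr0 mulr1; congr (_ + _).
  rewrite [RHS]big_mkcond big_ord_recl /= add0r; apply: eq_bigr => k _ /=.
  set i := (b, lift ord0 k).
  have [->|ci] := eqVneq (cf i) 0; first by rewrite horner0 mulr0 !mul0r.
  have Si : S i by rewrite /S ci.
  have [-> _] := hoq i; rewrite hornerM hornerXn -/(q i) -/(o i).
  have hv : v ^+ e i * (v ^+ (i.2 * o i1) * v ^+ (N * M)) = v ^+ (N * o i) * v ^+ (i.2 * M).
    by rewrite -!exprD subnK //; exact: hmin.
  have h1 := expf_neq0 (N * M) v0; have h2 := expf_neq0 (i.2 * o i1) v0.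
  have {hv} -> : v ^+ e i = v ^+ (N * o i) * v ^+ (i.2 * M) / (v ^+ (i.2 * o i1) * v ^+ (N * M)).
    by rewrite -hv mulfK // mulf_neq0.
  have -> : (s * (v ^+ M / v ^+ o i1)) ^+ bump 0 k =
      s ^+ bump 0 k * (v ^+ (i.2 * M) / v ^+ (i.2 * o i1)).
    by rewrite exprMn expr_div_n -!exprM (mulnC M) (mulnC (o i1)).
  rewrite -!exprM; move: h1 h2.
  move: (v ^+ (N * M)) (v ^+ (i.2 * o i1)) (v ^+ (i.2 * M)) (v ^+ (N * o i)) (s ^+ _) (_.[_]).
  by move=> z1 z2 z3 z4 z5 z6 h1 h2; field; rewrite h1 h2.
pose pl (b : bool) (c : C) : {poly C} :=
  \poly_(k < K) (if (insub k : option 'I_K) is Some j then cc b c 0 j else 0).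
have alE b c (s : C) : (pl b c).[s] = F b c 0 s.
  by rewrite horner_poly; apply: eq_bigr => k _; rewrite valK.
have F0 b c : F b c 0 0 = c.
  rewrite /F big_ord_recl /= big1 ?addr0 ?expr0 ?mulr1 // => k _.
  by rewrite exprS mul0r mulr0.
(* The minimising coefficient has order 0, so it survives at v = 0 and makes the limit curve
   nonconstant. *)
have nz : cc i1.1 (if i1.1 then x else y) 0 i1.2 != 0.
  have /andP[k0 ci] := Sis; have k1 : (i1.2 == 0%N :> nat) = false.
    by apply/negbTE; rewrite -lt0n.
  rewrite /cc k1 -surjective_pairing (negPf ci) /e -/N subnn mul1r expr0n /N k1.
  by have [_ /(_ ci)] := hoq i1.
have sz b c : cc b c 0 i1.2 != 0 -> (1 < size (pl b c))%N.
  move=> h; have /andP[k0 _] := Sis.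
  rewrite ltnNge; apply: contra h => /leq_sizeP /(_ i1.2 k0).
  by rewrite coef_poly ltn_ord valK => ->.
exists (pl true x), (pl false y); split.
- by rewrite alE F0.
- by rewrite alE F0.
- by case E : i1.1 nz => nz; [rewrite sz|rewrite orbC sz].
apply: polyC_inj_fun => s; rewrite horner_comp2 hornerC !alE -!scaled_ev0 //.
(* P is constant on orbits, which gives the identity for v nonzero; both sides are polynomial in v,
   so it persists at v = 0, where [scaled_ev] becomes the leading form. *)
have H v : scaled_ev w1 w2 D P (v ^+ N) (F true x v s) (F false y v s) =
    scaled_ev w1 w2 D P (v ^+ N) x y.
  move: v; apply: polyfun_eq_punctured.
  - apply: polyfun_sum => j; apply: polyfun_sum => i.
    apply: polyfunM; last exact: polyfunX.
    apply: polyfunM; last exact: polyfunX.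
    by apply: polyfunM; [exact: polyfun_cst|do 2!apply: polyfunX; exact: polyfun_id].
  - apply: polyfun_sum => j; apply: polyfun_sum => i.
    apply: polyfunM; last exact: polyfun_cst.
    apply: polyfunM; last exact: polyfun_cst.
    by apply: polyfunM; [exact: polyfun_cst|do 2!apply: polyfunX; exact: polyfun_id].
  - move=> v v0; have [-> ->] := FE v s v0.
    by rewrite PQu // expf_neq0.
have := H 0; have /andP[k0 _] := Sis.
by rewrite expr0n -/N eqn0Ngt k0.
Qed.
(** * Leading forms of coordinates *)

Definition inverse_pair (P Q A B : {poly {poly C}}) : Prop :=
  [/\ forall z, ev2 A (ev2 P z, ev2 Q z) = z.1,
      forall z, ev2 B (ev2 P z, ev2 Q z) = z.2,
      forall z, ev2 P (ev2 A z, ev2 B z) = z.1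
    & forall z, ev2 Q (ev2 A z, ev2 B z) = z.2].

Lemma ev2_swapXY P x y : ev2 (swapXY P) (x, y) = ev2 P (y, x).
Proof.
rewrite !ev2E exchange_big /= -!sizeYE.
have -> : sizeY (swapXY P) = size P by rewrite sizeYE swapXYK.
apply: eq_bigr => j _; apply: eq_bigr => i _; rewrite coef_swapXY.
by rewrite mulrAC.
Qed.

Lemma inverse_pair_swap P Q A B :
  inverse_pair P Q A B -> inverse_pair (swapXY P) (swapXY Q) B A.
Proof.
by move=> [h1 h2 h3 h4]; split=> -[x y]; rewrite !ev2_swapXY ?h1 ?h2 ?h3 ?h4.
Qed.

Lemma poly_neq0_ex (p : {poly C}) : p != 0 -> exists v, p.[v] != 0.
Proof.
move=> p0; have [/hasP[i _ h]|h] := boolP (has (fun i => p.[i%:R] != 0) (iota 0 (size p))).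
  by exists i%:R.
case/eqP: p0; apply: (@roots_geq_poly_eq0 _ _ [seq (i%:R : C) | i <- iota 0 (size p)]).
- apply/allP => z /mapP[i hi ->]; rewrite rootE.
  by move/hasPn: h => /(_ i hi); rewrite negbK.
- by rewrite map_inj_uniq ?iota_uniq // => i j /eqP; rewrite eqr_nat => /eqP.
- by rewrite size_map size_iota.
Qed.

Lemma ev2_neq0_ex P : P != 0 -> exists x y, ev2 P (x, y) != 0.
Proof.
move=> P0.
have h : lead_coef P != 0 by rewrite lead_coef_eq0.
have [x hx] := poly_neq0_ex h.
have h1 : map_poly (horner_eval x) P != 0.
  apply: contra hx => /eqP /polyP /(_ (size P).-1).
  by rewrite coef_map coef0 /= /horner_eval => ->.
have [y hy] := poly_neq0_ex h1; exists x, y; apply: contra hy => /eqP.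
rewrite /ev2 /= => E; apply/eqP; rewrite -[RHS]E.
rewrite -/(horner_eval x _) -horner_map /= /horner_eval hornerC //.
Qed.

Lemma sizeY_gt0 (P : {poly {poly C}}) : (0 < sizeY P)%N = (P != 0).
Proof. by rewrite sizeYE size_poly_gt0 swapXY_eq0. Qed.

Lemma size_exp_eq1 (p : {poly C}) n : (0 < n)%N -> (size (p ^+ n) == 1%N) = (size p == 1%N).
Proof.
case: n => // n _; have [->|p0] := eqVneq p 0; first by rewrite exprS mul0r.
have := size_exp p n.+1; have := size_poly_gt0 p; have := size_poly_gt0 (p ^+ n.+1).
rewrite expf_neq0 // p0; case: (size p) => // k; case: (size _) => //= l _ _ ->.
by rewrite !eqSS muln_eq0 orbF.
Qed.

Lemma size_polyC_neq0 (c : C) : c != 0 -> size c%:P = 1%N.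
Proof. by rewrite size_polyC => ->. Qed.

Lemma nonconst_contra (a b : {poly C}) :
  size a = 1%N -> (size b <= 1)%N -> (1 < size a)%N || (1 < size b)%N -> False.
Proof. by move=> -> h; rewrite ltnn /= ltnNge h. Qed.

(** For the weights (1, 0) the leading form is x^n c(y). Along a limit curve (a, b) the product a^n
    c(b) is a nonzero constant, so a is constant; then b is not, and c(b) can be constant only if c
    is. *)
Lemma coord_lead_const P Q A B : inverse_pair P Q A B -> (1 < sizeY P)%N ->
  P`_0`_(sizeY P).-1 != 0 /\ (forall j, (0 < j)%N -> P`_j`_(sizeY P).-1 = 0).
Proof.
move=> [h1 h2 h3 h4] sP; set n := (sizeY P).-1.
have n0 : (0 < n)%N by rewrite /n; case: (sizeY P) sP => [|[]].
pose c := (swapXY P)`_n.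
have c0 : c != 0.
  by rewrite /c /n sizeYE -/(lead_coef _) lead_coef_eq0 swapXY_eq0 -sizeY_gt0 ltnW.
have [y hy] := poly_neq0_ex c0.
have hD i j : P`_j`_i != 0 -> (i * 1 + j * 0 <= n)%N.
  rewrite muln1 muln0 addn0 => /eqP h; rewrite -ltnS /n prednK ?(ltnW sP) //.
  rewrite ltnNge; apply/negP => hi; apply: h.
  exact: nth_default (leq_trans (max_size_coefXY _ _) hi).
have topE x z : ev2 (top_form 1 0 n P) (x, z) = x ^+ n * c.[z].
  rewrite (ev2_wide _ _ (size_top_form _ _ _ _) (sizeY_top_form _ _ _ _)).
  have -> : c.[z] = \sum_(j < size P) P`_j`_n * z ^+ j.
    rewrite (@horner_coef_wide _ (size P)); last first.
      by rewrite (leq_trans (max_size_coefXY _ _)) // sizeYE swapXYK.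
    by apply: eq_bigr => j _; rewrite coef_swapXY.
  rewrite mulr_sumr; apply: eq_bigr => j _.
  have hn : (n < sizeY P)%N by rewrite /n prednK // (ltnW sP).
  rewrite (bigD1 (Ordinal hn)) //= coef_top_form muln1 muln0 addn0 eqxx.
  rewrite big1 ?addr0 ?mulrA 1?[x ^+ n * _]mulrC // => i /eqP hi.
  rewrite coef_top_form muln1 muln0 addn0; case: eqP => [E|]; last by rewrite !mul0r.
  by case: hi; apply: val_inj.
have [a [b [a0 b0 nc E]]] := @degenerate P Q A B 1 0 n 1 y h1 h2 h3 h4 hD.
have E2 : a ^+ n * (c \Po b) = (c.[y])%:P.
  rewrite -[c.[y]]mul1r -[in RHS](expr1n _ n) -topE -E.
  by apply: polyC_inj_fun => s; rewrite horner_comp2 topE hornerM horner_exp horner_comp.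
have : size (a ^+ n * (c \Po b)) == 1%N by rewrite E2 size_polyC_neq0.
rewrite size_mul_eq1 size_exp_eq1 // => /andP[/eqP sa /eqP scb].
have sb : (1 < size b)%N by move: nc; rewrite sa.
have sc : size c = 1%N.
  have := size_comp_poly c b; rewrite scb /=.
  have := size_poly_gt0 c; rewrite c0; case: (size c) => // k _ /=.
  by case: (size b) sb => [|[]] // l _ /esym /eqP; rewrite muln_eq0 orbF => /eqP ->.
have cE j : P`_j`_n = c`_j by rewrite coef_swapXY.
split=> [|j j0]; rewrite cE.
  by move: c0; rewrite -lead_coef_eq0 lead_coefE sc.
by rewrite nth_default // sc.
Qed.

Lemma comp2_dvd_fst (T : {poly {poly C}}) a b : (forall j, T`_j`_0 = 0) -> a %| comp2 T a b.
Proof.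
move=> h; rewrite /comp2; elim/big_ind: _ => [|p q|j _]; first exact: dvdp0.
  exact: dvdp_add.
elim/big_ind: _ => [|p q|i _]; [exact: dvdp0|exact: dvdp_add|].
case: i => -[|i] hi /=; first by rewrite h !mul0r dvdp0.
by rewrite dvdp_mulr // dvdp_mull // dvdp_exp.
Qed.

Lemma comp2_dvd_snd (T : {poly {poly C}}) a b : T`_0 = 0 -> b %| comp2 T a b.
Proof.
move=> h; rewrite /comp2; elim/big_ind: _ => [|p q|j _]; first exact: dvdp0.
  exact: dvdp_add.
elim/big_ind: _ => [|p q|i _]; [exact: dvdp0|exact: dvdp_add|].
case: j => -[|j] hj /=; first by rewrite h coef0 !mul0r dvdp0.
by rewrite dvdp_mull // dvdp_exp.
Qed.

(* A monomial of weight > nm has i, j > 0, hence x y divides the leading form,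
   which is then nonconstant along every degenerate curve. *)
Lemma coord_weight_bound P Q A B (n := (sizeY P).-1) (m := (size P).-1) :
  inverse_pair P Q A B -> (0 < n)%N -> (0 < m)%N ->
  forall i j, P`_j`_i != 0 -> (i * m + j * n <= n * m)%N.
Proof.
move=> iP n0 m0; have [h1 h2 h3 h4] := iP.
have bi i j : P`_j`_i != 0 -> (i <= n)%N.
  move=> /eqP h; rewrite leqNgt; apply/negP => hi; apply: h; apply: nth_default.
  by rewrite (leq_trans (max_size_coefXY _ _)) //; move: hi; rewrite /n; case: (sizeY P).
have bj i j : P`_j`_i != 0 -> (j <= m)%N.
  move=> /eqP h; rewrite leqNgt; apply/negP => hj; apply: h.
  have sj : (size P <= j)%N by move: hj; rewrite /m; case: (size P).
  by rewrite (nth_default _ sj) coef0.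
(* Descending induction on the excess [d] of the weights over n m; the two degree bounds give the
   starting value n m. *)
suff H d : (forall i j, P`_j`_i != 0 -> (i * m + j * n <= n * m + d)%N) ->
    forall i j, P`_j`_i != 0 -> (i * m + j * n <= n * m)%N.
  apply: (H (n * m)%N) => i j h.
  apply: leq_add; first by rewrite leq_mul2r (bi i j) ?orbT.
  by rewrite mulnC leq_mul2l (bj i j) ?orbT.
elim: d => [h|d IH hd]; first by move=> i j /h; rewrite addn0.
apply: IH => i0 j0 h0; have := hd _ _ h0; rewrite leq_eqVlt addnS ltnS => /orP[/eqP E|//].
exfalso; pose T := top_form m n (n * m + d.+1) P.
have T0 : T != 0.
  apply: contra h0 => /eqP T0; have := coef_top_form m n (n * m + d.+1) P i0 j0.
  by rewrite -/T T0 !coef0 E addnS eqxx => <-.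
have [x [y hxy]] := ev2_neq0_ex T0.
have [a [b [a0 b0 nc Tab]]] := @degenerate P Q A B m n (n * m + d.+1) x y h1 h2 h3 h4 hd.
have sT : size (comp2 T a b) == 1%N by rewrite Tab size_polyC_neq0.
have unit1 (p : {poly C}) : p %| comp2 T a b -> size p = 1%N.
  by move=> /dvdpP[q hq]; move: sT; rewrite hq size_mul_eq1 => /andP[_ /eqP].
have sa : size a = 1%N.
  apply: unit1; apply: comp2_dvd_fst => j; rewrite coef_top_form mul0n add0n.
  case: eqP => // Ej; have [->//|/bj hj] := eqVneq (P`_j`_0) 0.
  by have : (j * n <= m * n)%N by [rewrite leq_mul2r hj orbT]; rewrite Ej; lia.
have sb : size b = 1%N.
  apply: unit1; apply: comp2_dvd_snd; apply/polyP => i; rewrite coef_top_form coef0 mul0n addn0.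
  case: eqP => // Ei; have [->//|/bi hi] := eqVneq (P`_0`_i) 0.
  by have : (i * m <= n * m)%N by [rewrite leq_mul2r hi orbT]; rewrite Ei; lia.
by apply: (nonconst_contra sa _ nc); rewrite sb.
Qed.

(** A binary form splits through the roots of its dehomogenization [r]: the identity is checked at Y
    / X for X nonzero and extends to X = 0 by polynomiality. *)
Lemma homog_factor (r : {poly C}) : exists s : seq C,
  size s = (size r).-1 /\
  forall X Y, \sum_(k < size r) r`_k * Y ^+ k * X ^+ ((size r).-1 - k) =
     lead_coef r * \prod_(l <- s) (Y - l * X).
Proof.
have [s hs] := closed_field_poly_normal (r : {poly complex Rdefinitions.R}).
have [r0|r0] := eqVneq r 0.
  exists [::]; rewrite r0 size_poly0; split=> // X Y.
  by rewrite big_ord0 lead_coef0 mul0r.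
have ss : size s = (size r).-1.
  by rewrite [in RHS]hs size_scale ?lead_coef_eq0 // size_prod_XsubC.
exists s; split=> // X Y; move: X; apply: polyfun_eq_punctured.
- apply: polyfun_sum => k; apply: polyfunM; first exact: polyfun_cst.
  by apply: polyfunX; exact: polyfun_id.
- apply: polyfunM; first exact: polyfun_cst.
  apply: polyfun_prod => l; apply: polyfunD; first exact: polyfun_cst.
  by apply: polyfunN; apply: polyfunM; [exact: polyfun_cst|exact: polyfun_id].
move=> X X0.
transitivity (X ^+ (size r).-1 * r.[Y / X]).
  rewrite horner_coef mulr_sumr; apply: eq_bigr => k _.
  have hk : (k <= (size r).-1)%N by rewrite -ltnS prednK ?ltn_ord // (leq_ltn_trans (leq0n _) (ltn_ord k)).
  rewrite -{2}(subnK hk) exprD expr_div_n; have := expf_neq0 k X0 => hX.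
  by field.
rewrite -ss [in LHS]hs hornerZ horner_prod mulrCA; congr (_ * _).
elim: (s) => [|l s' IH]; first by rewrite !big_nil mulr1.
rewrite !big_cons -IH /= exprS hornerXsubC.
have -> : Y - l * X = X * (Y / X - l) by field.
by ring.
Qed.

(** Since y^a - l x^b is a nonzero constant, x and y are coprime, and differentiating gives a
    y^(a-1) y' = l b x^(b-1) x'. If a, b > 1, then y divides x' and x divides y', so each of x and y
    would have smaller degree than the other. *)
Lemma curve_exponents (a b : nat) (l : C) (x y : {poly C}) :
  (0 < a)%N -> (0 < b)%N -> l != 0 -> size (y ^+ a - l *: x ^+ b) = 1%N ->
  (1 < size x)%N || (1 < size y)%N -> a = 1%N \/ b = 1%N.
Proof.
move=> a0 b0 l0 sF nc.
have cst0 (p : {poly C}) : (size p <= 1)%N = (p^`() == 0).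
  apply/idP/eqP => [/size1_polyC ->|h]; first exact: derivC.
  rewrite leqNgt; apply/negP => sp.
  have : p^`()`_(size p).-2 == 0 by rewrite h coef0.
  rewrite coef_deriv -mulr_natr mulf_eq0 pnatr_eq0 orbF.
  have -> : (size p).-2.+1 = (size p).-1 by case: (size p) sp => [|[]].
  by rewrite -lead_coefE lead_coef_eq0 => /eqP p0; move: sp; rewrite p0 size_poly0.
have dF : (y ^+ a.-1 * y^`()) *+ a = l *: ((x ^+ b.-1 * x^`()) *+ b).
  apply/eqP; rewrite -subr_eq0.
  have /eqP : (y ^+ a - l *: x ^+ b)^`() = 0 by apply/eqP; rewrite -cst0 sF.
  by rewrite derivB derivZ !deriv_exp ![_^`() * _]mulrC => ->.
have natC (p : {poly C}) k : p *+ k = k%:R *: p by rewrite scaler_nat.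
have cop : coprimep x y.
  apply/Bezout_coprimepP; exists (- (l *: x ^+ b.-1), y ^+ a.-1) => /=.
  rewrite -size_poly_eq1 mulNr -scalerAl -!exprSr !prednK // addrC.
  by rewrite sF.
have sx : (1 < size x)%N.
  rewrite ltnNge; apply/negP => hx; move: nc; rewrite ltnNge hx /= => hy.
  have : y ^+ a.-1 * y^`() == 0.
    move/eqP: dF; move: (hx); rewrite cst0 => /eqP ->; rewrite mulr0 mul0rn scaler0.
    by rewrite natC scaler_eq0 pnatr_eq0 -leqn0 leqNgt a0.
  by rewrite mulf_eq0 -cst0 leqNgt hy orbF expf_eq0 => /andP[_ /eqP y0]; move: hy; rewrite y0 size_poly0.
have sy : (1 < size y)%N.
  rewrite ltnNge; apply/negP => hy.
  have : x ^+ b.-1 * x^`() == 0.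
    move/esym/eqP: dF; move: (hy); rewrite cst0 => /eqP ->; rewrite mulr0 mul0rn.
    by rewrite natC !scaler_eq0 (negPf l0) pnatr_eq0 -leqn0 leqNgt b0.
  by rewrite mulf_eq0 -cst0 leqNgt sx orbF expf_eq0 => /andP[_ /eqP x0]; move: sx; rewrite x0 size_poly0.
have dx0 : x^`() != 0 by rewrite -cst0 -ltnNge.
have dy0 : y^`() != 0 by rewrite -cst0 -ltnNge.
have hge (p : {poly C}) k : p != 0 -> (0 < k)%N -> (size p <= size (p ^+ k))%N.
  by move=> p0 k0; apply: dvdp_leq; rewrite ?expf_neq0 // dvdp_exp.
have x0 : x != 0 by rewrite -size_poly_gt0 ltnW.
have y0 : y != 0 by rewrite -size_poly_gt0 ltnW.
case: (ltngtP a 1) => [|a1|]; [by case: (a) a0|right|by left].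
case: (ltngtP b 1) => [|b1|//]; first by case: (b) b0.
have a10 : (0 < a.-1)%N by case: (a) a1 => [|[]].
have b10 : (0 < b.-1)%N by case: (b) b1 => [|[]].
have E1 : y ^+ a.-1 %| x^`().
  have : y ^+ a.-1 %| l *: ((x ^+ b.-1 * x^`()) *+ b).
    by rewrite -dF natC -mul_polyC dvdp_mull // dvdp_mulr.
  rewrite natC !dvdpZr ?pnatr_eq0 -?lt0n // Gauss_dvdpr //.
  by rewrite coprimep_sym coprimep_expl // coprimep_expr.
have E2 : x ^+ b.-1 %| y^`().
  have : x ^+ b.-1 %| (y ^+ a.-1 * y^`()) *+ a.
    by rewrite dF natC !dvdpZr ?pnatr_eq0 -?lt0n // dvdp_mulr.
  rewrite natC !dvdpZr ?pnatr_eq0 -?lt0n // Gauss_dvdpr //.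
  by rewrite coprimep_expl // coprimep_expr.
have := leq_trans (hge _ _ y0 a10) (dvdp_leq dx0 E1).
have := leq_trans (hge _ _ x0 b10) (dvdp_leq dy0 E2).
have := lt_size_deriv x0; have := lt_size_deriv y0.
by move=> u1 u2 u3 u4; have := leq_trans u2 (leq_trans u3 (ltnW (leq_trans u1 u4))); rewrite ltnn.
Qed.

Lemma coef_mul_top (p q : {poly C}) s t : (size p <= s.+1)%N -> (size q <= t.+1)%N ->
  (size (p * q)%R <= (s + t).+1)%N /\ (p * q)`_(s + t) = p`_s * q`_t.
Proof.
move=> sp sq; split.
  apply: leq_trans (size_polyMleq _ _) _.
  by move: sp sq; case: (size p) => [|k]; case: (size q) => [|l] /=; lia.
have hs : (s < (s + t).+1)%N by rewrite ltnS leq_addr.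
rewrite coefM (bigD1 (Ordinal hs)) //= addKn big1 ?addr0 // => j /eqP hj.
case: (ltngtP j s) => [h|h|h]; last by case: hj; apply: val_inj.
  by rewrite (nth_default _ (_ : size q <= s + t - j)%N) ?mulr0 //; lia.
by rewrite (nth_default _ (leq_trans sp h)) mul0r.
Qed.

Lemma coef_exp_top (p : {poly C}) s k : (size p <= s.+1)%N ->
  (size (p ^+ k)%R <= (k * s).+1)%N /\ (p ^+ k)`_(k * s) = p`_s ^+ k.
Proof.
move=> sp; elim: k => [|k [IH1 IH2]].
  by rewrite !expr0 mul0n coef1 eqxx size_poly1.
by rewrite !exprS mulSn -IH2; apply: coef_mul_top.
Qed.

Definition shear_sub (l : C) (b : nat) (P : {poly {poly C}}) : {poly {poly C}} :=
  P \Po ('X + (l *: 'X^b)%:P).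

Lemma ev2_shear_sub l b P x y : ev2 (shear_sub l b P) (x, y) = ev2 P (x, y + l * x ^+ b).
Proof.
rewrite /ev2 /shear_sub /= horner_comp hornerD hornerX hornerC.
have H (q : {poly C}) : (P.[q]).[x] = \sum_(j < size P) (P`_j).[x] * q.[x] ^+ j.
  by rewrite (horner_coef P) horner_sum; apply: eq_bigr => j _; rewrite hornerM horner_exp.
by rewrite !H hornerD !hornerC hornerZ hornerXn.
Qed.

Lemma size_shear_sub l b P : size (shear_sub l b P) = size P.
Proof. by rewrite size_comp_poly2 // size_XaddC. Qed.

(** After y := y + l x^b the coefficient of x^n collects P_ij l^j over i + j b = n, so it is the
    leading form at (1, l). Its vanishing pushes the x-degree below n. *)
Lemma sizeY_shear_sub l b (P : {poly {poly C}}) n : (0 < b)%N ->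
  (forall i j, P`_j`_i != 0 -> (i + j * b <= n)%N) ->
  ev2 (top_form 1 b n P) (1, l) = 0 -> (sizeY (shear_sub l b P) <= n)%N.
Proof.
move=> b0 hw ht; rewrite sizeYE; apply/leq_sizeP => i hi.
apply: polyC_inj_fun => y; rewrite horner0.
have -> : ((swapXY (shear_sub l b P))`_i).[y] = ((shear_sub l b P).[y%:P])`_i.
  rewrite (@horner_coef_wide _ (size (shear_sub l b P))); last first.
    by rewrite (leq_trans (max_size_coefXY _ _)) // sizeYE swapXYK.
  rewrite horner_coef coef_sum; apply: eq_bigr => j _.
  by rewrite coef_swapXY -polyC_exp coefMC.
rewrite /shear_sub horner_comp hornerD hornerX hornerC.
set q := y%:P + _.
have sq : (size q <= b.+1)%N.
  rewrite (leq_trans (size_polyD _ _)) // geq_max (leq_trans (size_polyC_leq1 _)) //.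
  by rewrite (leq_trans (size_scale_leq _ _)) // size_polyXn.
have qb : q`_b = l by rewrite coefD coefC coefZ coefXn eqxx mulr1 -[b]prednK //= add0r.
have cE k j : P`_j`_k != 0 ->
    ('X^k * q ^+ j)`_i = if (i == n) && (k * 1 + j * b == n)%N then l ^+ j else 0.
  move=> /hw hkj; have [s1 s2] := coef_exp_top j sq.
  have sX : (size ('X^k : {poly C}) <= k.+1)%N by rewrite size_polyXn.
  have [s3 s4] := coef_mul_top sX s1.
  rewrite coefXn eqxx mul1r s2 qb in s4; rewrite muln1.
  have [E|ne] := eqVneq (k + j * b)%N i.
    have En : i = n by apply/eqP; rewrite eqn_leq hi andbT -E.
    by rewrite -En E !eqxx /= -s4 E.
  rewrite nth_default; last first.
    by apply: leq_trans s3 _; rewrite ltn_neqAle ne (leq_trans hkj).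
  by case: (i =P n) ne => //= -> /negPf ->.
rewrite (horner_coef P) coef_sum.
transitivity (if i == n then ev2 (top_form 1 b n P) (1, l) else 0); last by rewrite ht if_same.
rewrite (ev2_wide _ _ (size_top_form _ _ _ _) (sizeY_top_form _ _ _ _)).
transitivity (\sum_(j < size P) \sum_(k < sizeY P)
   if i == n then (top_form 1 b n P)`_j`_k * 1 ^+ k * l ^+ j else 0); last first.
  by case: (i == n) => //; rewrite big1 // => j _; rewrite big1.
apply: eq_bigr => j _.
have -> : P`_j = \sum_(k < sizeY P) P`_j`_k *: 'X^k.
  by rewrite -poly_def; apply/polyP => k; rewrite coef_poly; case: ltnP => // h;
     rewrite nth_default // (leq_trans (max_size_coefXY _ _)).
rewrite mulr_suml coef_sum; apply: eq_bigr => k _.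
rewrite -scalerAl coefZ coef_top_form expr1n mulr1.
have [->|h] := eqVneq (P`_j`_k) 0; first by rewrite !if_same !mul0r if_same.
by rewrite cE //; case: (i == n); case: (_ == n) => /=; rewrite ?mulr0 ?mul0r.
Qed.
Lemma swap_weights P Q A B : inverse_pair P Q A B -> (1 < size P)%N ->
  P`_(size P).-1`_0 != 0 /\ (forall i, (0 < i)%N -> P`_(size P).-1`_i = 0).
Proof.
move=> /inverse_pair_swap iP sP.
have := coord_lead_const iP; rewrite sizeYE swapXYK => /(_ sP) [h1 h2].
split=> [|i /h2 E]; first by rewrite -(coef_swapXY P).
by rewrite -(coef_swapXY P).
Qed.

(** As a and b are coprime, the lattice points (i, j) on the edge i a + j b = g a b are exactly ((g
    - k) b, k a), so the form depends only on x^b and y^a. *)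
Lemma ev2_top_form_line g a b (P : {poly {poly C}}) :
  (0 < g)%N -> (0 < a)%N -> (0 < b)%N -> coprime a b ->
  (size P <= (g * a).+1)%N -> (sizeY P <= (g * b).+1)%N ->
  forall x y, ev2 (top_form (g * a) (g * b) (g * b * (g * a)) P) (x, y) =
    \sum_(k < g.+1) P`_(k * a)`_((g - k) * b) * (y ^+ a) ^+ k * (x ^+ b) ^+ (g - k).
Proof.
move=> g0 a0 b0 cab sP sYP x y.
rewrite (@ev2_wide _ (g * a).+1 (g * b).+1); last 2 first.
- exact: leq_trans (size_top_form _ _ _ _) sP.
- exact: leq_trans (sizeY_top_form _ _ _ _) sYP.
have hk (k : 'I_g.+1) : (k * a < (g * a).+1)%N by rewrite ltnS leq_mul2r -ltnS ltn_ord orbT.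
have hi (k : 'I_g.+1) : ((g - k) * b < (g * b).+1)%N by rewrite ltnS leq_mul2r leq_subr orbT.
transitivity (\sum_(j < (g * a).+1) \sum_(i < (g * b).+1) \sum_(k < g.+1)
   if (j == k * a :> nat)%N && (i == (g - k) * b :> nat)%N then P`_j`_i * x ^+ i * y ^+ j else 0).
  apply: eq_bigr => j _; apply: eq_bigr => i _; rewrite coef_top_form.
  case: eqP => [E|ne]; last first.
    rewrite !mul0r big1 // => k _; case: andP => // -[/eqP E1 /eqP E2]; case: ne.
    have := ltn_ord k; rewrite ltnS E1 E2 => hkg.
    by move: (nat_of_ord k) hkg => k' /subnKC <-; rewrite addKn; nia.
  have E' : (i * a + j * b = g * b * a)%N.
    by apply/eqP; rewrite -(eqn_pmul2l g0); apply/eqP; rewrite mulnDr; nia.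
  have /dvdnP[k jk] : (a %| j)%N.
    rewrite -(Gauss_dvdl j cab) -(dvdn_addr _ (dvdn_mull i (dvdnn a))) E'.
    exact: dvdn_mull.
  have kg : (k < g.+1)%N.
    by have := ltn_ord j; rewrite ltnS jk leq_mul2r (negPf (lt0n_neq0 a0)).
  have ik : (i = (g - k) * b :> nat)%N.
    apply/eqP; rewrite -(eqn_pmul2r a0); apply/eqP.
    by move: E'; rewrite jk mulnBl mulnBl; nia.
  rewrite (bigD1 (Ordinal kg)) //= -jk -ik !eqxx /= big1 ?addr0 // => k' /eqP hk'.
  case: eqP => //= Ej; case: hk'; apply: val_inj => /=.
  by apply/eqP; rewrite -(eqn_pmul2r a0) -Ej jk.
under eq_bigr => j _ do rewrite exchange_big /=.
rewrite exchange_big; apply: eq_bigr => k _ /=.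
rewrite (bigD1 (Ordinal (hk k))) //= (bigD1 (Ordinal (hi k))) //= !eqxx /=.
rewrite !big1 ?addr0.
- by rewrite -!exprM mulrAC ![(_ * a)%N]mulnC ![(_ * b)%N]mulnC.
- move=> j /eqP hj; rewrite big1 // => i _; case: eqP => //= E.
  by case: hj; apply: val_inj.
- move=> i /eqP hi'; case: eqP => //= E.
  by case: hi'; apply: val_inj.
Qed.

Lemma gcd_factor n m : (0 < n)%N -> (0 < m)%N -> exists g a b,
  [/\ (0 < g)%N, (0 < a)%N, (0 < b)%N & [/\ n = (g * b)%N, m = (g * a)%N & coprime a b]].
Proof.
move=> n0 m0; have g0 : (0 < gcdn n m)%N by rewrite gcdn_gt0 n0.
have /dvdnP[b nE] := dvdn_gcdl n m; have /dvdnP[a mE] := dvdn_gcdr n m.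
have [g gE] : exists g, gcdn n m = g by exists (gcdn n m).
rewrite gE in g0 nE mE.
exists g, a, b; split=> //.
- by case: (a) mE m0 => // ->.
- by case: (b) nE n0 => // ->.
split; rewrite 1?mulnC // /coprime.
move: gE; rewrite nE mE -muln_gcdl gcdnC => /eqP.
by rewrite -[X in _ == X]mul1n eqn_pmul2r.
Qed.

(** The form is a product of factors y^a - l x^b, each a nonzero constant along the limit curve
    through (1, 0), where the form does not vanish by [coord_lead_const]. Two different values of l
    would make x^b and y^a constant on that curve, so a single l occurs; [curve_exponents] then
    restricts a and b. *)
Lemma coord_top_form P Q A B (n := (sizeY P).-1) (m := (size P).-1) :
  inverse_pair P Q A B -> (0 < n)%N -> (0 < m)%N ->
  exists g a b (l c : C), [/\ n = (g * b)%N, m = (g * a)%N, c != 0 /\ l != 0, a = 1%N \/ b = 1%N &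
    forall x y, ev2 (top_form m n (n * m) P) (x, y) = c * (y ^+ a - l * x ^+ b) ^+ g].
Proof.
move=> iP n0 m0; have [h1 h2 h3 h4] := iP.
have sP : size P = m.+1 by move: m0; rewrite /m; case: (size P).
have sYP : sizeY P = n.+1 by move: n0; rewrite /n; case: (sizeY P).
have hw := coord_weight_bound iP n0 m0; rewrite -/n -/m in hw.
have sY1 : (1 < sizeY P)%N by rewrite sYP.
have sP1 : (1 < size P)%N by rewrite sP.
have [cx _] := coord_lead_const iP sY1.
have [cy _] := swap_weights iP sP1.
rewrite -/n in cx; rewrite -/m in cy.
have [g [a [b [g0 a0 b0 [nE mE cab]]]]] := gcd_factor n0 m0.
pose r := \poly_(k < g.+1) P`_(k * a)`_((g - k) * b).
have rE k : (k <= g)%N -> r`_k = P`_(k * a)`_((g - k) * b) by rewrite coef_poly ltnS => ->.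
have sr : size r = g.+1.
  by rewrite size_poly_eq // -[(g)%N]/(g.+1.-1) /= subnn mul0n -mE.
have lr : lead_coef r != 0 by rewrite lead_coefE sr /= rE // subnn mul0n -mE.
have [s [ss hs]] := homog_factor r; rewrite sr /= in ss hs.
have topE x y : ev2 (top_form m n (n * m) P) (x, y) =
    lead_coef r * \prod_(l <- s) (y ^+ a - l * x ^+ b).
  rewrite -hs mE nE ev2_top_form_line // -?mE -?nE ?sP ?sYP //.
  by apply: eq_bigr => k _; rewrite rE // -ltnS ltn_ord.
have T10 : ev2 (top_form m n (n * m) P) (1, 0) = P`_0`_n.
  rewrite topE -hs big_ord_recl /= big1 ?addr0 => [|k _].
    by rewrite rE // expr0 expr1n mulr1 expr1n mulr1 mul0n subn0 -nE.
  by rewrite expr0n -leqn0 leqNgt a0 /= expr0n mulr0 mul0r.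
have [al [be [al0 be0 nc Tab]]] := @degenerate P Q A B m n (n * m) 1 0 h1 h2 h3 h4 hw.
have E : comp2 (top_form m n (n * m) P) al be =
    (lead_coef r)%:P * \prod_(l <- s) (be ^+ a - l *: al ^+ b).
  apply: polyC_inj_fun => z; rewrite horner_comp2 topE hornerM hornerC horner_prod.
  by congr (_ * _); apply: eq_bigr => l _; rewrite hornerD hornerN hornerZ !horner_exp.
have : size (comp2 (top_form m n (n * m) P) al be) == 1%N by rewrite Tab size_polyC_neq0 // T10.
rewrite E size_mul_eq1 => /andP[_ /size_prod_seq_eq1 hsz].
have {}hsz l : l \in s -> size (be ^+ a - l *: al ^+ b) = 1%N by move=> ls; apply: hsz.
have ne : s != [::] by rewrite -size_eq0 ss -lt0n.
have [l ls] : exists l, l \in s by case: (s) ne => // l s' _; exists l; rewrite inE eqxx.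
have cst (p : {poly C}) k : (0 < k)%N -> (size (p ^+ k) <= 1)%N -> (size p <= 1)%N.
  move=> k0 h; have := size_exp p k; have -> : (size (p ^+ k)).-1 = 0%N by case: (size _) h => [|[]].
  by move/esym/eqP; rewrite muln_eq0 (negPf (lt0n_neq0 k0)) orbF; case: (size p) => [|[]].
have all_l l' : l' \in s -> l' = l.
  move=> l's; apply/eqP; apply/negPn/negP => ll.
  have sal : (size al <= 1)%N.
    apply: (cst _ b) => //.
    have <- : (l - l')^-1 *: ((be ^+ a - l' *: al ^+ b) - (be ^+ a - l *: al ^+ b)) = al ^+ b.
      rewrite opprB [X in _ *: X]addrC addrA subrK -scalerBl scalerA mulVf ?scale1r //.
      by rewrite subr_eq0 eq_sym.
    rewrite (leq_trans (size_scale_leq _ _)) // (leq_trans (size_polyD _ _)) //.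
    by rewrite size_polyN !hsz.
  have sbe : (size be <= 1)%N.
    apply: (cst _ a) => //.
    rewrite -[be ^+ a](subrK (l *: al ^+ b)) (leq_trans (size_polyD _ _)) // geq_max hsz //=.
    rewrite (leq_trans (size_scale_leq _ _)) // (leq_trans (size_poly_exp_leq _ _)) //.
    by case: (size al) sal => [|[]].
  by move: nc; rewrite !ltnNge sal sbe.
have sN : s = nseq g l.
  by rewrite -ss; apply/all_pred1P/allP => l' /all_l /= ->; rewrite eqxx.
have prodE X : \prod_(l0 <- s) (X - l0 * (1 : C)) = (X - l) ^+ g.
  rewrite sN; elim: (g) => [|k IH] /=; first by rewrite big_nil.
  by rewrite big_cons IH exprS mulr1.
have l0 : l != 0.
  apply: contra cx => /eqP l0; rewrite -T10 topE expr1n expr0n -leqn0 leqNgt a0 /=.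
  by rewrite prodE l0 subr0 expr0n -leqn0 leqNgt g0 mulr0.
exists g, a, b, l, (lead_coef r); split=> //.
  exact: (curve_exponents a0 b0 l0 (hsz l ls) nc).
move=> x y; rewrite topE sN; congr (_ * _); elim: (g) => [|k IH] /=; first by rewrite big_nil.
by rewrite big_cons IH exprS.
Qed.

Lemma jung_step P Q A B : inverse_pair P Q A B -> (1 < sizeY P)%N -> (1 < size P)%N ->
  exists l b, (sizeY (shear_sub l b P) < sizeY P)%N \/
     (sizeY (shear_sub l b (swapXY P)) < sizeY (swapXY P))%N.
Proof.
move=> iP; set n := (sizeY P).-1; set m := (size P).-1 => n1 m1.
have n0 : (0 < n)%N by rewrite /n; case: (sizeY P) n1 => [|[]].
have m0 : (0 < m)%N by rewrite /m; case: (size P) m1 => [|[]].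
have nE : n.+1 = sizeY P by rewrite prednK // ltnW.
have mE : m.+1 = size P by rewrite prednK // ltnW.
have hw := coord_weight_bound iP n0 m0; rewrite -/n -/m in hw.
have [g [a [b [l [c [ng mg [c0 l0] ab topE]]]]]] := coord_top_form iP n0 m0.
rewrite -/n -/m in ng mg topE.
have g0 : (0 < g)%N by case: (g) mg => //; move: m0; case: (m).
have a0 : (0 < a)%N by case: (a) mg => //; rewrite muln0; move: m0; case: (m).
have b0 : (0 < b)%N by case: (b) ng => //; rewrite muln0; move: n0; case: (n).
case: ab => [a1|b1].
  exists l, b; left; rewrite -nE ltnS; apply: sizeY_shear_sub => // [i j /hw|].
    by rewrite ng mg a1 muln1; nia.
  have -> : top_form 1 b n P = top_form m n (n * m) P.
    apply/polyP => j; apply/polyP => i; rewrite !coef_top_form.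
    suff -> : (i * 1 + j * b == n)%N = (i * m + j * n == n * m)%N by [].
    by rewrite ng mg a1; apply/eqP/eqP; nia.
  by rewrite topE a1 expr1 expr1n mulr1 subrr expr0n -leqn0 leqNgt g0 mulr0.
(* For b = 1 the swapped form is c (x^a - l y)^g, which vanishes at (1, l^-1). *)
exists l^-1, a; right.
have -> : sizeY (swapXY P) = size P by rewrite sizeYE swapXYK.
rewrite -mE ltnS.
apply: sizeY_shear_sub => // [i j|].
  by rewrite coef_swapXY => /hw; rewrite ng mg b1 muln1; nia.
have E : top_form 1 a m (swapXY P) = swapXY (top_form m n (n * m) P).
  apply/polyP => j; apply/polyP => i; rewrite coef_swapXY !coef_top_form coef_swapXY.
  suff -> : (i * 1 + j * a == m)%N = (j * m + i * n == n * m)%N by [].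
  by rewrite ng mg b1; apply/eqP/eqP; nia.
rewrite E ev2_swapXY topE b1 expr1 expr1n mulfV // subrr.
by rewrite expr0n -leqn0 leqNgt g0 mulr0.
Qed.
(** * Jung's theorem *)

(** Elementary maps as data: being affine or diagonal becomes a decidable condition on [epol].
    Equality of letters is stated through [app]. *)
Record elem := Elem { eal : C; ebe : C; eeta : C; epol : {poly C};
  elem_neq0 : (eal != 0) && (ebe != 0) }.

Definition app (e : elem) : map2 :=
  fun z => (eal e * z.1 + (epol e).[z.2], ebe e * z.2 + eeta e).

Lemma eal_neq0 e : eal e != 0. Proof. by case/andP: (elem_neq0 e). Qed.
Lemma ebe_neq0 e : ebe e != 0. Proof. by case/andP: (elem_neq0 e). Qed.

Lemma app_inj e f : app e =1 app f ->
  [/\ eal e = eal f, ebe e = ebe f, eeta e = eeta f & epol e = epol f].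
Proof.
move=> h; have h1 y := congr1 fst (h (0, y)); have h2 y := congr1 snd (h (0, y)).
rewrite /= in h1 h2.
have hp : epol e = epol f.
  by apply: polyC_inj_fun => y; have := h1 y; rewrite !mulr0 !add0r.
have he : eeta e = eeta f by have := h2 0; rewrite !mulr0 !add0r.
split=> //.
  by have := congr1 fst (h (1, 0)); rewrite /= hp !mulr1 => /addIr.
by have := h2 1; rewrite he !mulr1 => /addIr.
Qed.

Lemma elem1_proof : ((1 : C) != 0) && ((1 : C) != 0). Proof. by rewrite oner_neq0. Qed.
Definition elem1 := @Elem 1 1 0 0 elem1_proof.

Lemma app1 z : app elem1 z = z.
Proof. by case: z => x y; rewrite /app /= horner0 !mul1r !addr0. Qed.

Lemma elemM_proof e f : (eal e * eal f != 0) && (ebe e * ebe f != 0).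
Proof. by rewrite !mulf_neq0 ?eal_neq0 ?ebe_neq0. Qed.

Definition elemM e f := @Elem (eal e * eal f) (ebe e * ebe f) (ebe e * eeta f + eeta e)
  (eal e *: epol f + (epol e \Po (ebe f *: 'X + (eeta f)%:P))) (elemM_proof e f).

Lemma appM e f z : app (elemM e f) z = app e (app f z).
Proof.
case: z => x y; rewrite /app /= hornerD hornerZ horner_comp hornerD hornerZ hornerX hornerC.
by congr pair; ring.
Qed.

Lemma elemV_proof e : ((eal e)^-1 != 0) && ((ebe e)^-1 != 0).
Proof. by rewrite !invr_neq0 ?eal_neq0 ?ebe_neq0. Qed.

Definition elemV e := @Elem (eal e)^-1 (ebe e)^-1 (- (eeta e / ebe e))
  (- (eal e)^-1 *: (epol e \Po ((ebe e)^-1 *: 'X + (- (eeta e / ebe e))%:P))) (elemV_proof e).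

Lemma appVK e z : app (elemV e) (app e z) = z.
Proof.
have h1 := eal_neq0 e; have h2 := ebe_neq0 e.
case: z => x y; rewrite /app /= hornerZ horner_comp hornerD hornerZ hornerX hornerC.
have -> : (ebe e)^-1 * (ebe e * y + eeta e) + - (eeta e / ebe e) = y by field.
by congr pair; field.
Qed.

Lemma appKV e z : app e (app (elemV e) z) = z.
Proof.
have h1 := eal_neq0 e; have h2 := ebe_neq0 e.
case: z => x y; rewrite /app /= hornerZ horner_comp hornerD hornerZ hornerX hornerC.
by congr pair; field.
Qed.

Definition nonaff e := (2 < size (epol e))%N.
(** Translations are allowed. These are the elementary maps whose conjugate by t is again
    elementary. *)
Definition isdiag e := (size (epol e) <= 1)%N.

Lemma isdiag_aff e : isdiag e -> ~~ nonaff e.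
Proof. by rewrite /isdiag /nonaff -leqNgt => /leq_trans; apply. Qed.

Lemma size_lin (a b : C) : a != 0 -> size (a *: 'X + b%:P) = 2%N.
Proof.
move=> a0; rewrite size_polyDl size_scale ?size_polyX //.
by rewrite (leq_ltn_trans (size_polyC_leq1 _)).
Qed.

Lemma size_epolM e f :
  (size (epol (elemM e f)) <= maxn (size (epol e)) (size (epol f)))%N.
Proof.
rewrite /= (leq_trans (size_polyD _ _)) // size_scale ?eal_neq0 //.
by rewrite size_comp_poly2 ?size_lin ?ebe_neq0 // maxnC.
Qed.

Lemma size_epolV e : size (epol (elemV e)) = size (epol e).
Proof.
by rewrite /= size_scale ?oppr_eq0 ?invr_eq0 ?eal_neq0 // size_comp_poly2 // size_lin ?invr_neq0 ?ebe_neq0.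
Qed.

Lemma nonaffV e : nonaff (elemV e) = nonaff e. Proof. by rewrite /nonaff size_epolV. Qed.
Lemma affM e f : ~~ nonaff e -> ~~ nonaff f -> ~~ nonaff (elemM e f).
Proof.
by rewrite /nonaff -!leqNgt => h1 h2; rewrite (leq_trans (size_epolM _ _)) // geq_max h1.
Qed.

Lemma eq_app_nonaff e f : app e =1 app f -> nonaff e = nonaff f.
Proof. by move=> /app_inj[_ _ _ h]; rewrite /nonaff h. Qed.

Lemma eq_app_isdiag e f : app e =1 app f -> isdiag e = isdiag f.
Proof. by move=> /app_inj[_ _ _ h]; rewrite /isdiag h. Qed.

Lemma nonaffMl e f : ~~ nonaff e -> nonaff f -> nonaff (elemM e f).
Proof.
move=> he hf; apply/negPn/negP => h.
have := affM (eq_ind_r (fun b => ~~ b) he (nonaffV e)) h.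
rewrite (@eq_app_nonaff _ f) ?hf // => z.
by rewrite !appM appVK.
Qed.

Lemma nonaffMr e f : nonaff e -> ~~ nonaff f -> nonaff (elemM e f).
Proof.
move=> he hf; apply/negPn/negP => h.
have := affM h (eq_ind_r (fun b => ~~ b) hf (nonaffV f)).
rewrite (@eq_app_nonaff _ e) ?he // => z.
by rewrite !appM appKV.
Qed.

Lemma tswK z : tsw (tsw z) = z. Proof. by case: z. Qed.

Lemma diag_swap_proof d : (ebe d != 0) && (eal d != 0).
Proof. by rewrite eal_neq0 ebe_neq0. Qed.

(* t d t, for a diagonal d *)
Definition diag_swap d := @Elem (ebe d) (eal d) ((epol d)`_0) (eeta d)%:P (diag_swap_proof d).

Lemma isdiag_swap d : isdiag (diag_swap d).
Proof. exact: size_polyC_leq1. Qed.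

Lemma app_diag_swap d z : isdiag d -> app (diag_swap d) z = tsw (app d (tsw z)).
Proof.
move=> /size1_polyC h; case: z => x y.
have hv t : (epol d).[t] = (epol d)`_0 by rewrite [in LHS]h hornerC.
by rewrite /app /tsw /= hv hornerC.
Qed.

(** The big cell of the Bruhat decomposition: [s2] produces c x + d y + v as first coordinate, the
    swap makes it the second, and [s1] adds a / c times it to recover the other coordinate. *)
Lemma aff_bruhat (a b c d u v : C) : c != 0 -> a * d - b * c != 0 ->
  exists s1 s2, [/\ ~~ nonaff s1, ~~ nonaff s2 &
    forall x y, (a * x + b * y + u, c * x + d * y + v) = app s1 (tsw (app s2 (x, y)))].
Proof.
move=> c0 D0.
have p1 : (b - a * d / c != 0) && ((1 : C) != 0).
  rewrite oner_neq0 andbT; apply: contra D0 => /eqP h.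
  by apply/eqP; transitivity (- c * (b - a * d / c)); [field|rewrite h mulr0].
have p2 : (c != 0) && ((1 : C) != 0) by rewrite c0 oner_neq0.
exists (@Elem _ _ 0 ((a / c) *: 'X + (u - a * v / c)%:P) p1), (@Elem _ _ 0 (d *: 'X + v%:P) p2).
have sz (q r : C) : (size (q *: 'X + r%:P)%R <= 2)%N.
  rewrite (leq_trans (size_polyD _ _)) // geq_max (leq_trans (size_scale_leq _ _)) ?size_polyX //=.
  by rewrite (leq_trans (size_polyC_leq1 _)).
split=> [||x y]; rewrite ?/nonaff -?leqNgt //=.
rewrite /app /tsw /= !hornerD !hornerZ !hornerX !hornerC.
by congr pair; field.
Qed.

(** The conjugate t s t is affine with a nonzero lower left entry, hence in the big cell. This rule
    trades two swaps for one and removes an affine letter from the inside of a word. *)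
Lemma skew_bruhat s : ~~ nonaff s -> ~~ isdiag s ->
  exists s1 s2, [/\ ~~ nonaff s1, ~~ nonaff s2 &
    forall z, tsw (app s (tsw z)) = app s1 (tsw (app s2 z))].
Proof.
move=> h1 h2; have sp : size (epol s) = 2%N.
  by apply/eqP; rewrite eqn_leq; move: h1 h2; rewrite /nonaff /isdiag -!ltnNge ltnS => -> ->.
have pE y : (epol s).[y] = (epol s)`_1 * y + (epol s)`_0.
  by rewrite horner_coef sp !big_ord_recl big_ord0 /= expr0 expr1; ring.
have g0 : (epol s)`_1 != 0.
  have : lead_coef (epol s) != 0 by rewrite lead_coef_eq0 -size_poly_gt0 sp.
  by rewrite lead_coefE sp.
have := @aff_bruhat (ebe s) 0 (epol s)`_1 (eal s) (eeta s) (epol s)`_0 g0.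
rewrite mul0r subr0 mulf_neq0 ?eal_neq0 ?ebe_neq0 // => /(_ isT) [s1 [s2 [e1 e2 e3]]].
exists s1, s2; split=> // -[x y]; rewrite -e3 /app /tsw /= pE.
by congr pair; ring.
Qed.

(* [tv [:: x1; ...; xn]] is the word t x1 t x2 ... t xn. *)
Definition tv (l : seq elem) : map2 := fun z => foldr (fun x w => tsw (app x w)) z l.

Lemma tv_cons x l z : tv (x :: l) z = tsw (app x (tv l z)). Proof. by []. Qed.

Lemma tv_cat l1 l2 z : tv (l1 ++ l2) z = tv l1 (tv l2 z).
Proof. by rewrite /tv foldr_cat. Qed.

Lemma tv_rcons l x z : tv (rcons l x) z = tv l (tsw (app x z)).
Proof. by rewrite -cats1 tv_cat. Qed.

Definition normal_form (f : map2) : Prop :=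
  (exists c, f =1 app c) \/
  (exists c Z z, all nonaff Z /\ forall w, f w = app c (tv (rcons Z z) w)).

Lemma normal_form_app e f : normal_form f -> normal_form (app e \o f).
Proof.
case=> [[c h]|[c [Z [z [hZ h]]]]].
  by left; exists (elemM e c) => w; rewrite /= h appM.
by right; exists (elemM e c), Z, z; split=> // w; rewrite /= h appM.
Qed.

(** A nonaffine [c] becomes an inner letter. A diagonal one crosses the swap and merges with the
    next letter. For the remaining affine ones t c t = s1 t s2, and only [s2] merges with the next
    letter, which stays nonaffine if it was. *)
Lemma normal_form_tsw f : normal_form f -> normal_form (tsw \o f).
Proof.
case=> [[c h]|[c [Z [z [hZ h]]]]].
  by right; exists elem1, [::], c; split=> // w; rewrite app1 /= h.
have [nc|ac] := boolP (nonaff c).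
  by right; exists elem1, (c :: Z), z; split=> [|w]; rewrite ?app1 /= ?nc // h.
have [dc|ndc] := boolP (isdiag c).
  case: Z hZ h => [|x Z] hZ h.
    by left; exists (elemM (diag_swap c) z) => w; rewrite /= h appM app_diag_swap.
  right; exists (elemM (diag_swap c) x), Z, z; split=> [|w]; first by case/andP: hZ.
  by rewrite /= h appM app_diag_swap.
have [s1 [s2 [h1 h2 h3]]] := skew_bruhat ac ndc.
case: Z hZ h => [|x Z] hZ h.
  by right; exists s1, [::], (elemM s2 z); split=> // w; rewrite /= h /= h3 appM.
right; exists s1, (elemM s2 x :: Z), z; split=> [|w].
  by case/andP: hZ => hx hZ; rewrite /= nonaffMl.
by rewrite /= h /= h3 appM.
Qed.

Lemma eq_normal_form f g : f =1 g -> normal_form f -> normal_form g.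
Proof.
move=> e [[c h]|[c [Z [z [hZ h]]]]]; first by left; exists c => w; rewrite -e.
by right; exists c, Z, z; split=> // w; rewrite -e.
Qed.

Lemma normal_form_tet e : normal_form (tsw \o (app e \o tsw)).
Proof.
apply: normal_form_tsw; apply: normal_form_app.
apply: (@eq_normal_form (tsw \o app elem1)) => [z|]; first by rewrite /= app1.
by apply: normal_form_tsw; left; exists elem1.
Qed.

Lemma ev2_horner_eval P x y : ev2 P (x, y) = (map_poly (horner_eval x) P).[y].
Proof.
rewrite /ev2 /=; have := horner_map (horner_eval x) P y%:P.
by rewrite /= /horner_eval hornerC.
Qed.

(* [size P <= 1] says that P depends on x only. *)
Lemma normal_form_triangular P Q A B : inverse_pair P Q A B -> (size P <= 1)%N ->
  normal_form (fun z => (ev2 A z, ev2 B z)).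
Proof.
move=> [h1 h2 h3 h4] sP; pose p := P`_0.
have PE x y : ev2 P (x, y) = p.[x] by rewrite /ev2 [in LHS](size1_polyC sP) hornerC.
have sp : size p = 2%N.
  have : p \Po A.[0] = 'X.
    apply: polyC_inj_fun => u; rewrite horner_comp hornerX.
    by have := h3 (u, 0); rewrite PE /ev2 /= polyC0.
  move=> E; have := size_comp_poly p A.[0]; rewrite E size_polyX /= => /esym/eqP.
  by rewrite muln_eq1 => /andP[/eqP]; case: (size p) => [|[|[]]].
have pE x : p.[x] = p`_1 * x + p`_0.
  by rewrite horner_coef sp !big_ord_recl big_ord0 /= expr0 expr1; ring.
have c0 : p`_1 != 0.
  have : lead_coef p != 0 by rewrite lead_coef_eq0 -size_poly_gt0 sp.
  by rewrite lead_coefE sp.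
have AE u v : ev2 A (u, v) = (u - p`_0) / p`_1.
  by have := h3 (u, v); rewrite PE pE /= => {2}<-; field.
pose Qx x := map_poly (horner_eval x) Q.
have QxE x y : (Qx x).[y] = ev2 Q (x, y).
  by rewrite ev2_horner_eval.
(* For fixed x the polynomial Q(x, -) has the polynomial right inverse v |-> B(p_1 x + p_0, v), so
   its degree is 1. *)
have sQ x : size (Qx x) = 2%N.
  pose Bx := map_poly (horner_eval (p`_1 * x + p`_0)) B.
  have : Qx x \Po Bx = 'X.
    apply: polyC_inj_fun => v; rewrite horner_comp hornerX QxE.
    have := h4 (p`_1 * x + p`_0, v); rewrite AE /= => {2}<-; congr (ev2 Q (_, _)).
      by field.
    by rewrite ev2_horner_eval.
  move=> E; have := size_comp_poly (Qx x) Bx; rewrite E size_polyX /= => /esym/eqP.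
  by rewrite muln_eq1 => /andP[/eqP]; case: (size (Qx x)) => [|[|[]]].
have Q1 x : (Q`_1).[x] != 0.
  have : lead_coef (Qx x) != 0 by rewrite lead_coef_eq0 -size_poly_gt0 sQ.
  by rewrite lead_coefE sQ coef_map.
(* The coefficient of y in Q never vanishes on C, so it is constant. *)
have sQ1 : size Q`_1 = 1%N.
  apply/eqP/negPn/negP => /closed_rootP[x]; rewrite rootE => h.
  by move: (Q1 x); rewrite h.
have [k k0 Ek] : exists2 k : C, k != 0 & forall x, (Q`_1).[x] = k.
  have sQ1' : (size (Q`_1)%R <= 1)%N by rewrite sQ1.
  exists (Q`_1)`_0 => [|x]; last by rewrite [in LHS](size1_polyC sQ1') hornerC.
  by have := Q1 0; rewrite horner_coef0.
pose q := Q`_0.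
have QE x y : ev2 Q (x, y) = q.[x] + k * y.
  rewrite -QxE horner_coef sQ !big_ord_recl big_ord0 /= !coef_map /= /horner_eval Ek.
  by rewrite expr0 expr1; ring.
have BE u v : ev2 B (u, v) = (v - q.[(u - p`_0) / p`_1]) / k.
  by have := h4 (u, v); rewrite AE QE /= => {2}<-; field.
have pf : (k^-1 != 0) && ((p`_1)^-1 != 0) by rewrite !invr_neq0.
pose e := @Elem _ _ (- p`_0 / p`_1) (- k^-1 *: (q \Po ((p`_1)^-1 *: 'X + (- p`_0 / p`_1)%:P))) pf.
apply: (eq_normal_form _ (normal_form_tet e)) => -[u v].
rewrite /= /app /tsw /= AE BE hornerZ horner_comp hornerD hornerZ hornerX hornerC.
have -> : (p`_1)^-1 * u + - p`_0 / p`_1 = (u - p`_0) / p`_1 by field.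
by congr pair; field.
Qed.

(** Precomposing (P, Q) with a shear composes the inverse (A, B) with the inverse shear; this
    changes only B, by l A^b, and is undone by a word t e t. *)
Lemma normal_form_shear P Q A B l b : inverse_pair P Q A B ->
  (forall Q' B', inverse_pair (shear_sub l b P) Q' A B' ->
     normal_form (fun z => (ev2 A z, ev2 B' z))) ->
  normal_form (fun z => (ev2 A z, ev2 B z)).
Proof.
move=> [h1 h2 h3 h4] H.
have [B' hB'] : exists B' : {poly {poly C}}, forall z, ev2 B' z = ev2 B z - l * ev2 A z ^+ b.
  exists (B - (l%:P)%:P * A ^+ b) => z.
  by rewrite /ev2 hornerD hornerN hornerM horner_exp !hornerC hornerD hornerN hornerM horner_exp hornerC.
have pf : ((1 : C) != 0) && ((1 : C) != 0) by rewrite oner_neq0.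
pose e := @Elem _ _ 0 (l *: 'X^b) pf.
apply: (@eq_normal_form ((tsw \o (app e \o tsw)) \o (fun z => (ev2 A z, ev2 B' z)))).
  by move=> z; rewrite /= /app /tsw /= hB' hornerZ hornerXn; congr pair; ring.
have iP' : inverse_pair (shear_sub l b P) (shear_sub l b Q) A B'.
  split=> -[x y]; rewrite ?hB' !ev2_shear_sub ?h1 ?h2 /=; try ring.
  - by rewrite subrK h3.
  - by rewrite subrK h4.
apply: normal_form_tsw; apply: normal_form_app; apply: normal_form_tsw.
exact: H iP'.
Qed.

(** Only the coordinate P has to be simplified: a shear lowers one of its two partial degrees and
    keeps the other, and once P depends on one variable the inverse pair is triangular. *)
Theorem jung P Q A B : inverse_pair P Q A B -> normal_form (fun z => (ev2 A z, ev2 B z)).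
Proof.
have [N] := ubnP (size P + sizeY P); elim: N P Q A B => // N IH P Q A B hN iP.
have swapN R S : normal_form (fun z => (ev2 R z, ev2 S z)) ->
    normal_form (fun z => (ev2 S z, ev2 R z)).
  by move=> /normal_form_tsw; apply: eq_normal_form.
have sY : sizeY (swapXY P) = size P by rewrite sizeYE swapXYK.
have sX : size (swapXY P) = sizeY P by rewrite sizeYE.
have [s1|s1] := leqP (size P) 1; first exact: normal_form_triangular iP s1.
have [s2|s2] := leqP (sizeY P) 1.
  apply: swapN; apply: (normal_form_triangular (inverse_pair_swap iP)).
  by rewrite sX.
have [l [b [hb|hb]]] := jung_step iP s2 s1.
  apply: (normal_form_shear (l := l) (b := b) iP) => Q' B' iP'.
  apply: IH iP'; rewrite size_shear_sub; lia.
apply: swapN; apply: (normal_form_shear (l := l) (b := b) (inverse_pair_swap iP)) => Q' B' iP'.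
apply: IH iP'; rewrite size_shear_sub sX; rewrite sY in hb; lia.
Qed.
(** * Conjugate cyclic words *)

(* No inner letter is diagonal and no two neighbours are affine: since t s t = s1 t s2 for
   an affine nondiagonal s, this is reducedness up to regrouping. *)
Definition head_nonaff (l : seq elem) := if l is x :: _ then nonaff x else true.

Fixpoint good_word (l : seq elem) :=
  if l is x :: l' then [&& ~~ isdiag x, nonaff x || head_nonaff l' & good_word l'] else true.

Lemma nonaff_ndiag x : nonaff x -> ~~ isdiag x.
Proof. by move=> h; apply/negP => /isdiag_aff; rewrite h. Qed.

Lemma all_nonaff_good l : all nonaff l -> good_word l.
Proof. by elim: l => //= x l IH /andP[hx /IH ->]; rewrite nonaff_ndiag // hx. Qed.

Lemma good_word_cat l1 l2 : all nonaff l1 -> good_word l2 -> good_word (l1 ++ l2).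
Proof. by elim: l1 => //= x l IH /andP[hx /IH h] /h ->; rewrite nonaff_ndiag // hx. Qed.

(* Degrees grow along the image of the curve (s, 0); an affine letter only keeps the two
   degrees equal. *)
Lemma good_word_curve Z z : good_word Z -> exists p q : {poly C},
  [/\ forall s, tv (rcons Z z) (s, 0) = (p.[s], q.[s]), (1 < size q)%N,
      (size p <= size q)%N & head_nonaff Z -> (size p < size q)%N].
Proof.
elim: Z => [_|x Z IH] /=.
  exists (eeta z)%:P, (eal z *: 'X + ((epol z).[0])%:P); rewrite size_lin ?eal_neq0 //.
  have h : (size (eeta z)%:P < 2)%N by rewrite ltnS size_polyC_leq1.
  split=> //; last exact: ltnW.
  move=> s; rewrite /tsw /app /= mulr0 add0r hornerC hornerD hornerZ hornerX hornerC.
  by [].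
case/and3P=> ndx hx /IH[p [q [E sq spq spq']]].
have sx : (1 < size (epol x))%N by rewrite ltnNge.
have scomp : (size (epol x \Po q)).-1 = ((size (epol x)).-1 * (size q).-1)%N := size_comp_poly _ _.
have hpx : (size p < size (epol x \Po q)%R)%N.
  move: scomp sx sq spq; case: (size (epol x \Po q)) => [|k] /=.
    by case: (size (epol x)) => [|[]] // a; case: (size q) => [|[]].
  move=> -> sx sq spq; case/orP: hx => [hx|/spq' hx]; rewrite /nonaff in hx.
    rewrite ltnS (leq_trans spq) //; move: hx sq.
    by case: (size (epol x)) => [|[|[|a]]] // _; case: (size q) => [|[|b]] // _ /=; nia.
  rewrite ltnS; move: hx sx sq.
  by case: (size (epol x)) => [|[|a]] //; case: (size q) => [|[|b]] //=; nia.
exists (ebe x *: q + (eeta x)%:P), (eal x *: p + (epol x \Po q)).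
have s1 : size (ebe x *: q + (eeta x)%:P) = size q.
  by rewrite size_polyDl size_scale ?ebe_neq0 // (leq_ltn_trans (size_polyC_leq1 _)).
have s2 : size (eal x *: p + (epol x \Po q)) = size (epol x \Po q).
  by rewrite addrC size_polyDl // size_scale ?eal_neq0.
have hq : (size q <= size (epol x \Po q)%R)%N.
  move: scomp hpx sx sq; case: (size (_ \Po _)) => [|k] //= -> _.
  case: (size (epol x)) => [|[|a]] // _; case: (size q) => [|[|b]] //=; nia.
rewrite s1 s2; split.
- by move=> s; rewrite E /tsw /app /= !hornerD !hornerZ hornerC horner_comp.
- exact: leq_trans sq hq.
- exact: hq.
- rewrite /nonaff; move: scomp hpx sq; case: (size (_ \Po _)) => [|k] //= -> _.
  case: (size (epol x)) => [|[|[|a]]] // + _; case: (size q) => [|[|b]] //=; nia.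
Qed.

(** On the curve (s, 0) the second coordinate of the word is a nonconstant polynomial in s, while
    the identity would make it 0. *)
Lemma good_word_neq_id b Z z : good_word Z -> ~ (forall w, app b (tv (rcons Z z) w) = w).
Proof.
move=> hZ h; have [p [q [E sq _ _]]] := good_word_curve z hZ.
have : ebe b *: q + (eeta b)%:P = 0.
  apply: polyC_inj_fun => s; have := congr1 snd (h (s, 0)).
  by rewrite E /= hornerD hornerZ hornerC horner0.
move/(congr1 (fun r : {poly C} => size r)).
rewrite size_poly0 size_polyDl size_scale ?ebe_neq0 //; first by move=> E0; rewrite E0 in sq.
by rewrite (leq_ltn_trans (size_polyC_leq1 _)).
Qed.

Arguments tv : simpl never.

Lemma tv_nil z : tv [::] z = z. Proof. by []. Qed.

(* the inverse of [tsw \o tv (rcons Y y)] *)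
Definition vt (Y : seq elem) (y : elem) : map2 :=
  fun w => app (elemV y) (tv (rev (map elemV Y)) w).

Lemma vtK Y y w : vt Y y (tsw (tv (rcons Y y) w)) = w.
Proof.
rewrite /vt; elim: Y => [|x Y IH] /=; first by rewrite tv_cons !tv_nil tswK appVK.
by rewrite tv_cons rev_cons (tv_rcons (rev _)) tswK appVK IH.
Qed.

Lemma vtKr Y y w : tsw (tv (rcons Y y) (vt Y y w)) = w.
Proof.
rewrite /vt; elim: Y w => [|x Y IH] w /=.
  by rewrite tv_cons !tv_nil appKV tswK.
by rewrite tv_cons tswK rev_cons (tv_rcons (rev _)) -[tv (rcons Y y) _]tswK IH tswK appKV.
Qed.

Lemma all_nonaff_rev_inv l : all nonaff (rev (map elemV l)) = all nonaff l.
Proof. by rewrite all_rev all_map; apply: eq_all => x; rewrite /= nonaffV. Qed.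

(* [(tv W')^-1 phi (tv W) phi^-1] written as one word, for phi = c tv (Z, z) *)
Lemma conj_word_eq W0 xn Y0 yn c Z z :
  (forall w, app c (tv (rcons Z z) (tv (rcons W0 xn) w)) =
             tv (rcons Y0 yn) (app c (tv (rcons Z z) w))) ->
  forall w, app (elemV yn) (tv (rcons (rev (map elemV Y0) ++ c :: Z ++ z :: W0 ++
     elemM xn (elemV z) :: rev (map elemV Z)) (elemV c)) w) = w.
Proof.
move=> h w; pose u := vt (c :: Z) z w.
have phiu : app c (tv (rcons Z z) u) = w.
  by rewrite -[RHS](vtKr (c :: Z) z w) /= tv_cons tswK.
have : vt Y0 yn (tsw (app c (tv (rcons Z z) (tv (rcons W0 xn) u)))) = w.
  by rewrite h phiu vtK.
rewrite {1}/vt => {2}<-; congr (app _ _).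
rewrite rcons_cat tv_cat rcons_cons tv_cons rcons_cat tv_cat rcons_cons tv_cons.
rewrite rcons_cat tv_cat rcons_cons tv_cons appM.
by rewrite !tv_rcons /u /vt /= rev_cons tv_rcons.
Qed.

Definition conj_diag (V W : seq elem) :=
  exists d, isdiag d /\ forall w, app d (tv V w) = tv W (app d w).

(** Only [c] and [z] can be affine in this word; the last hypothesis keeps them from being two
    affine neighbours. *)
Lemma good_conj_word Y0 c Z z W0 x' : all nonaff Y0 -> ~~ isdiag c -> all nonaff Z ->
  ~~ isdiag z -> all nonaff W0 -> nonaff x' ->
  nonaff c || (0 < size Z)%N || nonaff z ->
  good_word (rev (map elemV Y0) ++ c :: Z ++ z :: W0 ++ x' :: rev (map elemV Z)).
Proof.
move=> hY hc hZ hz hW hx hcz.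
have g : good_word (W0 ++ x' :: rev (map elemV Z)).
  apply: all_nonaff_good; rewrite all_cat hW /= hx.
  by rewrite all_nonaff_rev_inv.
have gz : good_word (z :: W0 ++ x' :: rev (map elemV Z)).
  rewrite /= hz g andbT; case: W0 hW {g} => [|a W0] /=; first by rewrite hx orbT.
  by case/andP=> ->; rewrite orbT.
apply: good_word_cat; first by rewrite all_nonaff_rev_inv.
rewrite /= hc good_word_cat // andbT.
case: (nonaff c) hcz => //=.
by case: Z hZ {g gz} => [|a Z] //= /andP[->].
Qed.

(** If [c] were not diagonal, it would be the only possibly affine inner letter of the word (tv
    Y')^-1 c (tv X') c^-1, with X' and Y' the full words; that word would be good and yet the
    identity. *)
Lemma conj_elem_diag c X x Y y : all nonaff X -> all nonaff Y -> 
  (forall w, app c (tv (rcons X x) w) = tv (rcons Y y) (app c w)) -> isdiag c.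
Proof.
move=> hX hY h; apply/negPn/negP => hc.
apply: (@good_word_neq_id (elemV y) (rev (map elemV Y) ++ c :: X) (elemM x (elemV c))).
  rewrite good_word_cat ?all_nonaff_rev_inv //= hc all_nonaff_good // andbT.
  by case: X hX {h} => [|a X] /=; [rewrite orbT|case/andP=> ->; rewrite orbT].
move=> w; have := vtK Y y (app c (app (elemV c) w)); rewrite -h appKV => {2}<-.
rewrite /vt; congr (app _ _).
by rewrite rcons_cat tv_cat rcons_cons tv_cons !tv_rcons appM.
Qed.

Definition intertwines (phi : map2) (W W' : seq elem) :=
  forall w, phi (tv W w) = tv W' (phi w).

Lemma eq_intertwines phi psi W W' : phi =1 psi -> intertwines phi W W' -> intertwines psi W W'.
Proof. by move=> e h w; rewrite -!e. Qed.

Lemma intertwines_rot phi x W W' : intertwines phi (x :: W) W' ->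
  intertwines (fun w => phi (tsw (app x w))) (rcons W x) W'.
Proof. by move=> h w; rewrite tv_rcons -h. Qed.

Lemma intertwines_rotr phi x W W' : intertwines phi (rcons W x) W' ->
  intertwines (fun w => phi (app (elemV x) (tsw w))) (x :: W) W'.
Proof. by move=> h w; rewrite -h tv_rcons tv_cons tswK appVK appKV tswK. Qed.

Lemma intertwines_rot_snd phi y W W' : intertwines phi W (y :: W') ->
  intertwines (fun w => app (elemV y) (tsw (phi w))) W (rcons W' y).
Proof. by move=> h w; rewrite h tv_cons tswK appVK tv_rcons appKV tswK. Qed.

Definition rot_conj (W W' : seq elem) := exists i j, conj_diag (rot i W) (rot j W').

Lemma rot_rot_ex (T : Type) i j (s : seq T) : exists k, rot i (rot j s) = rot k s.
Proof.
have [hj|hj] := leqP j (size s); last by exists i; rewrite (rot_oversize (ltnW hj)).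
have [hi|hi] := leqP i (size s); last by exists j; rewrite rot_oversize ?size_rot // ltnW.
by rewrite rot_add_mod //; eexists.
Qed.

Lemma rot_conj_rot i j W W' : rot_conj (rot i W) (rot j W') -> rot_conj W W'.
Proof.
move=> [k [l]]; have [k' ->] := rot_rot_ex k i W; have [l' ->] := rot_rot_ex l j W'.
by exists k', l'.
Qed.

Lemma rot_conj_rcons x W W' : rot_conj (rcons W x) W' -> rot_conj (x :: W) W'.
Proof. by rewrite -rot1_cons -{1}(rot0 W'); exact: rot_conj_rot. Qed.

Lemma rot_conj_cons x W W' : rot_conj (x :: W) W' -> rot_conj (rcons W x) W'.
Proof. by rewrite -{1}(rotr1_rcons x W) -{1}(rot0 W'); exact: rot_conj_rot. Qed.

Lemma rot_conj_rcons_snd y W W' : rot_conj W (rcons W' y) -> rot_conj W (y :: W').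
Proof. by rewrite -rot1_cons -{1}(rot0 W); exact: rot_conj_rot. Qed.

Lemma rot_conj_elem c W W' : all nonaff W -> all nonaff W' -> (0 < size W)%N -> (0 < size W')%N ->
  intertwines (app c) W W' -> rot_conj W W'.
Proof.
case/lastP: W => // X x; case/lastP: W' => // Y y.
rewrite !all_rcons => /andP[_ hX] /andP[_ hY] _ _ h.
exists 0%N, 0%N; rewrite !rot0; exists c; split=> //.
exact: conj_elem_diag hX hY h.
Qed.

Lemma isdiag_tsw d x w : isdiag d ->
  tsw (app d (tsw (app x w))) = app (elemM (diag_swap d) x) w.
Proof. by move=> hd; rewrite appM app_diag_swap. Qed.

(** The induction is on the number of inner letters of phi. Whenever an end of phi is diagonal, or
    cancels against W up to a diagonal map, a rotation merges letters and shortens phi; if nothing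
    merges, the word of W'^-1 phi W phi^-1 is good, which is impossible. *)
Lemma rot_conj_word N Z c z W W' : (size Z < N)%N -> all nonaff Z ->
  all nonaff W -> all nonaff W' -> (0 < size W)%N -> (0 < size W')%N ->
  intertwines (fun w => app c (tv (rcons Z z) w)) W W' -> rot_conj W W'.
Proof.
elim: N Z c z W W' => // N IH.
have del Z c e W W' : (size Z <= N)%N -> all nonaff Z ->
    all nonaff W -> all nonaff W' -> (0 < size W)%N -> (0 < size W')%N ->
    intertwines (fun w => app c (tv Z (app e w))) W W' -> rot_conj W W'.
  move=> sZ hZ hW hW' sW sW' h.
  case/lastP: Z sZ hZ h => [|Z z'] sZ hZ h.
    apply: (@rot_conj_elem (elemM c e)) => //; apply: eq_intertwines h => w.
    by rewrite tv_nil appM.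
  apply: (IH Z c (elemM z' e)) => //; first by rewrite size_rcons in sZ.
    by move: hZ; rewrite all_rcons => /andP[].
  by apply: eq_intertwines h => w; rewrite !tv_rcons appM.
have main Z c z W0 xn W' : (size Z <= N)%N -> all nonaff Z ->
    all nonaff (rcons W0 xn) -> all nonaff W' -> (0 < size W')%N ->
    nonaff (elemM xn (elemV z)) ->
    intertwines (fun w => app c (tv (rcons Z z) w)) (rcons W0 xn) W' -> rot_conj (rcons W0 xn) W'.
  move=> sZ hZ hW hW' sW' hxz h.
  have sW : (0 < size (rcons W0 xn))%N by rewrite size_rcons.
  (* A diagonal [z] crosses the swap and merges with the first letter of W once W is rotated. *)
  have [dz|ndz] := boolP (isdiag z).
    case E : (rcons W0 xn) sW hW h => [|x W] // _ hW h.
    apply: rot_conj_rcons; apply: (del Z c (elemM (diag_swap z) x)) => //.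
    - by rewrite all_rcons.
    - by rewrite size_rcons.
    apply: eq_intertwines (intertwines_rot h) => w.
    by rewrite tv_rcons isdiag_tsw.
  case: W' sW' hW' h => // y W' _ hW' h; apply: rot_conj_rcons_snd.
  have hyW : all nonaff (rcons W' y) by rewrite all_rcons.
  have sWy : (0 < size (rcons W' y))%N by rewrite size_rcons.
  have h' := intertwines_rot_snd h.
  (* Symmetrically at the left end: in y^-1 t c t z1 a diagonal [c] lets all three letters merge. *)
  have [dc|ndc] := boolP (isdiag c).
    case: Z sZ hZ h h' => [|z1 Z] sZ hZ h h'.
      apply: (@rot_conj_elem (elemM (elemV y) (elemM (diag_swap c) z))) => //.
      by apply: eq_intertwines h' => w; rewrite /= tv_cons tv_nil isdiag_tsw // [RHS]appM.
    apply: (IH Z (elemM (elemV y) (elemM (diag_swap c) z1)) z) => //.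
      by case/andP: hZ.
    by apply: eq_intertwines h' => w; rewrite /= tv_cons isdiag_tsw // [RHS]appM.
  have contra c' z' Y0 yn : ~~ isdiag c' -> ~~ isdiag z' -> nonaff (elemM xn (elemV z')) ->
      all nonaff (rcons Y0 yn) -> nonaff c' || (0 < size Z)%N || nonaff z' ->
      intertwines (fun w => app c' (tv (rcons Z z') w)) (rcons W0 xn) (rcons Y0 yn) -> False.
    move=> hc' hz' hxz'; rewrite all_rcons => /andP[_ hY0] hcz /conj_word_eq; apply: good_word_neq_id.
    apply: good_conj_word => //.
    by move: hW; rewrite all_rcons => /andP[].
  have [hcz|] := boolP (nonaff c || (0 < size Z)%N || nonaff z).
    case/lastP EE : (y :: W') hW' h => [|Y0 yn] // hW' h; exfalso.
    exact: (contra c z Y0 yn).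
  (* What remains is an affine phi = c t z, whose word has two affine neighbours. After rotating W'
     it becomes (y^-1 s1) t (s2 z), with nonaffine left letter. *)
  rewrite !negb_or -leqNgt leqn0 -andbA => /and3P[ac Z0 az].
  case: Z Z0 {sZ hZ} h h' contra => // _ h h' contra.
  have [s1 [s2 [as1 as2 hs]]] := skew_bruhat ac ndc.
  have h2 : intertwines (fun w => app (elemM (elemV y) s1) (tv (rcons [::] (elemM s2 z)) w))
      (rcons W0 xn) (rcons W' y).
    by apply: eq_intertwines h' => w; rewrite /= !tv_cons !tv_nil hs !appM.
  have as2z := affM as2 az.
  have [d2|nd2] := boolP (isdiag (elemM s2 z)).
    case E : (rcons W0 xn) sW hW h2 => [|x W] // _ hW h2.
    apply: rot_conj_rcons; apply: (@rot_conj_elem (elemM (elemM (elemV y) s1) (elemM (diag_swap (elemM s2 z)) x))) => //.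
    - by rewrite all_rcons.
    - by rewrite size_rcons.
    apply: eq_intertwines (intertwines_rot h2) => w.
    by rewrite /= tv_cons tv_nil isdiag_tsw // [RHS]appM.
  have ny : nonaff (elemM (elemV y) s1).
    by apply: nonaffMr => //; rewrite nonaffV; case/andP: hW'.
  exfalso; apply: (contra _ _ W' y) h2 => //; first exact: nonaff_ndiag.
    apply: nonaffMr; last by rewrite nonaffV.
    by move: hW; rewrite all_rcons => /andP[].
  by rewrite ny.
move=> Z c z W W' sZ hZ hW hW' sW sW' h.
case/lastP: W sW hW h => // W0 xn _ hW h.
have [hxz|hxz] := boolP (nonaff (elemM xn (elemV z))); first exact: (main Z c z).
have hxn : nonaff xn by move: hW; rewrite all_rcons => /andP[].
(* Here xn z^-1 is affine. Rotating W to the right makes phi end in t s t with s = z xn^-1 affine: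
   either s is diagonal and phi shortens, or t s t = s1 t s2, and the new last letter of W no longer
   cancels against [s2]. *)
apply: rot_conj_cons.
have hW1 : all nonaff (xn :: W0) by move: hW; rewrite all_rcons.
have h1 := intertwines_rotr h.
pose s := elemM z (elemV xn).
have as_ : ~~ nonaff s.
  have : ~~ nonaff (elemV (elemM xn (elemV z))) by rewrite nonaffV.
  rewrite (@eq_app_nonaff _ s) // => w.
  by rewrite -[RHS](appVK (elemM xn (elemV z))) (appM z) (appM xn) appVK appKV.
have h2 : intertwines (fun w => app c (tv Z (tsw (app s (tsw w))))) (xn :: W0) W'.
  by apply: eq_intertwines h1 => w; rewrite tv_rcons appM.
have [ds|nds] := boolP (isdiag s).
  apply: (del Z c (diag_swap s)) => //.
  by apply: eq_intertwines h2 => w; rewrite app_diag_swap.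
have [s1 [s2 [as1 as2 hs]]] := skew_bruhat as_ nds.
rewrite lastI in hW1 h2 *.
move: (belast xn W0) (last xn W0) hW1 h2 => W1 xm hW1 h2.
have hxm : nonaff (elemM xm (elemV s2)).
  apply: nonaffMr; last by rewrite nonaffV.
  by move: hW1; rewrite all_rcons => /andP[].
case/lastP: Z sZ hZ {h h1 main} (@main) h2 => [|Z z'] sZ hZ main h2.
  apply: (main [::] (elemM c s1) s2) => //.
  by apply: eq_intertwines h2 => w; rewrite /= tv_cons !tv_nil hs appM.
apply: (main (rcons Z (elemM z' s1)) c s2) => //.
- by rewrite size_rcons; rewrite size_rcons in sZ.
- move: hZ; rewrite !all_rcons => /andP[hz' ->]; rewrite andbT.
  exact: nonaffMr.
by apply: eq_intertwines h2 => w; rewrite !tv_rcons hs appM.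
Qed.
(** A nondiagonal [d] would give a good word equal to the identity. So [d] is diagonal, crosses the
    first swap, and y^-1 (t d t) x takes its place in front of the remaining letters. Good words
    also exclude different lengths. *)
Lemma tv_chain X Y d e : all nonaff X -> all nonaff Y -> isdiag e ->
  (forall w, app d (tv X w) = tv Y (app e w)) ->
  size X = size Y /\ exists ds : nat -> elem, [/\ ds 0%N = d, app (ds (size X)) =1 app e,
    forall i, (i <= size X)%N -> isdiag (ds i) &
    forall i, (i < size X)%N -> forall w, app (diag_swap (ds i)) (app (nth elem1 X i) w) =
        app (nth elem1 Y i) (app (ds i.+1) w)].
Proof.
elim: X Y d => [|x X IH] Y d hX hY he h.
  case/lastP: Y hY h => [|Y y] hY h.
    split=> //; exists (fun=> d); split=> // i; rewrite leqn0 => /eqP _.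
    by rewrite (@eq_app_isdiag d e).
  exfalso; apply: (@good_word_neq_id (elemV d) Y (elemM y e)).
    by rewrite all_nonaff_good //; move: hY; rewrite all_rcons => /andP[].
  by move=> w; have := h w; rewrite tv_nil !tv_rcons appM => <-; rewrite appVK.
have EX : exists X0 x', x :: X = rcons X0 x' by exists (belast x X), (last x X); exact: lastI.
have [X0 [x' EX0]] := EX.
have hX0 : all nonaff X0 by move: hX; rewrite EX0 all_rcons => /andP[].
have gX0 : head_nonaff X0 by case: (X0) hX0 => //= a l /andP[].
case: Y hY h => [|y Y] hY h.
  exfalso; apply: (@good_word_neq_id (elemM (elemV e) d) X0 x'); first exact: all_nonaff_good.
  by move=> w; rewrite -EX0 appM h tv_nil appVK.
have dd : isdiag d.
  apply/negPn/negP => nd; move: (hY) (h).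
  have [Y0 [y' ->]] : exists Y0 y', y :: Y = rcons Y0 y'.
    by exists (belast y Y), (last y Y); exact: lastI.
  rewrite all_rcons EX0 => /andP[_ hY0] h'.
  apply: (@good_word_neq_id (elemV y') (rev (map elemV Y0) ++ d :: X0) (elemM x' (elemV e))).
    by rewrite good_word_cat ?all_nonaff_rev_inv //= nd gX0 orbT all_nonaff_good.
  move=> w; have := vtK Y0 y' (app e (app (elemV e) w)); rewrite -h' appKV => {2}<-.
  rewrite /vt; congr (app _ _).
  by rewrite rcons_cat tv_cat rcons_cons tv_cons !tv_rcons appM.
pose d1 := elemM (elemV y) (elemM (diag_swap d) x).
have h1 w : app d1 (tv X w) = tv Y (app e w).
  have := congr1 tsw (h w); rewrite !tv_cons tswK isdiag_tsw // => E.
  by rewrite appM E appVK.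
case/andP: hX => _ hX; case/andP: hY => _ hY.
have [sXY [ds [ds0 dsn dsd dsr]]] := IH Y d1 hX hY he h1.
split; first by rewrite /= sXY.
exists (fun i => if i is j.+1 then ds j else d); split=> //.
- by case=> // i; exact: dsd.
case=> [_|i hi] w /=; last exact: dsr.
by rewrite ds0 /d1 !appM appKV.
Qed.

Lemma conj_diag_size V W : all nonaff V -> all nonaff W -> conj_diag V W -> size V = size W.
Proof. by move=> hV hW [d [dd h]]; case: (tv_chain hV hW dd h). Qed.

Lemma all_rotE (a : pred elem) k s : all a (rot k s) = all a s.
Proof. by rewrite /rot all_cat andbC -all_cat cat_take_drop. Qed.

(** The rotated words are intertwined by y^-1 (t d t) x; that this map is again diagonal follows
    from [tv_chain]. *)
Lemma conj_diag_rot1 V W : all nonaff V -> all nonaff W ->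
  conj_diag V W -> conj_diag (rot 1 V) (rot 1 W).
Proof.
move=> hV hW cVW; have sVW := conj_diag_size hV hW cVW.
case: V hV cVW sVW => [|x X] hX; first by case: W hW.
case: W hW => [|y Y] hY // [d [dd h]] _; rewrite !rot1_cons.
pose d1 := elemM (elemV y) (elemM (diag_swap d) x).
have h1 w : app d1 (tv X w) = tv Y (app d w).
  have := congr1 tsw (h w); rewrite !tv_cons tswK isdiag_tsw // => E.
  by rewrite appM E appVK.
exists d1; split; last first.
  move=> w; rewrite !tv_rcons h1 -[app d _]tswK isdiag_tsw //.
  by rewrite /d1 [in RHS]appM appKV.
case/andP: hX => _ hX; case/andP: hY => _ hY.
by have [_ [ds [<- _ dsd _]]] := tv_chain hX hY dd h1; exact: dsd.
Qed.

Lemma conj_diag_rot k V W : all nonaff V -> all nonaff W ->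
  conj_diag V W -> conj_diag (rot k V) (rot k W).
Proof.
move=> hV hW cVW; have sVW := conj_diag_size hV hW cVW.
elim: k => [|k IH]; first by rewrite !rot0.
have [hk|hk] := ltnP k (size V); last first.
  by rewrite !rot_oversize // ?(leq_trans hk) // -?sVW ?(leq_trans hk).
have rS (s : seq elem) : (k < size s)%N -> rot k.+1 s = rot 1 (rot k s).
  by move=> hs; rewrite rotS.
by rewrite !rS -?sVW //; apply: conj_diag_rot1 => //; rewrite all_rotE.
Qed.

(** Both words are rotated further until the second one is back in place. *)
Lemma rot_conj_snd V W : all nonaff V -> all nonaff W -> rot_conj V W ->
  exists i, conj_diag (rot i V) W.
Proof.
move=> hV hW [i [j h]].
have [k Ek] := rot_rot_ex (size (rot j W) - j) i V; exists k.
rewrite -Ek -{2}(rotK j W); apply: conj_diag_rot h; by rewrite all_rotE.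
Qed.

(** * Finiteness of normalized words *)

Definition finitely_many (T : eqType) (P : T -> Prop) := exists s : seq T, forall x, P x -> x \in s.

Lemma fm_sub (T : eqType) (P Q : T -> Prop) : (forall x, P x -> Q x) ->
  finitely_many Q -> finitely_many P.
Proof. by move=> h [s hs]; exists s => x /h /hs. Qed.

Lemma fm_image (T U : eqType) (f : T -> U) (P : T -> Prop) : finitely_many P ->
  finitely_many (fun y => exists2 x, P x & y = f x).
Proof. by move=> [s hs]; exists (map f s) => y [x /hs hx ->]; exact: map_f. Qed.

Lemma fm_pair (T U : eqType) (P : T -> Prop) (Q : U -> Prop) :
  finitely_many P -> finitely_many Q ->
  finitely_many (fun z : T * U => P z.1 /\ Q z.2).
Proof.
move=> [s hs] [t ht]; exists [seq (x, y) | x <- s, y <- t] => -[x y] /= [/hs hx /ht hy].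
by apply/allpairsP; exists (x, y).
Qed.

Lemma fm_bigU (T U : eqType) (P : T -> Prop) (R : T -> U -> Prop) :
  finitely_many P -> (forall t, finitely_many (R t)) ->
  finitely_many (fun x => exists2 t, P t & R t x).
Proof.
move=> [s hs] hR; suff [r hr] : exists r : seq U, forall t x, t \in s -> R t x -> x \in r.
  by exists r => x [t /hs ts]; exact: hr.
elim: s {hs P} => [|t s [r hr]]; first by exists [::].
have [r' hr'] := hR t; exists (r' ++ r) => t' x; rewrite inE mem_cat => /orP[/eqP->|/hr h].
  by move/hr' => ->.
by move/h => ->; rewrite orbT.
Qed.

Lemma fm_seq (T : eqType) (P : T -> Prop) n : finitely_many P ->
  finitely_many (fun s : seq T => size s = n /\ forall x, x \in s -> P x).
Proof.
move=> hP; elim: n => [|n IH].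
  by exists [:: [::]] => s [/size0nil -> _]; rewrite inE.
apply: fm_sub (fm_image (fun z : T * seq T => z.1 :: z.2) (fm_pair hP IH)).
move=> [|x s] [] // [ss] h; exists (x, s) => //=; split; first by apply: h; rewrite mem_head.
by split=> // y ys; apply: h; rewrite inE ys orbT.
Qed.

Lemma fm_roots (p : {poly C}) : p != 0 -> finitely_many (fun x => root p x).
Proof.
move=> p0; have [s hs] := closed_field_poly_normal (p : {poly complex Rdefinitions.R}).
exists s => x; rewrite [p in root p]hs rootZ ?lead_coef_eq0 //.
by rewrite root_prod_XsubC.
Qed.

Fixpoint iter_coef n (nu : 'I_n -> 'I_n) (K : 'I_n -> C) (l : 'I_n -> nat) k j : C * nat :=
  if k is k'.+1 then (K (iter k' nu j) * (iter_coef nu K l k' j).1 ^+ l (iter k' nu j),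
                      ((iter_coef nu K l k' j).2 * l (iter k' nu j))%N)
  else (1, 1%N).

Lemma iter_coefE n (nu : 'I_n -> 'I_n) K l (c : 'I_n -> C) : (forall j, c (nu j) = K j * c j ^+ l j) ->
  forall k j, c (iter k nu j) = (iter_coef nu K l k j).1 * c j ^+ (iter_coef nu K l k j).2.
Proof.
move=> h; elim=> [|k IH] j /=; first by rewrite mul1r.
by rewrite h IH exprMn -exprM mulrA.
Qed.

Lemma iter_coef_lt n (nu : 'I_n -> 'I_n) K l k m j : (forall i, (1 < l i)%N) -> (k < m)%N -> ((iter_coef nu K l k j).2 < (iter_coef nu K l m j).2)%N.
Proof.
move=> l_ge2; have pos i : (0 < (iter_coef nu K l i j).2)%N.
  by elim: i => //= i IH; rewrite muln_gt0 IH ltnW.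
elim: m => // m IH; rewrite ltnS leq_eqVlt => /orP[/eqP<-|/IH h] /=.
  by rewrite -{1}[(iter_coef nu K l k j).2]muln1 ltn_pmul2l.
by apply: leq_trans h _; rewrite leq_pmulr // ltnW.
Qed.

(* every orbit of nu is eventually periodic, which gives c j^L' = const c j^L with L' > L *)
Lemma fm_power_system n (nu : 'I_n -> 'I_n) K l : (forall i, (1 < l i)%N) -> finitely_many (fun x : C => exists c j,
  (forall j, c j != 0) /\ (forall j, c (nu j) = K j * c j ^+ l j) /\ x = c j).
Proof.
move=> l_ge2; suff H j : finitely_many (fun x : C => exists c,
    (forall j, c j != 0) /\ (forall j, c (nu j) = K j * c j ^+ l j) /\ x = c j).
  have [s hs] : finitely_many (fun x : C => exists2 j : 'I_n, True & exists c,
      (forall j, c j != 0) /\ (forall j, c (nu j) = K j * c j ^+ l j) /\ x = c j).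
    by apply: fm_bigU => //; exists (enum 'I_n) => i _; rewrite mem_enum.
  by exists s => x [c [i h]]; apply: hs; exists i => //; exists c.
have /trajectP[k kn Ek] := looping_order nu j; set m := order nu j in kn Ek.
have hL := @iter_coef_lt _ nu K l _ _ j l_ge2 kn.
pose p : {poly C} := (iter_coef nu K l m j).1 *: 'X^((iter_coef nu K l m j).2)
                     - (iter_coef nu K l k j).1 *: 'X^((iter_coef nu K l k j).2).
have root_p c : (forall j, c (nu j) = K j * c j ^+ l j) -> root p (c j).
  move=> h; rewrite rootE hornerD hornerN !hornerZ !hornerXn -!iter_coefE //.
  by rewrite Ek subrr.
have [p0|p0] := eqVneq p 0; last first.
  by apply: fm_sub (fm_roots p0) => x [c [_ [h ->]]]; exact: root_p.
(* If [p] is zero, both coefficients vanish because the exponents differ, and the orbit of j reaches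
   an index where [c] is zero. *)
exists [::] => x [c [c0 [h _]]]; exfalso.
have := congr1 (fun q : {poly C} => q`_((iter_coef nu K l k j).2)) p0.
rewrite coef0 coefB !coefZ !coefXn eqxx (ltn_eqF hL) mulr0 mulr1 sub0r => /eqP.
rewrite oppr_eq0 => /eqP E; have := c0 (iter k nu j).
by rewrite (iter_coefE h) E mul0r eqxx.
Qed.

Lemma coef_lin_exp (c e : C) k : c != 0 ->
  ((c *: 'X + e%:P) ^+ k.+1)`_k.+1 = c ^+ k.+1 /\
  ((c *: 'X + e%:P) ^+ k.+1)`_k = k.+1%:R * c ^+ k * e.
Proof.
move=> c0; have sz : (size (c *: 'X + e%:P)%R <= 2)%N by rewrite size_lin.
have top k' : ((c *: 'X + e%:P) ^+ k')`_k' = c ^+ k'.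
  have [_] := coef_exp_top k' sz; rewrite muln1 => ->.
  by rewrite coefD coefZ coefX coefC /= mulr1 addr0.
split; first exact: top.
elim: k => [|k IH]; first by rewrite expr1 coefD coefZ coefX coefC /= mulr0 add0r expr0; ring.
rewrite exprS mulrDl coefD -scalerAl coefZ coefXM /= IH coefCM top.
by rewrite -[k.+2]addn1 natrD exprS; ring.
Qed.

Lemma coef_comp_lin (p : {poly C}) (c e : C) k : c != 0 -> size p = k.+2 ->
  (p \Po (c *: 'X + e%:P))`_k.+1 = p`_k.+1 * c ^+ k.+1 /\
  (p \Po (c *: 'X + e%:P))`_k = p`_k * c ^+ k + p`_k.+1 * (k.+1%:R * c ^+ k * e).
Proof.
move=> c0 sp; have sz : (size (c *: 'X + e%:P)%R <= 2)%N by rewrite size_lin.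
have low i n : (i < n)%N -> ((c *: 'X + e%:P) ^+ i)`_n = 0.
  move=> h; have [s1 _] := coef_exp_top i sz; rewrite muln1 in s1.
  by rewrite nth_default // (leq_trans s1).
have [t1 t2] := coef_lin_exp e k c0.
have t3 : ((c *: 'X + e%:P) ^+ k)`_k = c ^+ k.
  by case: k {sp t1 t2} => [|k]; [rewrite !expr0 coef1|have [] := coef_lin_exp e k c0].
rewrite !coef_comp_poly sp !big_ord_recr /= t1 t2 t3 low //.
rewrite !big1 ?add0r ?mulr0 ?add0r // => i _; rewrite low ?mulr0 //.
exact: ltn_trans (ltn_ord i) _.
Qed.

(* The normalization shared by the letters e_i, e_i^-1 of normal Henon maps and by
   the elementary involutions in normal form. *)
Definition normal_letter (y : elem) : Prop :=
  [/\ nonaff y, ebe y = 1 \/ ebe y = -1, eeta y = 0, (epol y)`_(size (epol y) - 2) = 0 &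
    lead_coef (epol y) = 1 \/ lead_coef (epol y) = eal y \/ lead_coef (epol y) = - eal y].

(** The data of a letter in an [eqType], as membership in a finite list requires. *)
Definition edata (e : elem) : C * C * C * {poly C} := (eal e, ebe e, eeta e, epol e).

Definition bsign (b : bool) : C := if b then 1 else -1.

(** Comparison of coefficients in (t d t) x = y d'. The vanishing subleading coefficient of [y]
    determines the translation of [d'] from its scale, so that only scales remain as unknowns. *)
Lemma step_relations d d' x y : isdiag d -> isdiag d' -> nonaff x -> normal_letter y ->
  (forall w, app (diag_swap d) (app x w) = app y (app d' w)) ->
  let l := (size (epol x)).-1 in
  [/\ ebe d * eal x = eal y * eal d', eal d * ebe x = ebe y * ebe d',
      eal d * eeta x + (epol d)`_0 = ebe y * eeta d',
      ebe d * lead_coef (epol x) = lead_coef (epol y) * ebe d' ^+ l &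
      eeta d' = (epol x)`_l.-1 / (l%:R * lead_coef (epol x)) * ebe d' /\
      epol y = (ebe d *: epol x + (eeta d - eal y * (epol d')`_0)%:P)
                 \Po ((ebe d')^-1 *: 'X + (- (eeta d' / ebe d'))%:P)].
Proof.
move=> hd hd' nx [ny hbe heta hsub _] h l.
have [E1 E2 E3 E4] : [/\ ebe d * eal x = eal y * eal d', eal d * ebe x = ebe y * ebe d',
    eal d * eeta x + (epol d)`_0 = ebe y * eeta d' + eeta y &
    ebe d *: epol x + (eeta d)%:P = eal y *: epol d' + (epol y \Po (ebe d' *: 'X + (eeta d')%:P))].
  have := @app_inj (elemM (diag_swap d) x) (elemM y d').
  case=> [w|e1 e2 e3 e4]; first by rewrite !appM.
  by split=> //; move: e4; rewrite /= comp_polyC.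
rewrite heta addr0 in E3.
have dE : epol d' = ((epol d')`_0)%:P := size1_polyC hd'.
have c0 := ebe_neq0 d'.
have Ep : epol y \Po (ebe d' *: 'X + (eeta d')%:P) =
    ebe d *: epol x + (eeta d - eal y * (epol d')`_0)%:P.
  rewrite polyCB polyCM addrA E4 {1}dE -[_ *: _%:P]mul_polyC.
  by rewrite [X in X - _]addrC addrK.
have sy : size (epol y) = size (epol x).
  rewrite -(size_comp_poly2 (epol y) (size_lin (eeta d') c0)) Ep size_polyDl size_scale ?ebe_neq0 //.
  by rewrite (leq_ltn_trans (size_polyC_leq1 _)) // ltnW.
have [k sx] : exists k, size (epol x) = k.+3.
  by exists (size (epol x) - 3)%N; rewrite -addn3 subnK.
have hl : l = k.+2 by rewrite /l sx.
have [t1 t2] := coef_comp_lin (eeta d') c0 (etrans sy sx).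
rewrite Ep !coefD !coefZ !coefC /= addr0 in t1 t2.
rewrite sy sx subn2 /= in hsub.
have lx : lead_coef (epol x) = (epol x)`_k.+2 by rewrite lead_coefE sx.
have ly : lead_coef (epol y) = (epol y)`_k.+2 by rewrite lead_coefE sy sx.
have lx0 : (epol x)`_k.+2 != 0 by rewrite -lx lead_coef_eq0 -size_poly_gt0 sx.
split=> //; first by rewrite hl lx ly.
split.
  rewrite hl lx; rewrite hsub mul0r add0r addr0 in t2.
  have d0 := ebe_neq0 d; have k0 : (k.+2%:R : C) != 0 by rewrite pnatr_eq0.
  have : (epol x)`_k.+1 = (ebe d)^-1 * ((epol y)`_k.+2 * (k.+2%:R * ebe d' ^+ k.+1 * eeta d')).
    by rewrite -t2 mulKf.
  move=> ->; have -> : (epol x)`_k.+2 = (ebe d)^-1 * ((epol y)`_k.+2 * ebe d' ^+ k.+2).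
    by rewrite -t1 mulKf.
  have y0 : (epol y)`_k.+2 != 0.
    by apply: contra lx0 => /eqP E; rewrite -(mulKf d0 (epol x)`_k.+2) t1 E mul0r mulr0.
  have := expf_neq0 k.+1 c0; rewrite (exprS _ k.+1).
  move: ((ebe d' ^+ k.+1)) => z z0; rewrite /=; move: (k.+2%:R) k0 => r k0.
  by field; rewrite d0 k0 y0 c0 z0.
rewrite -Ep -comp_polyA comp_polyD comp_polyZ comp_polyX comp_polyC.
rewrite scalerDr scalerA mulfV // scale1r -mul_polyC -polyCM -addrA -polyCD.
have -> : ebe d' * - (eeta d' / ebe d') + eeta d' = 0 by field.
by rewrite polyC0 addr0 comp_polyXr.
Qed.

(* By [step_relations] the letters of W are functions of the numbers [ebe (ds i)], which
   solve one of finitely many power systems. *)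
Lemma fm_normal_words X : all nonaff X -> (0 < size X)%N ->
  finitely_many (fun D => exists W, [/\ all nonaff W,
    forall i, (i < size W)%N -> normal_letter (nth elem1 W i), conj_diag X W & D = map edata W]).
Proof.
move=> hX; case En : (size X) => [|n'] // _; set n := n'.+1 in En.
pose x (i : 'I_n) := nth elem1 X i.
have nx i : nonaff (x i) by move/(all_nthP elem1): (hX) => h; apply: h; rewrite En.
(* The scale at position j is raised to the degree of the letter preceding j, hence the shift by
   [ord_pred]. *)
pose l (j : 'I_n) := (size (epol (x (ord_pred j)))).-1.
have l2 j : (1 < l j)%N by have := nx (ord_pred j); rewrite /nonaff /l; case: (size _).
pose kap (j : 'I_n) := (epol (x (ord_pred j)))`_(l j).-1 / ((l j)%:R * lead_coef (epol (x (ord_pred j)))).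
(* If the new letter before j is monic, the leading coefficients express the scale at the
   predecessor of j through the scale at j. If its leading coefficient is plus or minus its [eal],
   the predecessor cancels out and the scale at the successor is expressed instead. [t] records the
   signs and which case occurs. *)
pose nu (t : {ffun 'I_n -> bool * option bool}) j := if (t j).2 is Some _ then ordS j else ord_pred j.
pose K (t : {ffun 'I_n -> bool * option bool}) j : C :=
  if (t j).2 is Some b then bsign (t j).1 * ebe (x j) * (bsign b * eal (x (ord_pred j)) / lead_coef (epol (x (ord_pred j))))
  else (lead_coef (epol (x (ord_pred j))))^-1.
have fmS : finitely_many (fun z : C => exists2 t, True & exists c j,
  (forall j, c j != 0) /\ (forall j, c (nu t j) = K t j * c j ^+ l j) /\ z = c j).
  apply: fm_bigU => [|t]; first by exists (enum {ffun 'I_n -> bool * option bool}) => t _; rewrite mem_enum.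
  exact: fm_power_system.
case: fmS => S hS.
(* Recovers the diagonal map at j from the scales at j and at its successor and the sign of [ebe] of
   the new letter. *)
pose G (j : 'I_n) (z : C * C * bool) : C * C * C * C :=
  let a := bsign z.2 * z.1.2 / ebe (x j) in
  (a, bsign z.2 * (kap (ordS j) * z.1.2) - a * eeta (x j), z.1.1, kap j * z.1.1).
have fmQ : finitely_many (fun q => exists2 j : 'I_n, True &
    exists2 z : C * C * bool, (z.1.1 \in S /\ z.1.2 \in S) /\ True & q = G j z).
  apply: fm_bigU => [|j]; first by exists (enum 'I_n) => j _; rewrite mem_enum.
  apply: fm_image; apply: (@fm_pair _ _ (fun z : C * C => z.1 \in S /\ z.2 \in S) (fun=> True)).
    by apply: (@fm_pair _ _ (fun z => z \in S) (fun z => z \in S)); exists S.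
  by exists [:: true; false] => -[].
case: fmQ => Q hQ.
(* Recovers the new letter from the two diagonal maps around it. *)
pose F (i : 'I_n) (z : (C * C * C * C) * (C * C * C * C)) : C * C * C * {poly C} :=
  let al := z.1.1.2 * eal (x i) / z.2.1.1.1 in
  (al, z.1.1.1.1 * ebe (x i) / z.2.1.2, 0,
   (z.1.1.2 *: epol (x i) + (z.1.2 - al * z.2.1.1.2)%:P) \Po
       ((z.2.1.2)^-1 *: 'X + (- (z.2.2 / z.2.1.2))%:P)).
have fmF : finitely_many (fun y => exists2 i : 'I_n, True &
    exists2 z, z.1 \in Q /\ z.2 \in Q & y = F i z).
  apply: fm_bigU => [|j]; first by exists (enum 'I_n) => j _; rewrite mem_enum.
  by apply: fm_image; apply: (@fm_pair _ _ (fun z => z \in Q) (fun z => z \in Q)); exists Q.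
apply: fm_sub (fm_seq n fmF) => D [W [hW nW [d [dd hd]] ->]].
have [sXW [ds [ds0 dsn dsd dsr]]] := tv_chain hX hW dd hd.
rewrite size_map -sXW; split=> // u /(nthP (edata elem1))[k].
rewrite size_map -sXW En => kn <-; rewrite (nth_map elem1) -?sXW ?En //.
pose y (i : 'I_n) := nth elem1 W i.
have nyi i : normal_letter (y i) by apply: nW; rewrite -sXW En.
(* The chain closes up: its last diagonal map equals the first, so indices may be read
   cyclically. *)
have nxt (i : 'I_n) : [/\ eal (ds i.+1) = eal (ds (ordS i)), ebe (ds i.+1) = ebe (ds (ordS i)),
   eeta (ds i.+1) = eeta (ds (ordS i)) & epol (ds i.+1) = epol (ds (ordS i))].
  have [h|h] := ltnP i.+1 n; first by rewrite /= modn_small.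
  have Ei : i.+1 = n by apply/eqP; rewrite eqn_leq ltn_ord.
  by rewrite /= Ei modnn ds0; apply: app_inj => w; rewrite -En.
pose c (i : 'I_n) := ebe (ds i); pose a (i : 'I_n) := eal (ds i).
pose e (i : 'I_n) := eeta (ds i); pose b (i : 'I_n) := (epol (ds i))`_0.
have c0 i : c i != 0 by exact: ebe_neq0.
have a0 i : a i != 0 by exact: eal_neq0.
have rel i : let lx := lead_coef (epol (x i)) in
  [/\ c i * eal (x i) = eal (y i) * a (ordS i), a i * ebe (x i) = ebe (y i) * c (ordS i),
      a i * eeta (x i) + b i = ebe (y i) * e (ordS i),
      c i * lx = lead_coef (epol (y i)) * c (ordS i) ^+ l (ordS i) &
      e (ordS i) = kap (ordS i) * c (ordS i) /\
      epol (y i) = (c i *: epol (x i) + (e i - eal (y i) * b (ordS i))%:P)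
                 \Po ((c (ordS i))^-1 *: 'X + (- (e (ordS i) / c (ordS i)))%:P)].
  have iX : (i < size X)%N by rewrite En.
  have := step_relations (dsd i (ltnW iX)) (dsd i.+1 iX) (nx i) (nyi i) (dsr i iX).
  by rewrite /kap /l ordSK /c /a /e /b; have [-> -> -> ->] := nxt i.
have sgn i : ebe (y i) = bsign (ebe (y i) == 1).
  have [_ [->|->] _ _ _] := nyi i; rewrite /bsign ?eqxx //.
  by rewrite eq_sym -subr_eq0 opprK -mulr2n pnatr_eq0.
have lx0 i : lead_coef (epol (x i)) != 0.
  by rewrite lead_coef_eq0 -size_poly_gt0 (leq_trans _ (nx i)).
pose t := [ffun j : 'I_n => (ebe (y j) == 1,
   if lead_coef (epol (y (ord_pred j))) == 1 then None
   else Some (lead_coef (epol (y (ord_pred j))) == eal (y (ord_pred j))))].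
have cS j : c j \in S.
  apply: hS; exists t => //; exists c, j; split=> //; split=> // {}j.
  have [E1 _ _ E4 _] := rel (ord_pred j); rewrite !ord_predK in E1 E4.
  rewrite /nu /K /t !ffunE /= -sgn.
  have [ly|ly1] := eqVneq (lead_coef (epol (y (ord_pred j)))) 1.
    by rewrite ly mul1r in E4; rewrite -E4 mulrC mulfK.
  have ly : lead_coef (epol (y (ord_pred j))) =
      bsign (lead_coef (epol (y (ord_pred j))) == eal (y (ord_pred j))) * eal (y (ord_pred j)).
    have [_ _ _ _ []] := nyi (ord_pred j); first by move=> h; rewrite h eqxx in ly1.
    case=> ->; rewrite /bsign ?eqxx ?mul1r //.
    by rewrite eq_sym -subr_eq0 opprK -mulr2n mulrn_eq0 /= (negPf (eal_neq0 _)) mulN1r.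
  move: ly E4; set sg := bsign _ => ly; rewrite ly => E4.
  have [_ E2 _ _ _] := rel j.
  have be2 : ebe (y j) * ebe (y j) = 1.
    by have [_ [->|->] _ _ _] := nyi j; rewrite ?mulr1 // mulrNN mulr1.
  have -> : c (ordS j) = ebe (y j) * (a j * ebe (x j)) by rewrite E2 mulrA be2 mul1r.
  have aj : a j = sg * eal (x (ord_pred j)) / lead_coef (epol (x (ord_pred j))) * c j ^+ l j.
    have al : eal (y (ord_pred j)) = c (ord_pred j) * eal (x (ord_pred j)) / a j.
      by rewrite E1 mulfK.
    move: E4; rewrite al; move: (c0 (ord_pred j)) (a0 j) (lx0 (ord_pred j)).
    move: (c _) (a j) (lead_coef _) (eal _) (c j ^+ _) => z1 z2 z3 z4 z5 h1 h2 h3 E4.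
    apply: (mulfI h1); apply: (mulfI h3).
    have : z3 * (z1 * z2) = z2 * (z1 * z3) by ring.
    by move=> ->; rewrite E4; field; rewrite h3 h2.
  by rewrite aj; ring.
have cQ j : (a j, b j, c j, e j) \in Q.
  apply: hQ; exists j => //; exists (c j, c (ordS j), ebe (y j) == 1) => //=.
  rewrite /G /= -sgn; have [_ E2 E3 _ [E5 _]] := rel j.
  have -> : e j = kap j * c j by have [_ _ _ _ [h _]] := rel (ord_pred j); rewrite !ord_predK in h.
  have Ea : a j = ebe (y j) * c (ordS j) / ebe (x j) by rewrite -E2 mulfK // ebe_neq0.
  by rewrite -Ea -E5 -E3 [a j * _ + b j]addrC addrK.
exists (Ordinal kn) => //.
exists ((a (Ordinal kn), b (Ordinal kn), c (Ordinal kn), e (Ordinal kn)),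
        (a (ordS (Ordinal kn)), b (ordS (Ordinal kn)), c (ordS (Ordinal kn)), e (ordS (Ordinal kn)))).
  by rewrite !cQ.
have [E1 E2 E3 E4 [E5 E6]] := rel (Ordinal kn).
rewrite /F /edata -/(y (Ordinal kn)) E1 E2 !mulfK // E6.
by have [_ _ -> _ _] := nyi (Ordinal kn).
Qed.
(** * Reduced words and conjugacy *)

Lemma ev2_comp_ex P Q R : exists S : {poly {poly C}}, forall z, ev2 S z = ev2 P (ev2 Q z, ev2 R z).
Proof.
exists (\sum_(j < size P) \sum_(i < sizeY P) (P`_j`_i)%:P%:P * Q ^+ i * R ^+ j) => z.
rewrite [RHS]ev2E /ev2 !horner_sum; apply: eq_bigr => j _; rewrite !horner_sum.
by apply: eq_bigr => i _; rewrite !hornerM !horner_exp !hornerC.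
Qed.

Lemma polymap_comp f g : polymap f -> polymap g -> polymap (f \o g).
Proof.
move=> [P [Q h]] [P' [Q' h']].
have [S hS] := ev2_comp_ex P P' Q'; have [T hT] := ev2_comp_ex Q P' Q'.
by exists S, T => z; rewrite /= h h' hS hT.
Qed.

Lemma isG_comp f g : isG f -> isG g -> isG (f \o g).
Proof.
move=> [pf [f' [pf' [h1 h2]]]] [pg [g' [pg' [h3 h4]]]]; split; first exact: polymap_comp.
exists (g' \o f'); split; first exact: polymap_comp.
split=> z /=; first by rewrite [f' _](h1 (g z)) [g' _]h3.
by rewrite [g _](h4 (f' z)) [f _]h2.
Qed.

Lemma polymap_app e : polymap (app e).
Proof.
exists ((eal e *: 'X)%:P + map_poly polyC (epol e)), ((ebe e)%:P *: 'X + (eeta e)%:P%:P) => -[x y].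
rewrite /ev2 /app /= !(hornerD, hornerZ, hornerX, hornerC, horner_map, hornerM) /=.
by [].
Qed.

Lemma isG_app e : isG (app e).
Proof.
split; first exact: polymap_app.
exists (app (elemV e)); split; first exact: polymap_app.
by split=> z /=; [exact: appVK|exact: appKV].
Qed.

Lemma isG_tsw : isG tsw.
Proof.
have p : polymap tsw.
  by exists 'X, 'X%:P => -[x y]; rewrite /ev2 /tsw /= hornerX hornerC hornerC hornerX.
by split=> //; exists tsw; split=> //; split=> z /=; rewrite tswK.
Qed.

Lemma eq_isG f g : f =1 g -> isG f -> isG g.
Proof.
move=> e [[P [Q h]] [f' [pf' [h1 h2]]]]; split; first by exists P, Q => z; rewrite -e.
by exists f'; split=> //; split=> z /=; rewrite -e; [exact: h1|exact: h2].
Qed.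

Lemma isG_tv l : isG (tv l).
Proof.
elim: l => [|x l IH].
  by apply: (@eq_isG (app elem1)) (isG_app _) => z; rewrite app1.
exact: isG_comp isG_tsw (isG_comp (isG_app x) IH).
Qed.

Lemma isG_inv f : isG f -> exists g, [/\ isG g, cancel f g & cancel g f].
Proof.
move=> [pf [g [pg [h1 h2]]]]; exists g; split=> //.
by split=> //; exists f; split.
Qed.

(* conjugating by u, with f' = u f u^-1 written without the inverse *)
Lemma conjG_trans g f f' u : conjG g f -> isG u -> (forall z, f' (u z) = u (f z)) -> conjG g f'.
Proof.
move=> [phi [psi [Gphi [h1 [h2 h3]]]]] Gu h; have [v [Gv uK vK]] := isG_inv Gu.
exists (phi \o v), (u \o psi); split; first exact: isG_comp.
split; first by move=> z /=; rewrite [psi _]h1 vK.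
split; first by move=> z /=; rewrite uK [phi _]h2.
by move=> z; rewrite h3 /= h uK.
Qed.

Lemma conjG_conj g f f' : conjG g f -> conjG g f' ->
  exists phi, isG phi /\ forall z, phi (f z) = f' (phi z).
Proof.
move=> [phi [psi [Gphi [h1 [h2 h3]]]]] [phi' [psi' [Gphi' [h1' [h2' h3']]]]].
have [v [Gv uK vK]] := isG_inv Gphi'.
have E z : psi' z = v z by rewrite -{1}(vK z) [psi' _]h1'.
exists (v \o phi); split; first exact: isG_comp.
move=> z /=; have := h3 (phi z); rewrite h3' /= [psi _]h1 => <-.
by rewrite uK E.
Qed.

Lemma isG_normal_form f : isG f -> normal_form f.
Proof.
move=> [[A [B h]] [f' [[P [Q h']] [h1 h2]]]].
have iP : inverse_pair P Q A B.
  split=> z.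
  - by have := congr1 fst (h2 z); rewrite /= h' h.
  - by have := congr1 snd (h2 z); rewrite /= h' h.
  - by have := congr1 fst (h1 z); rewrite /= h' h.
  - by have := congr1 snd (h1 z); rewrite /= h' h.
exact: eq_normal_form (fun z => esym (h z)) (jung iP).
Qed.

(** Jung's theorem enters here: it supplies a word for the conjugating map, whose letters can then
    be cancelled. *)
Lemma isG_rot_conj phi W W' : isG phi -> all nonaff W -> all nonaff W' ->
  (0 < size W)%N -> (0 < size W')%N -> (forall z, phi (tv W z) = tv W' (phi z)) ->
  exists i, conj_diag (rot i W) W'.
Proof.
move=> /isG_normal_form Nphi hW hW' sW sW' h; apply: rot_conj_snd => //.
case: Nphi => [[c e]|[c [Z [z [hZ e]]]]].
  by apply: (@rot_conj_elem c) => //; exact: eq_intertwines e h.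
by apply: (@rot_conj_word (size Z).+1 Z c z) => //; exact: eq_intertwines e h.
Qed.

Lemma isElem_ex f : isElem f -> exists e, f =1 app e.
Proof.
move=> [al [be [eta [p [al0 [be0 h]]]]]].
have pf : (al != 0) && (be != 0) by rewrite al0 be0.
by exists (@Elem al be eta p pf) => -[x y]; rewrite h.
Qed.

Lemma isElem_app e : isElem (app e).
Proof. by exists (eal e), (ebe e), (eeta e), (epol e); rewrite eal_neq0 ebe_neq0. Qed.

Lemma eq_isElem f g : f =1 g -> isElem f -> isElem g.
Proof.
by move=> e [al [be [eta [p [al0 [be0 h]]]]]]; exists al, be, eta, p; do 2!split=> //; move=> x y; rewrite -e.
Qed.

Lemma eq_isAff f g : f =1 g -> isAff f -> isAff g.
Proof.
by move=> e [a [b [c [d [u [v [D h]]]]]]]; exists a, b, c, d, u, v; split=> // x y; rewrite -e.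
Qed.

Lemma isAff_app e : isAff (app e) <-> ~~ nonaff e.
Proof.
split=> [[a [b [c [d [u [v [D h]]]]]]]|].
  have : epol e = b *: 'X + u%:P.
    apply: polyC_inj_fun => y; rewrite hornerD hornerZ hornerX hornerC.
    by have := congr1 fst (h 0 y); rewrite /= !mulr0 !add0r.
  rewrite /nonaff -leqNgt => ->; rewrite (leq_trans (size_polyD _ _)) // geq_max.
  rewrite (leq_trans (size_scale_leq _ _)) ?size_polyX //=.
  by rewrite (leq_trans (size_polyC_leq1 _)).
rewrite /nonaff -leqNgt => s2.
exists (eal e), (epol e)`_1, 0, (ebe e), (epol e)`_0, (eeta e).
rewrite mulr0 subr0 mulf_neq0 ?eal_neq0 ?ebe_neq0 //; split=> // x y.
rewrite /app /= (horner_coef_wide _ s2) !big_ord_recl big_ord0 /= expr0 expr1.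
by congr pair; ring.
Qed.

Definition aff_only (f : map2) := isAff f /\ ~ isElem f.
Definition elem_only (f : map2) := isElem f /\ ~ isAff f.

Lemma elem_only_ex f : elem_only f -> exists2 e, nonaff e & f =1 app e.
Proof.
move=> [/isElem_ex[e he] na]; exists e => //; apply/negPn/negP => /isAff_app h.
by apply: na; apply: eq_isAff h => z; rewrite he.
Qed.

Lemma aff_only_ex f : aff_only f ->
  exists s s', [/\ ~~ nonaff s, ~~ nonaff s' & forall z, f z = app s (tsw (app s' z))].
Proof.
move=> [[a [b [c [d [u [v [D h]]]]]]] ne].
have c0 : c != 0.
  apply/negP => /eqP c0; apply: ne; exists a, d, v, (b *: 'X + u%:P).
  move: D; rewrite c0 mulr0 subr0 mulf_eq0 negb_or => /andP[-> ->]; do 2!split=> //.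
  move=> x y; rewrite h c0 hornerD hornerZ hornerX hornerC; congr pair; ring.
have [s1 [s2 [h1 h2 h3]]] := aff_bruhat u v c0 D.
by exists s1, s2; split=> // -[x y]; rewrite h h3.
Qed.

Lemma elem_only_app e : nonaff e -> elem_only (app e).
Proof. by move=> h; split; [exact: isElem_app|move/isAff_app; rewrite h]. Qed.

Lemma aff_only_tsw : aff_only tsw.
Proof.
split.
  exists 0, 1, 1, 0, 0, 0; rewrite !mul0r sub0r mul1r oppr_eq0 oner_neq0; split=> // x y.
  by rewrite /tsw /=; congr pair; ring.
move=> [al [be [eta [p [al0 [be0 h]]]]]].
have := congr1 snd (h 1 0); have := congr1 snd (h 0 0); rewrite /= mulr0 add0r => <-.
by move=> /eqP; rewrite oner_eq0.
Qed.

Fixpoint alternating (b : bool) (w : seq map2) : Prop :=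
  if w is f :: w' then (if b then aff_only f else elem_only f) /\ alternating (~~ b) w' else True.

Lemma alternating_nth b w i : alternating b w -> (i < size w)%N ->
  if b (+) odd i then aff_only (nth id w i) else elem_only (nth id w i).
Proof.
elim: w b i => // f w IH b [|i] [hf hw] hi /=; first by rewrite addbF.
by rewrite addbN -addNb; apply: IH.
Qed.

(** Even length puts the two end letters in different subgroups. *)
Lemma alternating_cyc b w : alternating b w -> (1 < size w)%N -> ~~ odd (size w) -> cyc_reduced w.
Proof.
move=> hw sw ow; have s0 : (0 < size w)%N by exact: ltnW.
have nsame f g : aff_only f -> elem_only g -> ~ same_subgroup f g.
  by move=> [h1 h2] [h3 h4] [[]|[]].
have nsame' f g : aff_only f -> elem_only g -> ~ same_subgroup g f.
  by move=> [h1 h2] [h3 h4] [[]|[]].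
split; last split=> //.
  split=> //; split=> i hi.
    by have := alternating_nth hw hi; case: ifP => _ [h1 h2]; split; try (by left); try (by right); case.
  have := alternating_nth hw hi; have := alternating_nth hw (ltnW hi); rewrite /=.
  by rewrite addbN; case: (b (+) odd i) => /= h1 h2; [exact: nsame|exact: nsame'].
have := alternating_nth hw s0; rewrite nth0 addbF.
have hl : ((size w).-1 < size w)%N by rewrite prednK.
have := alternating_nth hw hl; rewrite nth_last.
have -> : odd (size w).-1 by move: ow; rewrite -[in odd _](prednK s0) /= negbK.
by rewrite addbT; case: b {hw} => /= h1 h2; [exact: nsame|exact: nsame'].
Qed.

(** Both interleavings occur: [N_ee] begins with t, whereas [N_aa] and [N_ea] end with it. *)
Lemma eq_compw_interleave W : 
  compw (flatten [seq [:: tsw; app x] | x <- W]) =1 tv W /\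
  compw (flatten [seq [:: app x; tsw] | x <- W]) =1 tsw \o (tv W \o tsw).
Proof.
split; elim: W => [|x W IH] z //=.
- by rewrite tv_cons -IH.
- by rewrite tv_nil tswK.
- by rewrite tv_cons tswK [compw _ z]IH /= tswK.
Qed.

Lemma alternating_interleave W : all nonaff W ->
  alternating true (flatten [seq [:: tsw; app x] | x <- W]) /\
  alternating false (flatten [seq [:: app x; tsw] | x <- W]).
Proof.
elim: W => //= x W IH /andP[/elem_only_app hx /IH[h1 h2]].
by have ht := aff_only_tsw.
Qed.

Lemma size_interleave (f g : elem -> map2) W :
  size (flatten [seq [:: f x; g x] | x <- W]) = (size W).*2.
Proof. by elim: W => //= x W ->. Qed.

Lemma cred_map_tv W : all nonaff W -> (0 < size W)%N ->
  cred_map (tv W) /\ cred_map (tsw \o (tv W \o tsw)).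
Proof.
move=> hW sW; have [h1 h2] := alternating_interleave hW.
have [e1 e2] := eq_compw_interleave W.
split; right; right.
  exists (flatten [seq [:: tsw; app x] | x <- W]); split=> [|z]; last by rewrite e1.
  apply: (alternating_cyc h1); rewrite (size_interleave (fun=> tsw)) ?odd_double //.
  by rewrite -addnn; move: sW; case: (size W) => // n _; rewrite addSn addnS.
exists (flatten [seq [:: app x; tsw] | x <- W]); split=> [|z]; last by rewrite e2.
apply: (alternating_cyc h2); rewrite (size_interleave _ (fun=> tsw)) ?odd_double //.
by rewrite -addnn; move: sW; case: (size W) => // n _; rewrite addSn addnS.
Qed.

Lemma eq_cred_map f g : f =1 g -> cred_map f -> cred_map g.
Proof.
move=> e [h|[h|[w [hw h]]]]; first by left; exact: eq_isAff h.
  by right; left; exact: eq_isElem h.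
by right; right; exists w; split=> // z; rewrite -e.
Qed.

(** * Normal words and finiteness of the normal forms *)

Fixpoint normal_word (W : seq elem) : Prop :=
  if W is x :: W' then normal_letter x /\ normal_word W' else True.

Lemma normal_word_cat V W : normal_word (V ++ W) <-> normal_word V /\ normal_word W.
Proof. by elim: V => [|x V IH] /=; [tauto|rewrite IH; tauto]. Qed.

Lemma normal_word_rcons W x : normal_word (rcons W x) <-> normal_word W /\ normal_letter x.
Proof. by rewrite -cats1 normal_word_cat /=; tauto. Qed.

Lemma normal_word_nth W i : normal_word W -> (i < size W)%N -> normal_letter (nth elem1 W i).
Proof. by elim: W i => // x W IH [|i] [h1 h2] //=; exact: IH. Qed.

Lemma normal_word_nonaff W : normal_word W -> all nonaff W.
Proof. by elim: W => //= x W IH [[-> _ _ _ _] /IH]. Qed.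

(** Any two solutions are conjugate to each other. With one of them fixed, every other is carried by
    a diagonal map to one of finitely many rotations of it, and [fm_normal_words] applies to each
    rotation; [dec] reads the parameters back from the letters. *)
Lemma fm_conj_normal g (T : eqType) (word : T -> seq elem) (P : T -> Prop)
    (dec : seq (C * C * C * {poly C}) -> T) :
  (forall x, P x -> [/\ normal_word (word x), (0 < size (word x))%N & dec (map edata (word x)) = x]) ->
  finitely_many (fun x => P x /\ conjG g (tv (word x))).
Proof.
move=> hP; case: (pselect (exists x, P x /\ conjG g (tv (word x)))) => [[x0 [Px0 gx0]]|h]; last first.
  by exists [::] => x hx; case: h; exists x.
have [n0 s0 _] := hP _ Px0; pose X := word x0.
have hX : all nonaff X by exact: normal_word_nonaff.
have fmW : finitely_many (fun D => exists2 i : nat, (i <= size X)%N & exists W, [/\ all nonaff W,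
    forall k, (k < size W)%N -> normal_letter (nth elem1 W k), conj_diag (rot i X) W & D = map edata W]).
  apply: fm_bigU => [|i]; first by exists (iota 0 (size X).+1) => i; rewrite mem_iota ltnS.
  by apply: fm_normal_words; rewrite ?all_rotE ?size_rot.
apply: fm_sub (fm_image dec fmW) => x [Px gx]; have [nx sx ex] := hP _ Px.
exists (map edata (word x)) => //.
have hx := normal_word_nonaff nx.
have [phi [Gphi hphi]] := conjG_conj gx0 gx.
have [i hi] := isG_rot_conj Gphi hX hx s0 sx hphi.
have hn k : (k < size (word x))%N -> normal_letter (nth elem1 (word x) k).
  exact: normal_word_nth.
have [li|li] := leqP i (size X); first by exists i => //; exists (word x).
exists 0%N => //; exists (word x); split=> //.
by move: hi; rewrite rot0 rot_oversize // ltnW.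
Qed.

Definition henon_coef (h : C * {poly C}) : C := if h.1 == 0 then 1 else - h.1.

Lemma henon_elem_proof h : (henon_coef h != 0) && ((1 : C) != 0).
Proof.
rewrite oner_neq0 andbT /henon_coef; have [_|h0] := eqVneq h.1 0; first exact: oner_neq0.
by rewrite oppr_eq0.
Qed.

(* The elementary factor e of a Henon map h = t e; [henon_coef] has the junk value 1
   at [h.1 = 0] so that [henon_elem] is total. *)
Definition henon_elem h := @Elem (henon_coef h) 1 0 h.2 (henon_elem_proof h).

Lemma henonE h z : h.1 != 0 -> henon h z = tsw (app (henon_elem h) z).
Proof.
move=> /negPf h0; rewrite /henon /app /tsw /= /henon_coef h0 mul1r addr0.
by congr pair; ring.
Qed.

Lemma henon_invE h z : h.1 != 0 -> henon_inv h z = app (elemV (henon_elem h)) (tsw z).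
Proof.
move=> h0; have [k1 k2] := henon_invK h0.
rewrite -[RHS]k1 /= henonE // appKV tswK //.
Qed.

Definition einv_coefs (n : nat) : C * C :=
  match n with 0 => (-1, 1) | 1 => (1, -1) | _ => (-1, -1) end.

Lemma einv_elem_proof n : ((einv_coefs n).1 != 0) && ((einv_coefs n).2 != 0).
Proof. by case: n => [|[|n]] /=; rewrite ?oppr_eq0 ?oner_neq0. Qed.

Definition einv_elem (e : nat * {poly C}) := @Elem _ _ 0 e.2 (einv_elem_proof e.1).

Lemma einvE e z : einv e z = app (einv_elem e) z.
Proof.
by case: e => -[|[|n]] p; rewrite /einv /app /=; congr pair; ring.
Qed.

Definition henon_word (hs : seq (C * {poly C})) := map henon_elem (rev hs).
Definition henon_word_inv (hs : seq (C * {poly C})) := map elemV (map henon_elem hs).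

Definition nonzero_data (hs : seq (C * {poly C})) := forall h, h \in hs -> h.1 != 0.

Lemma compw_cat v w z : compw (v ++ w) z = compw v (compw w z).
Proof. by elim: v => //= f v IH; rewrite IH. Qed.

Lemma hrevsE hs z : nonzero_data hs -> compw (hrevs hs) z = tv (henon_word hs) z.
Proof.
rewrite /hrevs /henon_word => h; have {}h : nonzero_data (rev hs) by move=> k; rewrite mem_rev; exact: h.
elim: (rev hs) h => //= k s IH h; rewrite tv_cons -IH ?henonE ?h ?mem_head // => k' hk'.
by apply: h; rewrite inE hk' orbT.
Qed.

Lemma hinvsE hs z : nonzero_data hs -> tsw (compw (hinvs hs) z) = tv (henon_word_inv hs) (tsw z).
Proof.
rewrite /hinvs /henon_word_inv; elim: hs => //= k s IH h.
rewrite henon_invE ?h ?mem_head // tv_cons -IH // => k' hk'.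
by apply: h; rewrite inE hk' orbT.
Qed.

(** An inverse Hénon map e^-1 t has its swap on the right, so the aa and ea forms become words t x1
    t x2 ... only after conjugation by t; the ee form already is one. *)
Definition word_aa hs := henon_word_inv hs ++ henon_word hs.
Definition word_ea hs e1 := henon_word_inv hs ++ einv_elem e1 :: henon_word hs.
Definition word_ee hs e0 e1 := henon_word_inv hs ++ einv_elem e1 :: rcons (henon_word hs) (einv_elem e0).

Lemma N_aaE hs z : nonzero_data hs -> tsw (N_aa hs z) = tv (word_aa hs) (tsw z).
Proof.
move=> h; rewrite /N_aa !compw_cat /= ?compw_cat /= hinvsE // hrevsE // tswK.
by rewrite tv_cat.
Qed.

Lemma N_eaE hs e1 z : nonzero_data hs -> tsw (N_ea hs e1 z) = tv (word_ea hs e1) (tsw z).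
Proof.
move=> h; rewrite /N_ea !compw_cat /= ?compw_cat /= hinvsE // hrevsE // einvE.
by rewrite tv_cat tv_cons.
Qed.

Lemma N_eeE hs e0 e1 z : nonzero_data hs -> N_ee hs e0 e1 z = tv (word_ee hs e0 e1) z.
Proof.
move=> h; rewrite /N_ee /= !compw_cat /= ?compw_cat /= hinvsE // hrevsE // !einvE.
by rewrite tv_cat tv_cons tv_rcons.
Qed.

(** The inverse of a monic letter has leading coefficient [- eal], which explains the last
    alternative in [normal_letter]. *)
Lemma henon_normal_letter h : henon_normal h ->
  normal_letter (henon_elem h) /\ normal_letter (elemV (henon_elem h)).
Proof.
move=> [[h0 sh] [/monicP mh sub]]; split.
  split=> //; first by left.
  by left.
have c0 := eal_neq0 (henon_elem h).
have Ep : epol (elemV (henon_elem h)) = (- (henon_coef h)^-1) *: h.2.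
  by rewrite /= mul0r oppr0 polyC0 addr0 invr1 scale1r comp_polyXr.
split.
- by rewrite nonaffV.
- by left; rewrite /= invr1.
- by rewrite /= mul0r oppr0.
- by rewrite size_epolV Ep coefZ sub mulr0.
- by right; right; rewrite Ep lead_coefZ mh mulr1.
Qed.

(** For an odd or even polynomial the subleading coefficient has the wrong parity and vanishes. *)
Lemma einv_normal_letter e : einv_normal e -> normal_letter (einv_elem e).
Proof.
move=> [e3 [sp [/monicP mp h]]]; split=> //=; last by left.
  by case: (e.1) => [|[|n]] /=; [left|right|right].
have [k sk] : exists k, size e.2 = k.+2 by exists (size e.2 - 2)%N; rewrite -addn2 subnK // ltnW.
have lk : e.2`_k.+1 != 0 by rewrite -[k.+1]/(k.+2.-1) -sk -lead_coefE mp oner_neq0.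
rewrite sk subSS subSS subn0 in h *.
case: (e.1) h => [|[|n]] // h; apply: (h).
  by apply: contra lk => ok; rewrite h //= ok.
by apply: contraNT lk => ok; rewrite h //= ok.
Qed.

Lemma normal_word_hs hs : all_normal hs ->
  [/\ nonzero_data hs, normal_word (henon_word_inv hs) & normal_word (henon_word hs)].
Proof.
move=> h; split; first by move=> k /h[[]].
- rewrite /henon_word_inv; elim: hs h => //= k s IH h; split.
    by have [] := henon_normal_letter (h k (mem_head _ _)).
  by apply: IH => k' hk'; apply: h; rewrite inE hk' orbT.
- rewrite /henon_word; have {}h : all_normal (rev hs) by move=> k; rewrite mem_rev; exact: h.
  elim: (rev hs) h => //= k s IH h; split.
    by have [] := henon_normal_letter (h k (mem_head _ _)).
  by apply: IH => k' hk'; apply: h; rewrite inE hk' orbT.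
Qed.

Definition dec_henon (d : C * C * C * {poly C}) : C * {poly C} := (- d.1.1.1, d.2).

Lemma dec_henon_word hs : nonzero_data hs ->
  rev (map dec_henon (map edata (henon_word hs))) = hs.
Proof.
move=> h; rewrite /henon_word -!map_comp -map_rev revK -[RHS]map_id; apply/eq_in_map => k /h k0.
by rewrite /dec_henon /= /henon_coef (negPf k0) opprK; case: (k).
Qed.

Definition dec_einv (d : C * C * C * {poly C}) : nat * {poly C} :=
  (if d.1.1.1 == 1 then 1%N else if d.1.1.2 == 1 then 0%N else 2%N, d.2).

Lemma dec_einv_elem e : (e.1 < 3)%N -> dec_einv (edata (einv_elem e)) = e.
Proof.
have ne : (-1 : C) == 1 = false by rewrite eq_sym -subr_eq0 opprK -mulr2n pnatr_eq0.
by case: e => -[|[|[|n]]] p //= _; rewrite /dec_einv /= ?eqxx ?ne.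
Qed.

Lemma size_henon_word hs : size (henon_word hs) = size hs.
Proof. by rewrite size_map size_rev. Qed.

Lemma size_henon_word_inv hs : size (henon_word_inv hs) = size hs.
Proof. by rewrite !size_map. Qed.

Lemma isG_conj_tv g (f : map2) W : conjG g f ->
  (forall z, tsw (f z) = tv W (tsw z)) -> conjG g (tv W).
Proof. by move=> gf h; apply: (conjG_trans gf isG_tsw) => z; rewrite h. Qed.

Lemma unique_aa g : finitely_many (fun hs => all_normal hs /\ conjG g (N_aa hs)).
Proof.
pose dec D := rev (map dec_henon (drop (size D)./2 D)).
have := @fm_conj_normal g _ word_aa (fun hs => all_normal hs /\ hs != [::]) dec.
case=> [hs [nh h0]|s hs].
  have [d1 d2 d3] := normal_word_hs nh.
  have sV := size_henon_word_inv hs; have sR := size_henon_word hs.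
  rewrite /word_aa; split; first by rewrite normal_word_cat.
    by rewrite size_cat sV sR addn_gt0 orbb lt0n size_eq0.
  rewrite /dec size_map size_cat sV sR addnn doubleK map_cat drop_size_cat ?size_map //.
  exact: dec_henon_word.
(* The empty list, for which the form is t t and the word has no letters, is added by hand. *)
exists ([::] :: s) => h [nh gh]; rewrite inE; have [//|h0] := eqVneq h [::].
apply: hs; split=> //; have [d1 _ _] := normal_word_hs nh.
by apply: isG_conj_tv gh _ => z; exact: N_aaE.
Qed.

Lemma unique_ea g : finitely_many (fun he : seq (C * {poly C}) * (nat * {poly C}) =>
  all_normal he.1 /\ einv_normal he.2 /\ conjG g (N_ea he.1 he.2)).
Proof.
pose dec D := let m := (size D)./2 in
  (rev (map dec_henon (drop m.+1 D)), dec_einv (nth (edata elem1) D m)).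
have := @fm_conj_normal g _ (fun he => word_ea he.1 he.2) (fun he => all_normal he.1 /\ einv_normal he.2) dec.
case=> [[hs e] /= [nh ne]|s hs].
  have [d1 d2 d3] := normal_word_hs nh; have en := einv_normal_letter ne.
  have sV := size_henon_word_inv hs; have sR := size_henon_word hs.
  rewrite /word_ea; split; first by rewrite normal_word_cat.
    by rewrite size_cat /= addnS.
  have sm : size (map edata (henon_word_inv hs)) = size hs by rewrite size_map.
  rewrite /dec size_map size_cat /= sV sR addnS addnn /= uphalf_double map_cat /=.
  rewrite nth_cat sm ltnn subnn /= -cat_rcons drop_size_cat ?size_rcons ?sm //.
  by rewrite dec_henon_word // dec_einv_elem //; case: ne.
exists s => -[h e] /= [nh [ne gh]].
apply: hs; split=> //; have [d1 _ _] := normal_word_hs nh.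
by apply: isG_conj_tv gh _ => z; exact: N_eaE.
Qed.

Lemma unique_ee g : finitely_many (fun he : seq (C * {poly C}) * (nat * {poly C}) * (nat * {poly C}) =>
  [/\ all_normal he.1.1, einv_normal he.1.2, einv_normal he.2 & conjG g (N_ee he.1.1 he.1.2 he.2)]).
Proof.
(* The word has 2 m' + 2 letters: m' inverse letters, [e1] at index m', m' Hénon letters, and [e0]
   at the end. *)
pose dec D := let m := (size D)./2.-1 in
  (rev (map dec_henon (take m (drop m.+1 D))), dec_einv (last (edata elem1) D),
   dec_einv (nth (edata elem1) D m)).
have := @fm_conj_normal g _ (fun he => word_ee he.1.1 he.1.2 he.2)
  (fun he => [/\ all_normal he.1.1, einv_normal he.1.2 & einv_normal he.2]) dec.
case=> [[[hs e0] e1] /= [nh n0 n1]|s hs].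
  have [d1 d2 d3] := normal_word_hs nh.
  have l0 := einv_normal_letter n0; have l1 := einv_normal_letter n1.
  have sV := size_henon_word_inv hs; have sR := size_henon_word hs.
  rewrite /word_ee; split; first by rewrite normal_word_cat /= normal_word_rcons.
    by rewrite size_cat /= addnS.
  have sm : size (map edata (henon_word_inv hs)) = size hs by rewrite size_map.
  have sm' : size (map edata (henon_word hs)) = size hs by rewrite size_map.
  rewrite /dec size_map size_cat /= size_rcons sV sR !addnS addnn /= doubleK map_cat /=.
  rewrite nth_cat sm ltnn subnn /= -cat_rcons drop_size_cat ?size_rcons ?sm //.
  rewrite map_rcons -cats1 take_size_cat // dec_henon_word // cats1 last_cat last_rcons.
  by rewrite !dec_einv_elem //; [case: n1|case: n0].
exists s => -[[h e0] e1] /= [nh n0 n1 gh].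
apply: hs; split=> //; have [d1 _ _] := normal_word_hs nh.
(* Conjugation by the identity exchanges a map for a pointwise equal one. *)
apply: (conjG_trans gh (isG_app elem1)) => z.
by rewrite !app1 N_eeE.
Qed.
(** * Normalization of words *)

Definition edeg (x : elem) := (size (epol x)).-1.

(* the root-centering translation: y + kap x kills the subleading coefficient *)
Definition kap (x : elem) : C :=
  (epol x)`_(size (epol x) - 2) / ((edeg x)%:R * lead_coef (epol x)).

Lemma nonaff_size x : nonaff x -> exists k, size (epol x) = k.+3.
Proof. by move=> h; exists (size (epol x) - 3)%N; rewrite -addn3 subnK. Qed.

Lemma edeg_gt1 x : nonaff x -> (1 < edeg x)%N.
Proof. by move=> /nonaff_size[k h]; rewrite /edeg h. Qed.

Lemma elead_neq0 x : nonaff x -> lead_coef (epol x) != 0.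
Proof. by move=> /nonaff_size[k h]; rewrite lead_coef_eq0 -size_poly_gt0 h. Qed.

Lemma diag_ex (a b c e : C) : a != 0 -> c != 0 ->
  exists d, [/\ isdiag d, eal d = a, ebe d = c, eeta d = e & (epol d)`_0 = b].
Proof.
move=> a0 c0; have pf : (a != 0) && (c != 0) by rewrite a0.
exists (@Elem a c e b%:P pf); split=> //; last by rewrite /= coefC.
exact: size_polyC_leq1.
Qed.

(** Up to an additive constant, the polynomial of D x d^-1 is [eal D] times [epol x] evaluated at y
    / ebe d - kap x; the shift by [kap x] cancels the subleading term. *)
Lemma twist_coefs D x d : isdiag D -> isdiag d -> nonaff x -> eeta d = kap x * ebe d ->
  let y := elemM (elemM D x) (elemV d) in
  [/\ size (epol y) = size (epol x),
      lead_coef (epol y) = eal D * lead_coef (epol x) / ebe d ^+ edeg x &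
      (epol y)`_(size (epol y) - 2) = 0].
Proof.
move=> hD hd nx he y; have [k sx] := nonaff_size nx.
have c0 := ebe_neq0 d; have a0 := eal_neq0 d; have D0 := eal_neq0 D.
have lx : lead_coef (epol x) = (epol x)`_k.+2 by rewrite lead_coefE sx.
have lx0 : (epol x)`_k.+2 != 0 by rewrite -lx elead_neq0.
pose q := eal D *: epol x + ((epol D)`_0)%:P.
have sq : size q = k.+3.
  rewrite size_polyDl size_scale ?eal_neq0 // sx.
  by rewrite (leq_ltn_trans (size_polyC_leq1 _)).
have [b Ey] : exists b : C, epol y = b%:P + (q \Po ((ebe d)^-1 *: 'X + (- (eeta d / ebe d))%:P)).
  exists (eal D * eal x * (- (eal d)^-1 * (epol d)`_0)).
  have hV : epol (elemV d) = (- (eal d)^-1 * (epol d)`_0)%:P.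
    by rewrite /= [in LHS](size1_polyC hd) comp_polyC -mul_polyC polyCM.
  have hDx : epol (elemM D x) = q by rewrite /= [in LHS](size1_polyC hD) comp_polyC.
  have -> : epol y = eal (elemM D x) *: epol (elemV d) +
      (epol (elemM D x) \Po (ebe (elemV d) *: 'X + (eeta (elemV d))%:P)) by [].
  by rewrite hV hDx -mul_polyC -polyCM.
have sy : size (epol y) = k.+3.
  rewrite Ey addrC size_polyDl size_comp_poly2 ?size_lin ?invr_neq0 ?sq //.
  by rewrite (leq_ltn_trans (size_polyC_leq1 _)).
have [t1 t2] := coef_comp_lin (- (eeta d / ebe d)) (invr_neq0 c0) sq.
have Y1 : (epol y)`_k.+2 = q`_k.+2 * (ebe d)^-1 ^+ k.+2 by rewrite Ey coefD coefC add0r t1.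
have Y2 : (epol y)`_k.+1 = q`_k.+1 * (ebe d)^-1 ^+ k.+1 +
    q`_k.+2 * (k.+2%:R * (ebe d)^-1 ^+ k.+1 * (- (eeta d / ebe d))).
  by rewrite Ey coefD coefC add0r t2.
have q1 : q`_k.+2 = eal D * (epol x)`_k.+2 by rewrite coefD coefZ coefC addr0.
have q2 : q`_k.+1 = eal D * (epol x)`_k.+1 by rewrite coefD coefZ coefC addr0.
split; first by rewrite sy sx.
  by rewrite lead_coefE sy lx /= Y1 q1 /edeg sx /= exprVn.
rewrite sy !subSS subn0 Y2 q1 q2 he /kap /edeg sx /= !subSS subn0 lx.
have k0 : (k.+2%:R : C) != 0 by rewrite pnatr_eq0.
move: (k.+2%:R) k0 ((ebe d)^-1 ^+ k.+1) => r r0 z; field.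
by rewrite lx0 r0 c0.
Qed.

(** [eal y] is left free: it is minus the parameter delta of the Hénon map. *)
Definition henon_letter (y : elem) : Prop :=
  [/\ nonaff y, ebe y = 1, eeta y = 0, lead_coef (epol y) = 1 & (epol y)`_(size (epol y) - 2) = 0].

(* the coefficient ebe d_0 forced by ebe d_k = z when all twisted letters are monic *)
Fixpoint twist_be (X : seq elem) (z : C) : C :=
  if X is x :: X' then twist_be X' z ^+ edeg x / lead_coef (epol x) else z.

Lemma twist_be_monomial X : all nonaff X -> exists K M, [/\ K != 0, (0 < M)%N &
  forall z, twist_be X z = K * z ^+ M].
Proof.
elim: X => [_|x X IH] /=.
  by exists 1, 1%N; split=> // [|z]; rewrite ?oner_neq0 // mul1r.
case/andP=> hx /IH[K [M [K0 M0 E]]].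
exists (K ^+ edeg x / lead_coef (epol x)), (M * edeg x)%N; split.
- by rewrite mulf_neq0 ?expf_neq0 // invr_neq0 // elead_neq0.
- by rewrite muln_gt0 M0 ltnW // edeg_gt1.
- by move=> z; rewrite E exprMn -exprM mulrAC.
Qed.

Lemma twist_be_neq0 X z : all nonaff X -> z != 0 -> twist_be X z != 0.
Proof.
by move=> hX z0; have [K [M [K0 _ ->]]] := twist_be_monomial hX; rewrite mulf_neq0 // expf_neq0.
Qed.

(** Each twisted letter (t d t) x d'^-1 must be monic, have [ebe] equal to 1 and no translation;
    this forces [ebe], [eal] and the constant of [epol] of d in terms of d'. The translation of d
    stays free to centre the preceding letter. At the ends, the translation of [d0], and [eal] and
    [epol] of [dk], remain available for the involutions. *)
Lemma twist_word x X dk d0 (z := ebe dk) : all nonaff (x :: X) -> isdiag dk -> isdiag d0 ->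
  eeta dk = kap (last x X) * z -> ebe d0 = twist_be (x :: X) z ->
  eal d0 = twist_be X z / ebe x ->
  (epol d0)`_0 = kap x * twist_be X z - eal d0 * eeta x ->
  exists hs, [/\ all_normal hs, hs != [::] &
    forall w, app d0 (tv (x :: X) w) = tv (henon_word hs) (app dk w)].
Proof.
have letter_hs y hs : henon_letter y -> all_normal hs ->
    exists hs', [/\ all_normal hs', hs' != [::] &
      forall w, tsw (app y (tv (henon_word hs) w)) = tv (henon_word hs') w].
  move=> [ny b1 e0 l1 s0] nh; exists (rcons hs (- eal y, epol y)); split.
  - move=> h; rewrite mem_rcons inE => /orP[/eqP->|/nh//].
    by split; [split=> //; rewrite oppr_eq0 eal_neq0|split=> //; apply/monicP].
  - by rewrite -size_eq0 size_rcons.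
  move=> w; rewrite /henon_word rev_rcons map_cons tv_cons; congr (tsw _).
  by rewrite /app /= /henon_coef /= oppr_eq0 (negPf (eal_neq0 _)) opprK b1 e0.
have step x1 D d1 : nonaff x1 -> isdiag D -> isdiag d1 -> eeta d1 = kap x1 * ebe d1 ->
   ebe D = ebe d1 ^+ edeg x1 / lead_coef (epol x1) -> eal D = ebe d1 / ebe x1 ->
   (epol D)`_0 = eeta d1 - eal D * eeta x1 ->
   henon_letter (elemM (elemM (diag_swap D) x1) (elemV d1)).
  move=> nx hD hd1 he hbe hal hp.
  have [E1 E2 E3] := twist_coefs (isdiag_swap D) hd1 nx he.
  have x0 := ebe_neq0 x1; have c0 := ebe_neq0 d1; have l0 := elead_neq0 nx.
  split=> //.
  - by rewrite /nonaff E1.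
  - by rewrite /= hal; field; rewrite x0 c0.
  - by rewrite /= hp hal; field; rewrite x0 c0.
  - by rewrite E2 /= hbe; have := expf_neq0 (edeg x1) c0 => h; field; rewrite h l0.
elim: X x d0 => [|x' X IH] x d0 hX hk h0 ek be0 al0 p0.
  have nx : nonaff x by case/andP: hX.
  have hy : henon_letter (elemM (elemM (diag_swap d0) x) (elemV dk)).
    by apply: step => //; rewrite p0 ek.
  have [hs [nh hs0 E]] : _ := letter_hs _ [::] hy (fun h (hh : h \in [::]) => False_ind _ (notF hh)).
  exists hs; split=> // w; rewrite -E !tv_cons !tv_nil -[app d0 _]tswK isdiag_tsw //.
  by rewrite [in RHS]appM appVK.
have [nx hX'] : nonaff x /\ all nonaff (x' :: X) by apply/andP.
have [nx' hX''] : nonaff x' /\ all nonaff X by apply/andP.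
have z0 : z != 0 by exact: ebe_neq0.
pose a := twist_be X z / ebe x'.
have a0 : a != 0 by rewrite mulf_neq0 ?invr_neq0 ?ebe_neq0 // twist_be_neq0.
(* [eeta d1] centres the letter [x]; the other parameters are those forced by the letter [x']. *)
have [d1 [hd1 d1a d1c d1e d1p]] := diag_ex (kap x' * twist_be X z - a * eeta x')
   (kap x * twist_be (x' :: X) z) a0 (twist_be_neq0 hX' z0).
rewrite -d1a in d1p.
have [hs [nh _ E]] := IH x' d1 hX' hk hd1 ek d1c d1a d1p.
have hy : henon_letter (elemM (elemM (diag_swap d0) x) (elemV d1)).
  by apply: step => //; rewrite ?d1c ?d1e.
have [hs' [nh' hs0' E']] := letter_hs _ _ hy nh.
exists hs'; split=> // w; rewrite -E' -E !(tv_cons x) -[app d0 _]tswK isdiag_tsw //.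
by rewrite [in RHS]appM appVK.
Qed.

(** * Existence of the normal forms *)

Lemma root_ex (v : C) n : v != 0 -> (0 < n)%N -> exists2 z : C, z != 0 & z ^+ n = v.
Proof.
move=> v0 n0; have sp : size ('X^n - v%:P) = n.+1 by rewrite size_XnsubC.
have [|z] := @closed_rootP (complex Rdefinitions.R) ('X^n - v%:P) _.
  by rewrite sp eqSS -lt0n.
rewrite rootE hornerD hornerN hornerXn hornerC subr_eq0 => /eqP hz; exists z => //.
by apply: contraNneq v0 => z0; rewrite -hz z0 expr0n eqn0Ngt n0.
Qed.

Lemma solve_monomials (a b : C) m n : a != 0 -> b != 0 -> (m < n)%N ->
  exists2 z : C, z != 0 & a * z ^+ m = b * z ^+ n.
Proof.
move=> a0 b0 mn; have [||z z0 hz] := @root_ex (a / b) (n - m); rewrite ?subn_gt0 //.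
  by rewrite mulf_neq0 ?invr_neq0.
exists z => //; rewrite -(subnK (ltnW mn)) exprD hz mulrA [b * _]mulrC divfK //.
Qed.

Definition sym_diag (d : elem) := [/\ isdiag d, eal d = ebe d & (epol d)`_0 = eeta d].

Lemma sym_diag_tsw d z : sym_diag d -> app d (tsw z) = tsw (app d z).
Proof.
move=> [hd h1 h2]; have hv t : (epol d).[t] = eeta d by rewrite (size1_polyC hd) hornerC.
by case: z => x y; rewrite /app /tsw /= !hv h1.
Qed.

Lemma app_injective e : injective (app e).
Proof. exact: can_inj (appVK e). Qed.

Lemma tv_injective W : injective (tv W).
Proof.
elim: W => [|x W IH] z w //; rewrite !tv_cons => /(congr1 tsw); rewrite !tswK.
by move/app_injective/IH.
Qed.

Lemma hrevs_hinvs hs z : nonzero_data hs -> compw (hrevs hs) (compw (hinvs hs) z) = z.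
Proof.
rewrite /hrevs; elim: hs z => // h hs IH z hn.
have hn' : nonzero_data hs by move=> k hk; apply: hn; rewrite inE hk orbT.
rewrite rev_cons map_rcons -cats1 compw_cat /=.
have [_ K] := henon_invK (hn _ (mem_head _ _)).
by rewrite [henon h _]K IH.
Qed.

(** Applying the Hénon word on the left removes the inverse maps; as this word is injective,
    conjugacies can be verified after applying it. *)
Lemma N_aa_tv hs z : nonzero_data hs ->
  tv (henon_word hs) (N_aa hs z) = tsw (tv (henon_word hs) (tsw z)).
Proof.
by move=> h; rewrite -!hrevsE // /N_aa !compw_cat /= ?compw_cat /= hrevs_hinvs.
Qed.

Lemma N_ea_tv hs e z : nonzero_data hs ->
  tv (henon_word hs) (N_ea hs e z) = einv e (tv (henon_word hs) (tsw z)).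
Proof.
by move=> h; rewrite -!hrevsE // /N_ea !compw_cat /= ?compw_cat /= hrevs_hinvs.
Qed.

Lemma N_ee_tv hs e0 e1 z : nonzero_data hs ->
  tv (henon_word hs) (tsw (N_ee hs e0 e1 z)) = einv e1 (tv (henon_word hs) (tsw (einv e0 z))).
Proof.
by move=> h; rewrite -!hrevsE // /N_ee /= !compw_cat /= ?compw_cat /= tswK hrevs_hinvs.
Qed.

Lemma cred_N_aa hs : all_normal hs -> hs != [::] -> cred_map (N_aa hs).
Proof.
move=> nh h0; have [d1 d2 d3] := normal_word_hs nh.
have nW : all nonaff (word_aa hs) by apply: normal_word_nonaff; rewrite normal_word_cat.
have [|_ h] := cred_map_tv nW.
  by rewrite size_cat size_henon_word_inv addn_gt0 lt0n size_eq0 h0.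
by apply: eq_cred_map h => z; rewrite /= -[LHS]tswK -N_aaE // !tswK.
Qed.

Lemma cred_N_ea hs e : all_normal hs -> einv_normal e -> cred_map (N_ea hs e).
Proof.
move=> nh ne; have [d1 d2 d3] := normal_word_hs nh; have en := einv_normal_letter ne.
have nW : all nonaff (word_ea hs e) by apply: normal_word_nonaff; rewrite normal_word_cat.
have [|_ h] := cred_map_tv nW; first by rewrite size_cat /= addnS.
by apply: eq_cred_map h => z; rewrite /= -[LHS]tswK -N_eaE // !tswK.
Qed.

Lemma cred_N_ee hs e0 e1 : all_normal hs -> einv_normal e0 -> einv_normal e1 ->
  cred_map (N_ee hs e0 e1).
Proof.
move=> nh n0 n1; have [d1 d2 d3] := normal_word_hs nh.
have l0 := einv_normal_letter n0; have l1 := einv_normal_letter n1.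
have nW : all nonaff (word_ee hs e0 e1).
  by apply: normal_word_nonaff; rewrite normal_word_cat /= normal_word_rcons.
have [|h _] := cred_map_tv nW; first by rewrite size_cat /= addnS.
by apply: eq_cred_map h => z; rewrite N_eeE.
Qed.

(** Both [dk] and [d0] have to commute with t. For [dk] this only fixes free parameters; for [d0] it
    demands [eal d0 = ebe d0], which is the monomial equation for z. *)
Lemma exist_aa g f x X : all nonaff (x :: X) -> conjG g f ->
  (forall w, tv (x :: X) (f w) = tsw (tv (x :: X) (tsw w))) ->
  exists hs, all_normal hs /\ cred_map (N_aa hs) /\ conjG g (N_aa hs).
Proof.
move=> hX gf hf; have [nx hX'] : nonaff x /\ all nonaff X by apply/andP.
have [K [M [K0 M0 EX]]] := twist_be_monomial hX'.
have lx := elead_neq0 nx; have B0 := ebe_neq0 x.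
have [|||z z0 hz] := @solve_monomials (K / ebe x) (K ^+ edeg x / lead_coef (epol x)) M (M * edeg x).
- by rewrite mulf_neq0 ?invr_neq0.
- by rewrite mulf_neq0 ?expf_neq0 ?invr_neq0.
- by rewrite ltn_Pmulr // edeg_gt1.
have [dk [hk ka kc ke kp]] := diag_ex (kap (last x X) * z) (kap (last x X) * z) z0 z0.
have a0 : twist_be X z / ebe x != 0 by rewrite mulf_neq0 ?invr_neq0 // twist_be_neq0.
pose b := kap x * twist_be X z - twist_be X z / ebe x * eeta x.
have [d0 [h0 da dc de dp]] := diag_ex b b a0 a0.
have [||||hs [nh hs0 E]] := @twist_word x X dk d0 hX hk h0; rewrite ?kc ?ke ?da ?dp //.
  by rewrite dc /= EX exprMn -exprM [RHS]mulrAC -hz mulrAC.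
have [nz _ _] := normal_word_hs nh.
exists hs; split=> //; split; first exact: cred_N_aa.
apply: (conjG_trans gf (isG_app dk)) => w.
have sk : sym_diag dk by split=> //; rewrite ?ka ?kc ?kp ?ke.
have s0 : sym_diag d0 by split=> //; rewrite ?da ?dc ?dp ?de.
apply: (@tv_injective (henon_word hs)).
by rewrite N_aa_tv // -sym_diag_tsw // -!E hf sym_diag_tsw.
Qed.

Lemma coef_comp_opp (p : {poly C}) i : (p \Po (-1 *: 'X + 0%:P))`_i = (-1) ^+ i * p`_i.
Proof.
rewrite polyC0 addr0 scaleN1r comp_polyE coef_sum.
have E j : p`_j *: (- 'X) ^+ j = ((-1) ^+ j * p`_j) *: 'X^j.
  have N1 : (-1 : {poly C}) = (-1)%:P by rewrite polyCN.
  by rewrite (exprNn 'X) N1 -polyC_exp mul_polyC scalerA mulrC.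
under eq_bigr => j _ do rewrite E coefZ coefXn.
have [h|h] := ltnP i (size p).
  rewrite (bigD1 (Ordinal h)) //= eqxx mulr1 big1 ?addr0 // => j /eqP hj.
  case: eqP => [Ej|]; last by rewrite mulr0.
  by case: hj; apply: val_inj.
rewrite nth_default // mulr0 big1 // => j _.
by rewrite [i == j]gtn_eqF ?mulr0 // (leq_trans (ltn_ord j)).
Qed.

(** Squaring gives eal^2 = ebe^2 = 1. For ebe = 1 the leading coefficient forces eal = -1; for ebe =
    -1 the sign of eal decides the parity of the polynomial. *)
Lemma einv_of_involution y : nonaff y -> (forall w, app y (app y w) = w) ->
  lead_coef (epol y) = 1 -> (epol y)`_(size (epol y) - 2) = 0 ->
  exists e, einv_normal e /\ forall w, einv e w = app y w.
Proof.
move=> ny hinv ly sy; have [k sk] := nonaff_size ny.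
have [|e1 e2 e3 e4] := @app_inj (elemM y y) elem1; first by move=> w; rewrite appM app1.
rewrite /= in e1 e2 e3 e4.
have sgn (u : C) : u * u = 1 -> u = 1 \/ u = -1.
  by move=> h; have := subr_sqr u 1; rewrite !expr2 h mulr1 subrr => /esym/eqP;
     rewrite mulf_eq0 subr_eq0 addr_eq0 => /orP[]/eqP; [left|right].
have p0 : epol y != 0 by rewrite -size_poly_gt0 sk.
have al := sgn _ e1; have [be|be] := sgn _ e2.
  have eta0 : eeta y = 0.
    by move/eqP: e3; rewrite be mul1r -mulr2n mulrn_eq0 => /eqP.
  have al' : eal y = -1.
    have := congr1 (fun q : {poly C} => q`_k.+2) e4.
    have lk : (epol y)`_k.+2 = 1 by rewrite -ly lead_coefE sk.
    rewrite be eta0 scale1r polyC0 addr0 comp_polyXr coefD coefZ coef0 lk mulr1 => /eqP.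
    by rewrite addr_eq0 => /eqP.
  exists (0%N, epol y); split; last first.
    by case=> u v; rewrite /einv /app /= al' be eta0; congr pair; ring.
  by split=> //; split; [|split; [apply/monicP|]].
(* For ebe = -1 the second coordinate of y y = id allows any translation; the vanishing subleading
   coefficient forces it to be 0. *)
have eta0 : eeta y = 0.
  have b0 := ebe_neq0 y; have [_ t] := coef_comp_lin (eeta y) b0 sk.
  rewrite sk !subSS subn0 in sy.
  have := congr1 (fun q : {poly C} => q`_k.+1) e4.
  rewrite coefD coefZ coef0 sy mulr0 add0r t sy mul0r add0r => /eqP.
  rewrite be !mulf_eq0 expf_eq0 oppr_eq0 oner_eq0 andbF orbF pnatr_eq0 /= => /orP[/eqP h|/eqP//].
  by move: p0; rewrite -lead_coef_eq0 lead_coefE sk /= h eqxx.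
rewrite be eta0 in e4.
have ce i : eal y * (epol y)`_i + (-1) ^+ i * (epol y)`_i = 0.
  by have := congr1 (fun q : {poly C} => q`_i) e4; rewrite coefD coefZ coef_comp_opp coef0.
case: al => al.
  exists (1%N, epol y); split; last first.
    by case=> u v; rewrite /einv /app /= al be eta0; congr pair; ring.
  split=> //; split; [|split; [exact/monicP|]] => // i oi /=.
  have := ce i; rewrite al mul1r -signr_odd (negPf oi) expr0 mul1r -mulr2n => /eqP.
  by rewrite mulrn_eq0 => /eqP.
exists (2%N, epol y); split; last first.
  by case=> u v; rewrite /einv /app /= al be eta0; congr pair; ring.
split=> //; split; [|split; [exact/monicP|]] => // i oi /=.
have := ce i; rewrite al mulN1r -signr_odd oi expr1 mulN1r -opprD => /eqP.
by rewrite oppr_eq0 -mulr2n mulrn_eq0 => /eqP.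
Qed.

Lemma normalize_involution e d : nonaff e -> (forall w, app e (app e w) = w) -> isdiag d ->
  eal d * lead_coef (epol e) = ebe d ^+ edeg e -> eeta d = kap e * ebe d ->
  exists ev, einv_normal ev /\ forall w, einv ev (app d w) = app d (app e w).
Proof.
move=> ne he hd hl hk; have [E1 E2 E3] := twist_coefs hd hd ne hk.
have [||||ev [nev hev]] := @einv_of_involution (elemM (elemM d e) (elemV d)).
- by rewrite /nonaff E1.
- by move=> w; rewrite !appM appVK he appKV.
- by rewrite E2 hl mulfV // expf_neq0 // ebe_neq0.
- by [].
by exists ev; split=> // w; rewrite hev !appM appVK.
Qed.

(** [dk] must commute with t and [d0] must make the conjugate of [e] monic and centred; the monic
    condition is the equation for z. Without letters the two diagonal maps coincide. *)
Lemma exist_ea g f X e : all nonaff X -> nonaff e -> (forall w, app e (app e w) = w) ->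
  conjG g f -> (forall w, tv X (f w) = app e (tv X (tsw w))) ->
  exists hs e1, all_normal hs /\ einv_normal e1 /\ cred_map (N_ea hs e1) /\ conjG g (N_ea hs e1).
Proof.
move=> hX ne he gf hf.
suff [hs [dk [d0 [nh [sk hd0 [c1 c2]] E]]]] : exists hs dk d0, [/\ all_normal hs,
    [/\ sym_diag dk, isdiag d0 & eal d0 * lead_coef (epol e) = ebe d0 ^+ edeg e /\
                      eeta d0 = kap e * ebe d0] &
    forall w, app d0 (tv X w) = tv (henon_word hs) (app dk w)].
  have [e1 [ne1 E1]] := normalize_involution ne he hd0 c1 c2.
  have [nz _ _] := normal_word_hs nh.
  exists hs, e1; do 2!split=> //; split; first exact: cred_N_ea.
  apply: (conjG_trans gf (isG_app dk)) => w; apply: (@tv_injective (henon_word hs)).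
  by rewrite N_ea_tv // -sym_diag_tsw // -!E hf E1.
have le := elead_neq0 ne.
case: X hX hf => [|x X] hX hf.
  have [|||z z0 hz] := @solve_monomials (lead_coef (epol e)) 1 1 (edeg e).
  - exact: le.
  - exact: oner_neq0.
  - exact: edeg_gt1.
  have [d [hd da dc de dp]] := diag_ex (kap e * z) (kap e * z) z0 z0.
  exists [::], d, d; split=> //; split=> //; rewrite ?/sym_diag ?da ?dc ?de ?dp //.
  by split=> //; rewrite mulrC -{1}[z]expr1 hz mul1r.
have [nx hX'] : nonaff x /\ all nonaff X by apply/andP.
have [K [M [K0 M0 EX]]] := twist_be_monomial hX'.
have lx := elead_neq0 nx; have B0 := ebe_neq0 x.
have [|||z z0 hz] := @solve_monomials (K / ebe x * lead_coef (epol e))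
   ((K ^+ edeg x / lead_coef (epol x)) ^+ edeg e) M (M * edeg x * edeg e).
- by rewrite !mulf_neq0 ?invr_neq0.
- by rewrite expf_neq0 // mulf_neq0 ?expf_neq0 ?invr_neq0.
- by rewrite -mulnA ltn_Pmulr // (leq_trans (edeg_gt1 nx)) // leq_pmulr // ltnW // edeg_gt1.
have [dk [hk ka kc ke kp]] := diag_ex (kap (last x X) * z) (kap (last x X) * z) z0 z0.
have a0 : twist_be X z / ebe x != 0 by rewrite mulf_neq0 ?invr_neq0 // twist_be_neq0.
pose b := kap x * twist_be X z - twist_be X z / ebe x * eeta x.
have c0 : twist_be (x :: X) z != 0 by exact: twist_be_neq0.
have [d0 [h0 da dc de dp]] := diag_ex b (kap e * twist_be (x :: X) z) a0 c0.
have [||||hs [nh hs0 E]] := @twist_word x X dk d0 hX hk h0; rewrite ?kc ?ke ?da ?dp //.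
exists hs, dk, d0; split=> //; split=> //; first by split=> //; rewrite ?ka ?kc ?kp ?ke.
split; last by rewrite de dc.
rewrite da dc /= EX [(K * _) ^+ edeg x]exprMn -exprM [_ / lead_coef (epol x)]mulrAC exprMn -exprM -hz.
by ring.
Qed.

(** Each end faces an involution to normalize: [d0] acts on [e1], and t dk t acts on [e0]. *)
Lemma exist_ee g f X e0 e1 : all nonaff X ->
  nonaff e0 -> (forall w, app e0 (app e0 w) = w) ->
  nonaff e1 -> (forall w, app e1 (app e1 w) = w) ->
  conjG g f -> (forall w, tv X (tsw (f w)) = app e1 (tv X (tsw (app e0 w)))) ->
  exists hs e0' e1', all_normal hs /\ einv_normal e0' /\ einv_normal e1' /\
    cred_map (N_ee hs e0' e1') /\ conjG g (N_ee hs e0' e1').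
Proof.
move=> hX n0 he0 n1 he1 gf hf.
have l0 := elead_neq0 n0; have l1 := elead_neq0 n1.
suff [hs [dk [d0 [nh [hdk hd0 c1 c2] [c3 c4] E]]]] : exists hs dk d0, [/\ all_normal hs,
    [/\ isdiag dk, isdiag d0, eal d0 * lead_coef (epol e1) = ebe d0 ^+ edeg e1 &
                      eeta d0 = kap e1 * ebe d0],
    ebe dk * lead_coef (epol e0) = eal dk ^+ edeg e0 /\ (epol dk)`_0 = kap e0 * eal dk &
    forall w, app d0 (tv X w) = tv (henon_word hs) (app dk w)].
  have [e1' [ne1 E1]] := normalize_involution n1 he1 hd0 c1 c2.
  have [e0' [ne0 E0]] := normalize_involution n0 he0 (isdiag_swap dk) c3 c4.
  have [nz _ _] := normal_word_hs nh.
  exists hs, e0', e1'; do 3!split=> //; split; first exact: cred_N_ee.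
  apply: (conjG_trans gf (isG_app (diag_swap dk))) => w.
  apply: (can_inj tswK); apply: (@tv_injective (henon_word hs)).
  by rewrite N_ee_tv // E0 !app_diag_swap // !tswK -!E hf E1.
case: X hX hf => [|x X] hX hf.
  (* Without letters one diagonal map meets both conditions: with eal = z, the one at [e0] gives ebe
     = z^(edeg e0) / lead, and the one at [e1] becomes the equation solved here. *)
  have [|||z z0 hz] := @solve_monomials (lead_coef (epol e1) * lead_coef (epol e0) ^+ edeg e1) 1 1 (edeg e0 * edeg e1).
  - by rewrite mulf_neq0 // expf_neq0.
  - exact: oner_neq0.
  - by rewrite (leq_trans (edeg_gt1 n0)) // leq_pmulr // ltnW // edeg_gt1.
  have c0 : z ^+ edeg e0 / lead_coef (epol e0) != 0 by rewrite mulf_neq0 ?expf_neq0 ?invr_neq0.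
  have [d [hd da dc de dp]] := diag_ex (kap e0 * z) (kap e1 * (z ^+ edeg e0 / lead_coef (epol e0))) z0 c0.
  exists [::], d, d; split=> //; rewrite ?da ?dc ?de ?dp //; split=> //.
    rewrite exprMn -exprM -[z ^+ (_ * _)]mul1r -hz expr1 exprVn.
    by have h := expf_neq0 (edeg e1) l0; field.
  by rewrite divfK.
have [nx hX'] : nonaff x /\ all nonaff X by apply/andP.
have [K [M [K0 M0 EX]]] := twist_be_monomial hX'.
have lx := elead_neq0 nx; have B0 := ebe_neq0 x.
have [|||z z0 hz] := @solve_monomials (K / ebe x * lead_coef (epol e1))
   ((K ^+ edeg x / lead_coef (epol x)) ^+ edeg e1) M (M * edeg x * edeg e1).
- by rewrite !mulf_neq0 ?invr_neq0.
- by rewrite expf_neq0 // mulf_neq0 ?expf_neq0 ?invr_neq0.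
- by rewrite -mulnA ltn_Pmulr // (leq_trans (edeg_gt1 nx)) // leq_pmulr // ltnW // edeg_gt1.
(* [eal dk] is still free, so the condition at [e0] is met by a root taken after z is known. *)
have [||z' z'0 hz'] := @root_ex (z * lead_coef (epol e0)) (edeg e0).
- by rewrite mulf_neq0.
- by rewrite ltnW // edeg_gt1.
have [dk [hk ka kc ke kp]] := diag_ex (kap e0 * z') (kap (last x X) * z) z'0 z0.
have a0 : twist_be X z / ebe x != 0 by rewrite mulf_neq0 ?invr_neq0 // twist_be_neq0.
pose b := kap x * twist_be X z - twist_be X z / ebe x * eeta x.
have c0 : twist_be (x :: X) z != 0 by exact: twist_be_neq0.
have [d0 [h0 da dc de dp]] := diag_ex b (kap e1 * twist_be (x :: X) z) a0 c0.
have [||||hs [nh hs0 E]] := @twist_word x X dk d0 hX hk h0; rewrite ?kc ?ke ?da ?dp //.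
exists hs, dk, d0; split=> //; last by rewrite kc ka kp hz'.
split=> //; last by rewrite de dc.
rewrite da dc /= EX [(K * _) ^+ edeg x]exprMn -exprM [_ / lead_coef (epol x)]mulrAC exprMn -exprM -hz.
by ring.
Qed.
(** * Words with two involutions *)

Lemma aff_involution r : aff_only r -> involution r ->
  exists s, ~~ nonaff s /\ forall z, r (app s z) = app s (tsw z).
Proof.
move=> [[a [b [c [d [u [v [D h]]]]]]] ne] inv.
have c0 : c != 0.
  apply/negP => /eqP c0; apply: ne; exists a, d, v, (b *: 'X + u%:P).
  move: D; rewrite c0 mulr0 subr0 mulf_eq0 negb_or => /andP[-> ->]; do 2!split=> //.
  by move=> x y; rewrite h c0 hornerD hornerZ hornerX hornerC; congr pair; ring.
have [h1 h2] : a * u + b * v = - u /\ c * u + d * v = - v.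
  have := inv (0, 0); rewrite /= !h => -[].
  by rewrite !mulr0 !add0r => /eqP; rewrite addr_eq0 => /eqP -> /eqP; rewrite addr_eq0 => /eqP ->.
have [h3 h4] : a * a + b * c = 1 /\ a = - d.
  have := inv (1, 0); rewrite /= !h => -[].
  rewrite !mulr1 !mulr0 !addr0 !mulrDr => E1 E2; split.
    rewrite -E1; transitivity (a * a + b * c + (a * u + b * v) + u); last by ring.
    by rewrite h1 subrK.
  apply: (mulfI c0); apply/eqP; rewrite -subr_eq0 -[X in _ == X]E2; apply/eqP.
  transitivity (c * a + d * c + (c * u + d * v) + v); last by ring.
  by rewrite h2; ring.
have pf : ((1 : C) != 0) && (c != 0) by rewrite oner_neq0.
have two0 : (2%:R : C) != 0 by rewrite pnatr_eq0.
(* The point (u/2, v/2), midway between 0 and its image, is fixed by r. The columns of the linear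
   part are the first basis vector and its image (a, c) under the linear part of r, with a = -d; r
   exchanges these as t exchanges the basis vectors. *)
exists (@Elem 1 c (v / 2%:R) (- d *: 'X + (u / 2%:R)%:P) pf); split.
  rewrite /nonaff -leqNgt (leq_trans (size_polyD _ _)) // geq_max.
  rewrite (leq_trans (size_scale_leq _ _)) ?size_polyX //=.
  by rewrite (leq_trans (size_polyC_leq1 _)).
case=> x y; rewrite /app /tsw /= !hornerD !hornerZ !hornerX !hornerC h; congr pair.
  transitivity (a * x + (b * c - a * d) * y + (a * u + b * v) / 2%:R + u); first by field.
  have -> : b * c - a * d = 1 by rewrite -h3 {3}h4; ring.
  by rewrite h1 h4; field.
transitivity (c * x + (c * u + d * v) / 2%:R + v); first by field.
by rewrite h2; field.
Qed.

Lemma letter_cases f : letter f -> aff_only f \/ elem_only f.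
Proof. by move=> [[h|h] ns]; [left|right]; split=> // h'; apply: ns. Qed.

Lemma reduced_cons x y u : reduced [:: x, y & u] ->
  [/\ letter x, ~ same_subgroup x y & reduced (y :: u)].
Proof.
move=> [_ [h1 h2]]; split; [exact: (h1 0%N)|exact: (h2 0%N)|].
by split=> //; split=> i hi; [exact: (h1 i.+1)|exact: (h2 i.+1)].
Qed.

Lemma reduced_letter x u : reduced (x :: u) -> letter x.
Proof. by move=> [_ [h _]]; exact: (h 0%N). Qed.

Lemma reduced_suffix v x u : reduced (v ++ x :: u) -> reduced (x :: u).
Proof.
elim: v => // y v IH; case: v IH => [|z v] IH h; first by have [] := reduced_cons h.
by apply: IH; have [] := reduced_cons h.
Qed.

Lemma next_kind x y : letter x -> letter y -> ~ same_subgroup x y ->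
  (aff_only x -> elem_only y) /\ (elem_only x -> aff_only y).
Proof.
move=> /letter_cases hx /letter_cases hy ns; split=> -[h _].
  by case: hy => // -[h' _]; case: ns; left.
by case: hy => // -[h' _]; case: ns; right.
Qed.

Lemma aff_elem_only f : aff_only f -> elem_only f -> False.
Proof. by move=> [h _] [_ h']. Qed.

(** Each affine letter is written s t s', and its triangular affine factors are absorbed by the
    elementary neighbours, which stay nonaffine. The kind of the first letter decides whether the
    outer letter [x0] is affine. *)
Lemma compw_normal fs r tl (c b : map2) : reduced (fs ++ r :: tl) -> aff_only r ->
  (exists2 s, ~~ nonaff s & c =1 app s \o b) ->
  exists x0 l, [/\ all nonaff l, forall z, compw fs (c z) = app x0 (tv l (b z)),
    aff_only (head r fs) -> ~~ nonaff x0 & elem_only (head r fs) -> nonaff x0].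
Proof.
move=> hr ar [s as_ hc]; elim: fs hr => [|x fs IH] hr.
  by exists s, [::]; split=> // /(aff_elem_only ar).
have [y [u [Ey hy]]] : exists y u, fs ++ r :: tl = y :: u /\ y = head r fs.
  by case: (fs) => [|y fs'] /=; eexists; eexists; split.
have hr' := hr; rewrite /= Ey in hr'; have [lx ns ry] := reduced_cons hr'.
rewrite -Ey in ry; have [x0 [l [hl E ha he]]] := IH ry.
rewrite Ey in ry; have [k1 k2] := next_kind lx (reduced_letter ry) ns.
rewrite -hy in ha he.
case: (letter_cases lx) => hx.
  have [s1 [s2 [a1 a2 hs]]] := aff_only_ex hx.
  exists s1, (elemM s2 x0 :: l); split=> //=.
  - by rewrite hl nonaffMl // (he (k1 hx)).
  - by move=> z; rewrite hs E tv_cons appM.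
  - by move=> /(aff_elem_only hx).
have [e ne hse] := elem_only_ex hx.
exists (elemM e x0), l; split=> //=.
- by move=> z; rewrite hse E appM.
- by move=> /aff_elem_only/(_ hx).
- by move=> _; rewrite nonaffMr // ha //; apply: k2.
Qed.

Lemma compw_inv (f finv : nat -> map2) s :
  (forall i, i \in s -> finv i \o f i =1 id /\ f i \o finv i =1 id) ->
  cancel (compw (map f (rev s))) (compw (map finv s)) /\
  cancel (compw (map finv s)) (compw (map f (rev s))).
Proof.
elim: s => [|i s IH] h; first by split.
have [|k1 k2] := IH; first by move=> j hj; apply: h; rewrite inE hj orbT.
have [h1 h2] := h i (mem_head _ _).
split=> z; rewrite rev_cons map_rcons -cats1 compw_cat /=.
  by rewrite k1 [finv i _]h1.
by rewrite [f i _]h2 k2.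
Qed.

Lemma involution_conj e c (i : map2) : i =1 app e -> involution i ->
  forall w, app (elemM (elemV c) (elemM e c)) (app (elemM (elemV c) (elemM e c)) w) = w.
Proof.
move=> h inv w; rewrite !appM appKV -!h [i _]inv.
by rewrite appVK.
Qed.

Lemma app_elemVV e z : app (elemV (elemV e)) z = app e z.
Proof. by rewrite -{1}[z](appVK e) appVK. Qed.

Lemma nonaff_conj e c : nonaff e -> ~~ nonaff c -> nonaff (elemM (elemV c) (elemM e c)).
Proof. by move=> ne ac; rewrite nonaffMl ?nonaffV // nonaffMr. Qed.

Lemma tv_rev_inv Y w : tv (rev (map elemV Y)) (tsw (tv Y (tsw w))) = w.
Proof.
elim: Y w => [|x Y IH] w /=; first by rewrite !tv_nil !tswK.
by rewrite rev_cons tv_rcons tv_cons tswK appVK IH.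
Qed.

(** Conjugation by [s0] turns [r0] into t; [s1] does the same for [r1] and is absorbed into the
    first letter. *)
Lemma conj_aa g (F Finv r0 r1 : map2) s0 s1 x0 l :
  cancel Finv F -> ~~ nonaff s1 -> nonaff x0 -> all nonaff l ->
  (forall z, r0 (app s0 z) = app s0 (tsw z)) -> (forall z, r1 (app s1 z) = app s1 (tsw z)) ->
  (forall z, F (app s0 z) = app x0 (tv l z)) ->
  conjG g (fun z => Finv (r1 (F (r0 z)))) ->
  exists hs, all_normal hs /\ cred_map (N_aa hs) /\ conjG g (N_aa hs).
Proof.
move=> FinvK a1 n0 hl h0 h1 hF gw.
pose f' z := app (elemV s0) (Finv (r1 (F (r0 (app s0 z))))).
have gf' : conjG g f'.
  by apply: (conjG_trans gw (isG_app (elemV s0))) => z; rewrite /f' appKV.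
apply: (exist_aa (x := elemM (elemV s1) x0) (X := l) _ gf') => [|w].
  by rewrite /= hl nonaffMl // nonaffV.
rewrite !tv_cons !appM -!hF /f' appKV FinvK h0; congr (tsw _).
by rewrite -[F _](appKV s1) h1 !appVK.
Qed.

(** After conjugation by [s0], the elementary involution becomes x0^-1 e1 x0, still nonaffine
    because [x0] is affine. *)
Lemma conj_ae g (F Finv r0 r1 : map2) s0 e1 x0 l :
  cancel Finv F -> nonaff e1 -> ~~ nonaff x0 -> all nonaff l ->
  (forall z, r0 (app s0 z) = app s0 (tsw z)) -> r1 =1 app e1 -> involution r1 ->
  (forall z, F (app s0 z) = app x0 (tv l z)) ->
  conjG g (fun z => Finv (r1 (F (r0 z)))) ->
  exists hs e1, all_normal hs /\ einv_normal e1 /\ cred_map (N_ea hs e1) /\ conjG g (N_ea hs e1).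
Proof.
move=> FinvK n1 a0 hl h0 h1 inv1 hF gw.
pose f' z := app (elemV s0) (Finv (r1 (F (r0 (app s0 z))))).
have gf' : conjG g f'.
  by apply: (conjG_trans gw (isG_app (elemV s0))) => z; rewrite /f' appKV.
apply: (exist_ea hl (nonaff_conj n1 a0) (involution_conj _ h1 inv1) gf') => w.
by rewrite -[LHS](appVK x0) -hF /f' appKV FinvK h0 hF h1 !appM.
Qed.

(** Without inner letters, conjugation by t s1^-1 turns r1 r0 into (s1^-1 e0 s1) t. *)
Lemma conj_ea_nil g (r0 r1 : map2) e0 s1 :
  nonaff e0 -> ~~ nonaff s1 -> r0 =1 app e0 -> involution r0 ->
  (forall z, r1 (app s1 z) = app s1 (tsw z)) -> conjG g (fun z => r1 (r0 z)) ->
  exists hs e1, all_normal hs /\ einv_normal e1 /\ cred_map (N_ea hs e1) /\ conjG g (N_ea hs e1).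
Proof.
move=> n0 a1 h0 inv0 h1 gw.
pose f' z := tsw (app (elemV s1) (r1 (r0 (app s1 (tsw z))))).
have gf' : conjG g f'.
  apply: (conjG_trans gw (isG_comp isG_tsw (isG_app (elemV s1)))) => z.
  by rewrite /f' /= tswK appKV.
apply: (exist_ea (X := [::]) _ (nonaff_conj n0 a1) (involution_conj _ h0 inv0) gf') => // w.
by rewrite !tv_nil /f' -[r0 _](appKV s1) h1 appVK tswK h0 !appM.
Qed.

(* Conjugating by F r0 turns F^-1 r1 F r0 into F r0 F^-1 r1, which exchanges the roles
   of the two involutions. *)
Lemma conj_ea g (F Finv r0 r1 : map2) e0 s1 s' x0 l :
  cancel F Finv -> cancel Finv F -> nonaff e0 -> ~~ nonaff s1 -> ~~ nonaff s' ->
  nonaff x0 -> all nonaff l -> r0 =1 app e0 -> involution r0 ->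
  (forall z, r1 (app s1 z) = app s1 (tsw z)) ->
  (forall z, F z = app x0 (tv l (tsw (app s' z)))) ->
  conjG g (fun z => Finv (r1 (F (r0 z)))) ->
  exists hs e1, all_normal hs /\ einv_normal e1 /\ cred_map (N_ea hs e1) /\ conjG g (N_ea hs e1).
Proof.
move=> FK FinvK n0 a1 as' nx hl h0 inv0 h1 hF gw.
pose Y := elemM (elemV s1) x0 :: l; pose G := rev (map elemV Y).
have EH z : app (elemV s1) (F z) = tsw (tv Y (tsw (app s' z))).
  by rewrite hF /Y tv_cons tswK appM.
pose f' z := app (elemV s1) (F (r0 (Finv (app s1 (tsw z))))).
have Gu : isG (fun z => app (elemV s1) (F (r0 z))).
  apply: (@eq_isG (app (elemV s1) \o (app x0 \o (tv l \o (tsw \o (app s' \o app e0)))))).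
    by move=> z /=; rewrite hF h0.
  do 5!(apply: isG_comp; first by [exact: isG_app|exact: isG_tv|exact: isG_tsw]).
  exact: isG_app.
have gf' : conjG g f'.
  apply: (conjG_trans gw Gu) => z; rewrite /f'.
  by rewrite -[F (r0 z) in RHS](appKV s1) h1.
have hG : all nonaff G.
  by rewrite all_nonaff_rev_inv /= hl nonaffMl // nonaffV.
have as'V : ~~ nonaff (elemV s') by rewrite nonaffV.
apply: (exist_ea hG (nonaff_conj n0 as'V) (involution_conj _ h0 inv0) gf') => w.
have EG v : tv G v = app s' (Finv (app s1 v)).
  by rewrite -{1}[v](appVK s1) -{1}[app s1 v]FinvK EH tv_rev_inv.
rewrite EG /f' appKV FK !appM EG h0.
by rewrite app_elemVV appVK.
Qed.

(** Conjugation by s' leaves the word t l1 t l2 ... t between the elementary involutions s' e0 s'^-1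
    and x0^-1 e1 x0. *)
Lemma conj_ee g (F Finv r0 r1 : map2) e0 e1 s' x0 l :
  cancel Finv F -> nonaff e0 -> nonaff e1 -> ~~ nonaff s' ->
  ~~ nonaff x0 -> all nonaff l -> r0 =1 app e0 -> involution r0 -> r1 =1 app e1 -> involution r1 ->
  (forall z, F z = app x0 (tv l (tsw (app s' z)))) ->
  conjG g (fun z => Finv (r1 (F (r0 z)))) ->
  exists hs e0 e1, all_normal hs /\ einv_normal e0 /\ einv_normal e1 /\
    cred_map (N_ee hs e0 e1) /\ conjG g (N_ee hs e0 e1).
Proof.
move=> FinvK n0 n1 as' ax hl h0 inv0 h1 inv1 hF gw.
pose f' z := app s' (Finv (r1 (F (r0 (app (elemV s') z))))).
have gf' : conjG g f'.
  by apply: (conjG_trans gw (isG_app s')) => z; rewrite /f' appVK.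
have as'V : ~~ nonaff (elemV s') by rewrite nonaffV.
apply: (exist_ee hl (nonaff_conj n0 as'V) (involution_conj _ h0 inv0)
  (nonaff_conj n1 ax) (involution_conj _ h1 inv1) gf') => w.
rewrite -[LHS](appVK x0) -hF FinvK hF h1 h0 !appM app_elemVV.
by [].
Qed.

Theorem theorem3p5 (g : map2) (m : nat) (f finv : nat -> map2) (r0 r1 : map2) :
  (forall i, (i < m)%N -> finv i \o f i =1 id /\ f i \o finv i =1 id) ->
  involution r0 -> involution r1 ->
  (isAff r0 \/ isElem r0) -> (isAff r1 \/ isElem r1) ->
  let w := [seq finv i | i <- iota 0 m] ++ [:: r1] ++
           [seq f i | i <- rev (iota 0 m)] ++ [:: r0] in
  reduced w -> conjG g (compw w) ->
  (* (N_aa) *)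
  (isAff r0 /\ isAff r1 ->
     (exists hs, all_normal hs /\ cred_map (N_aa hs) /\ conjG g (N_aa hs)) /\
     (exists L : seq (seq (C * {poly C})), forall hs,
        all_normal hs -> cred_map (N_aa hs) -> conjG g (N_aa hs) -> hs \in L)) /\
  (* (N_ea) *)
  ((isAff r0 /\ isElem r1) \/ (isElem r0 /\ isAff r1) ->
     (exists hs e1, all_normal hs /\ einv_normal e1 /\
        cred_map (N_ea hs e1) /\ conjG g (N_ea hs e1)) /\
     (exists L : seq (seq (C * {poly C}) * (nat * {poly C})), forall hs e1,
        all_normal hs -> einv_normal e1 -> cred_map (N_ea hs e1) ->
        conjG g (N_ea hs e1) -> (hs, e1) \in L)) /\
  (* (N_ee) *)
  (isElem r0 /\ isElem r1 ->
     (exists hs e0 e1, all_normal hs /\ einv_normal e0 /\ einv_normal e1 /\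
        cred_map (N_ee hs e0 e1) /\ conjG g (N_ee hs e0 e1)) /\
     (exists L : seq (seq (C * {poly C}) * (nat * {poly C}) * (nat * {poly C})),
        forall hs e0 e1,
        all_normal hs -> einv_normal e0 -> einv_normal e1 ->
        cred_map (N_ee hs e0 e1) -> conjG g (N_ee hs e0 e1) -> (hs, e0, e1) \in L)).
Proof.
move=> hf inv0 inv1 _ _ w.
pose fs := [seq f i | i <- rev (iota 0 m)]; pose F := compw fs.
pose Finv := compw [seq finv i | i <- iota 0 m].
have [|FK FinvK] := @compw_inv f finv (iota 0 m); first by move=> i; rewrite mem_iota; exact: hf.
rewrite -/F -/Finv in FK FinvK.
(* The kinds of the letters are read off from the suffix r1 F r0; the prefix is the inverse of F. *)
rewrite /w => /reduced_suffix red gw0.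
have gw : conjG g (fun z => Finv (r1 (F (r0 z)))).
  by apply: (conjG_trans gw0 (isG_app elem1)) => z; rewrite !app1 compw_cat /= compw_cat.
have {}red : reduced (r1 :: fs ++ [:: r0]) by [].
have l1 := reduced_letter red.
have l0 : letter r0 by apply: (@reduced_letter _ [::]); exact: (reduced_suffix (v := r1 :: fs)) red.
have [y [u [Ey hy]]] : exists y u, fs ++ [:: r0] = y :: u /\ y = head r0 fs.
  by case: (fs) => [|y fs'] /=; eexists; eexists; split.
have := red; rewrite Ey => red'; have [_ ns ry] := reduced_cons red'; rewrite -Ey in ry.
have ly : letter y by move: ry; rewrite Ey; exact: reduced_letter.
have [k1 k2] := next_kind l1 ly ns; rewrite hy in k1 k2.
have affk r : letter r -> isAff r -> aff_only r.
  by move=> [_ h] h'; split=> // h''; apply: h.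
have elemk r : letter r -> isElem r -> elem_only r.
  by move=> [_ h] h'; split=> // h''; apply: h.
(* Next to an elementary [r0] the letter of F applied first is affine, of the form s t s'; its
   factor s' is kept apart, to be used later for conjugating [r0]. *)
have start : elem_only r0 -> fs = [::] \/ exists s' x0 l, [/\ ~~ nonaff s', all nonaff l,
    forall z, F z = app x0 (tv l (tsw (app s' z))),
    aff_only (head r0 fs) -> ~~ nonaff x0 & elem_only (head r0 fs) -> nonaff x0].
  move=> k0; case/lastP E : fs => [|fs' r]; [by left|right].
  rewrite E cat_rcons in ry; have red2 := reduced_suffix ry.
  have [lr nsr _] := reduced_cons red2.
  have ar : aff_only r.
    case: (letter_cases lr) => // er; case: nsr.
    by right; split; [case: er|case: k0].
  have [s [s' [as_ as' hs]]] := aff_only_ex ar.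
  have [|x0 [l [hl EF ha he]]] := @compw_normal fs' r [:: r0] r (tsw \o app s') ry ar.
    by exists s => // z; rewrite hs.
  have hd : head r0 (rcons fs' r) = head r fs' by case: (fs').
  exists s', x0, l; rewrite hd; split=> // z.
  by rewrite /F E -cats1 compw_cat /= EF.
split; last split.
- move=> [/(affk _ l0) A0 /(affk _ l1) A1]; split; last first.
    by have [L hL] := unique_aa g; exists L => hs h1 _ h2; exact: hL.
  have [s0 [as0 E0]] := aff_involution A0 inv0.
  have [s1 [as1 E1]] := aff_involution A1 inv1.
  have [|x0 [l [hl EF ha he]]] := @compw_normal fs r0 [::] (app s0) id ry A0.
    by exists s0.
  exact: conj_aa FinvK as1 (he (k1 A1)) hl E0 E1 EF gw.
- move=> k; split; last first.
    by have [L hL] := unique_ea g; exists L => hs e1 h1 h2 _ h3; exact: (hL (hs, e1)).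
  case: k => [[/(affk _ l0) A0 /(elemk _ l1) A1]|[/(elemk _ l0) A0 /(affk _ l1) A1]].
    have [s0 [as0 E0]] := aff_involution A0 inv0.
    have [e1 n1 E1] := elem_only_ex A1.
    have [|x0 [l [hl EF ha he]]] := @compw_normal fs r0 [::] (app s0) id ry A0.
      by exists s0.
    exact: conj_ae FinvK n1 (ha (k2 A1)) hl E0 E1 inv1 EF gw.
  have [e0 n0 E0] := elem_only_ex A0.
  have [s1 [as1 E1]] := aff_involution A1 inv1.
  case: (start A0) => [fs0|[s' [x0 [l [as' hl EF ha he]]]]].
    have m0 : m = 0%N by move: (congr1 size fs0); rewrite size_map size_rev size_iota.
    have gw' : conjG g (fun z => r1 (r0 z)).
      apply: (conjG_trans gw (isG_app elem1)) => z; rewrite !app1 /F fs0 /Finv m0 //.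
    exact: conj_ea_nil n0 as1 E0 inv0 E1 gw'.
  exact: conj_ea FK FinvK n0 as1 as' (he (k1 A1)) hl E0 inv0 E1 EF gw.
- move=> [/(elemk _ l0) A0 /(elemk _ l1) A1]; split; last first.
    have [L hL] := unique_ee g; exists L => hs e0 e1 h1 h2 h3 _ h4.
    by apply: (hL (hs, e0, e1)).
  have [e0 n0 E0] := elem_only_ex A0; have [e1 n1 E1] := elem_only_ex A1.
  case: (start A0) => [fs0|[s' [x0 [l [as' hl EF ha he]]]]].
    (* Two adjacent elementary involutions would contradict reducedness, so F has letters. *)
    by have := k2 A1; rewrite fs0 /= => /aff_elem_only/(_ A0).
  exact: conj_ee FinvK n0 n1 as' (ha (k2 A1)) hl E0 inv0 E1 inv1 EF gw.
Qed.
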